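(* Let $m\in\mathbb{R}$ and let $\sigma\in M^{m}_{\rho,\Lambda}(\mathbb{Z}^n\times\mathbb{T}^n)$ be $M$-elliptic. Then there exists a symbol $\tau\in M^{-m}_{\rho,\Lambda}(\mathbb{Z}^n\times\mathbb{T}^n)$ such that $$T_\tau T_\sigma=I+R\qquad\text{and}\qquad T_\sigma T_\tau=I+S,$$ where $R$ and $S$ are pseudo-differential operators with symbols in $M^{-\infty}_{\rho,\Lambda}(\mathbb{Z}^n\times\mathbb{T}^n)=\bigcap_{r\in\mathbb{R}}M^{r}_{\rho,\Lambda}(\mathbb{Z}^n\times\mathbb{T}^n)$.
   Context: Write $\mathbb{T}^n=\mathbb{R}^n/\mathbb{Z}^n$ and $\mathbb{N}_0=\{0,1,2,\dots\}$. For $f$ on $\mathbb{Z}^n$ set $\Delta_{k_j}f(k)=f(k+e_j)-f(k)$ ($e_j$ the $j$-th unit vector) and $\Delta_k^\alpha=\Delta_{k_1}^{\alpha_1}\cdots\Delta_{k_n}^{\alpha_n}$ for $\alpha\in\mathbb{N}_0^n$. On smooth functions on $\mathbb{T}^n$ set $D_x^{(\beta)}=D_{x_1}^{(\beta_1)}\cdots D_{x_n}^{(\beta_n)}$, where $D_{x_j}^{(0)}=I$ and $D_{x_j}^{(\ell)}=\prod_{m=0}^{\ell-1}\big(\frac{1}{2\pi i}\frac{\partial}{\partial x_j}-m\big)$ for $\ell\ge1$. Write $k^\gamma=k_1^{\gamma_1}\cdots k_n^{\gamma_n}$. Weight function: $\Lambda:\mathbb{Z}^n\to(0,\infty)$ is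 a weight function if there are positive constants $\mu_0\le\mu_1\le\mu$ and $C_0,C_1$ with $C_0(1+|k|)^{\mu_0}\le\Lambda(k)\le C_1(1+|k|)^{\mu_1}$ for all $k\in\mathbb{Z}^n$, and for all $\alpha\in\mathbb{N}_0^n$, $\gamma\in\{0,1\}^n$ there is $C_{\alpha,\gamma}>0$ with $|k^\gamma\Delta_k^{\alpha+\gamma}\Lambda(k)|\le C_{\alpha,\gamma}\Lambda(k)^{1-|\alpha|/\mu}$ for all $k\in\mathbb{Z}^n$. Fix such a $\Lambda$ (with its constants) and $\rho\in(0,1/\mu]$. Symbol classes: for $m\in\mathbb{R}$, $S^m_{\rho,\Lambda}(\mathbb{Z}^n\times\mathbb{T}^n)$ is the set of $\sigma:\mathbb{Z}^n\times\mathbb{T}^n\to\mathbb{C}$, smooth in $x$ for every $k$, such that for all $\alpha,\beta\in\mathbb{N}_0^n$ there is a constant $C>0$ with $|D_x^{(\beta)}\Delta_k^\alpha\sigma(k,x)|\le C\Lambda(k)^{m-\rho|\alpha|}$ for all $(k,x)$. $M^m_{\rho,\Lambda}(\mathbb{Z}^n\times\mathbb{T}^n)$ is the set of $\sigma:\mathbb{Z}^n\times\mathbb{T}^n\to\mathbb{C}$, smooth in $x$ for every $k$, such that $k^\gamma\Delta_k^\gamma\sigma(k,x)\in S^m_{\rho,\Lambda}(\mathbb{Z}^n\times\mathbb{T}^n)$ for all $\gamma\in\{0,1\}^n$. Operators: $\mathcal{S}(\mathbb{Z}^n)$ is the space of rapidly decreasing functions on $\mathbb{Z}^n$. For $f\in\mathcal{S}(\mathbb{Z}^n)$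 put $\widehat f(x)=\sum_{k\in\mathbb{Z}^n}e^{-2\pi i k\cdot x}f(k)$ and $T_\sigma f(k)=\int_{\mathbb{T}^n}e^{2\pi i k\cdot x}\sigma(k,x)\widehat f(x)\,dx$. Identities between operators are understood on $\mathcal{S}(\mathbb{Z}^n)$. $M$-ellipticity: $\sigma\in M^m_{\rho,\Lambda}(\mathbb{Z}^n\times\mathbb{T}^n)$ is $M$-elliptic if there are positive constants $C,R_1$ with $|\sigma(k,x)|\ge C\Lambda(k)^m$ for all $x\in\mathbb{T}^n$ and all $k\in\mathbb{Z}^n$ with $|k|\ge R_1$. *)

(* Defs.v *)
From HB Require Import structures.
From mathcomp Require Import all_boot all_order all_algebra.
From mathcomp Require Import complex.
From mathcomp Require Import all_classical all_reals all_analysis.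

Set Implicit Arguments.
Unset Strict Implicit.
Unset Printing Implicit Defensive.

Import Order.TTheory GRing.Theory Num.Theory.
Import numFieldNormedType.Exports.

Local Open Scope classical_set_scope.
Local Open Scope ring_scope.

(* Functions on the torus R^n / Z^n are functions on 'rV[R]_n that are
   invariant under translation by integer vectors (see [torus_smooth]);
   multi-indices in N^n are functions 'I_n -> nat, and those in {0,1}^n are
   functions 'I_n -> bool. *)

Definition cabs {R : realType} (z : R[i]) : R := Normc.normc z.

Definition enorm {R : realType} {n : nat} (k : 'rV[int]_n) : R :=
  Num.sqrt (\sum_(j < n) ((k ord0 j)%:~R : R) ^+ 2).

Definition mlength {n : nat} (a : 'I_n -> nat) : nat := (\sum_(j < n) a j)%N.

Definition monomial {V : nzRingType} {n : nat} (k : 'rV[int]_n)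
    (g : 'I_n -> bool) : V :=
  \prod_(j < n) ((k ord0 j)%:~R : V) ^+ g j.

Definition diff1 {V : zmodType} {n : nat} (j : 'I_n) (f : 'rV[int]_n -> V) :
    'rV[int]_n -> V :=
  fun k => f (k + delta_mx ord0 j) - f k.

Definition diffm {V : zmodType} {n : nat} (a : 'I_n -> nat) :
    ('rV[int]_n -> V) -> ('rV[int]_n -> V) :=
  \big[comp/idfun]_(j < n) iter (a j) (diff1 j).

Definition rpartial {R : realType} {n : nat} (j : 'I_n) (g : 'rV[R]_n -> R) :
    'rV[R]_n -> R :=
  fun x => 'D_(delta_mx ord0 j) g x.

Definition cpartial {R : realType} {n : nat} (j : 'I_n) (g : 'rV[R]_n -> R[i]) :
    'rV[R]_n -> R[i] :=
  fun x => Complex (rpartial j (fun y => complex.Re (g y)) x)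
                   (rpartial j (fun y => complex.Im (g y)) x).

(* C^oo on R^n: the iterated partial derivatives of all orders, taken in any
   sequence of directions, exist and are continuous. *)
Definition rsmooth {R : realType} {n : nat} (g : 'rV[R]_n -> R) : Prop :=
  forall s : seq 'I_n, let h := foldr rpartial g s in
    continuous h /\ forall (j : 'I_n) x, derivable h x (delta_mx ord0 j).

Definition torus_smooth {R : realType} {n : nat} (g : 'rV[R]_n -> R[i]) : Prop :=
  [/\ forall x (l : 'rV[int]_n), g (x + map_mx intr l) = g x,
      rsmooth (fun x => complex.Re (g x)) &
      rsmooth (fun x => complex.Im (g x))].

Fixpoint Dfact1 {R : realType} {n : nat} (j : 'I_n) (l : nat)
    (g : 'rV[R]_n -> R[i]) : 'rV[R]_n -> R[i] :=
  if l is m.+1 then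
    let h := Dfact1 j m g in
    fun x => (Complex 0 (2 * pi))^-1 * cpartial j h x - m%:R * h x
  else g.

Definition Dfact {R : realType} {n : nat} (b : 'I_n -> nat) :
    ('rV[R]_n -> R[i]) -> ('rV[R]_n -> R[i]) :=
  \big[comp/idfun]_(j < n) Dfact1 j (b j).

Definition weight_function {R : realType} {n : nat} (mu0 mu1 mu C0 C1 : R)
    (Lam : 'rV[int]_n -> R) : Prop :=
  [/\ [/\ 0 < mu0, mu0 <= mu1 & mu1 <= mu], 0 < C0 /\ 0 < C1,
      forall k, 0 < Lam k,
      forall k, C0 * (1 + enorm k) `^ mu0 <= Lam k
                /\ Lam k <= C1 * (1 + enorm k) `^ mu1 &
      forall (a : 'I_n -> nat) (g : 'I_n -> bool), exists2 C : R, 0 < C &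
        forall k,
          `|monomial k g * diffm (fun j => a j + g j)%N Lam k|
            <= C * Lam k `^ (1 - (mlength a)%:R / mu)].

Definition symbol (R : realType) (n : nat) : Type :=
  'rV[int]_n -> 'rV[R]_n -> R[i].

Definition symbol_diff {R : realType} {n : nat} (a : 'I_n -> nat)
    (s : symbol R n) : symbol R n :=
  fun k x => diffm a (fun l => s l x) k.

Definition S_class {R : realType} {n : nat} (Lam : 'rV[int]_n -> R) (rho m : R)
    (s : symbol R n) : Prop :=
  (forall k, torus_smooth (s k)) /\
  forall a b : 'I_n -> nat, exists2 C : R, 0 < C &
    forall k x, cabs (Dfact b (symbol_diff a s k) x)
                  <= C * Lam k `^ (m - rho * (mlength a)%:R).

Definition M_class {R : realType} {n : nat} (Lam : 'rV[int]_n -> R) (rho m : R)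
    (s : symbol R n) : Prop :=
  (forall k, torus_smooth (s k)) /\
  forall g : 'I_n -> bool,
    S_class Lam rho m (fun k x => monomial k g * symbol_diff g s k x).

Definition M_class_infty {R : realType} {n : nat} (Lam : 'rV[int]_n -> R)
    (rho : R) (s : symbol R n) : Prop :=
  forall r : R, M_class Lam rho r s.

Definition M_elliptic {R : realType} {n : nat} (Lam : 'rV[int]_n -> R) (m : R)
    (s : symbol R n) : Prop :=
  exists C R1 : R, [/\ 0 < C, 0 < R1 &
    forall k x, R1 <= enorm k -> C * Lam k `^ m <= cabs (s k x)].

Definition schwartz {R : realType} {n : nat} (f : 'rV[int]_n -> R[i]) : Prop :=
  forall N : nat, exists C : R,
    forall k, cabs (f k) <= C * (1 + enorm k) ^- N.

(* Unordered sum of an absolutely summable family; the value is not meaningful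
   for other families. *)
Definition rsum {R : realType} {I : choiceType} (u : I -> R) : R :=
  fine (\esum_(i in [set: I]) ((EFin \o u)^\+%E i))
  - fine (\esum_(i in [set: I]) ((EFin \o u)^\-%E i)).

Definition csum {R : realType} {I : choiceType} (u : I -> R[i]) : R[i] :=
  Complex (rsum (fun i => complex.Re (u i))) (rsum (fun i => complex.Im (u i))).

(* Integral over R^n / Z^n with its normalized measure, as the iterated
   Lebesgue integral over the cube [0,1]^n; it is used for continuous
   integrands only. *)
Fixpoint rtorus_int {R : realType} (n : nat) : ('rV[R]_n -> R) -> R :=
  match n with
  | 0%N => fun g => g 0
  | p.+1 => fun g =>
      (\int[@lebesgue_measure R]_(t in `[0%R, 1%R])
         rtorus_int (fun y : 'rV[R]_p => g (row_mx (t%:M : 'rV[R]_1) y)))%R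
  end.

Definition torus_int {R : realType} {n : nat} (g : 'rV[R]_n -> R[i]) : R[i] :=
  Complex (rtorus_int (fun x => complex.Re (g x)))
          (rtorus_int (fun x => complex.Im (g x))).

Definition cis {R : realType} (t : R) : R[i] := Complex (cos t) (sin t).

Definition phase {R : realType} {n : nat} (k : 'rV[int]_n) (x : 'rV[R]_n) : R :=
  2 * pi * \sum_(j < n) (k ord0 j)%:~R * x ord0 j.

Definition fourier {R : realType} {n : nat} (f : 'rV[int]_n -> R[i]) :
    'rV[R]_n -> R[i] :=
  fun x => csum (fun k => cis (- phase k x) * f k).

Definition pdo {R : realType} {n : nat} (s : symbol R n)
    (f : 'rV[int]_n -> R[i]) : 'rV[int]_n -> R[i] :=
  fun k => torus_int (fun x => cis (phase k x) * s k x * fourier f x).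

(* Main.v *)
Require Import Defs.
From mathcomp Require Import all_boot all_order all_algebra.
From mathcomp Require Import complex.
From mathcomp Require Import all_classical all_reals all_analysis.
From mathcomp Require Import ring lra zify.

Set Implicit Arguments.
Unset Strict Implicit.
Unset Printing Implicit Defensive.

Import Order.TTheory GRing.Theory Num.Theory.
Import numFieldNormedType.Exports.

Local Open Scope classical_set_scope.
Local Open Scope ring_scope.

(** The operator with symbol [s] acts on a rapidly decreasing [f] by

      [pdo s f k = \sum_p a k p * f (k + p)],

    where [a k] is the family of Fourier coefficients of [s k]: this is what
    remains of the oscillatory integral once the Fourier series of [f] is
    inserted ([pdo_op_of]). A symbol is thus the same thing as a coefficient
    array [a], and the whole calculus is carried out on arrays. A symbol of
    class M corresponds to an array that decreases faster than any power of
    [p], with constants [Lam k `^ m], the difference operators in [k] and the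
    weights [k_j] acting in the same way on both sides ([M_class_mclass] and
    [mclass_fsymbol_M_class]). The first direction needs smoothness turned
    into decay by integration by parts, the second needs termwise
    differentiation of Fourier series.

    On arrays the product of operators is the twisted convolution

      [coef_comp a b k p = \sum_q a k q * b (k + q) (p - q)],

    which is associative ([compA], an exchange of absolutely convergent double
    sums), and the pointwise product of symbols is the convolution
    [coef_conv a b] obtained by replacing [b (k + q)] by [b k]. The two differ
    by first differences of [b] along a path from [k] to [k + q], which gain a
    factor [Lam k `^ (- rho)]; the length of the path and the variation of
    [Lam] along it are polynomial in [q], and the decay of [a k q] in [q]
    absorbs them ([has_order_comp_err], [mclass_comp_err]). No expansion
    beyond this first term is made. That [Lam] varies at most polynomially
    ([weight_moderate]) follows from the estimate of its first differences: it
    says that [Lam `^ (1 / mu)] has bounded increments.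

    The reciprocal of an elliptic symbol, modified where ellipticity says
    nothing, has an array [b] which inverts that of the symbol for the
    pointwise product ([elliptic_reciprocal]): this uses Fourier inversion,
    hence the uniqueness of Fourier coefficients ([trig_unique]). The estimates
    for [b] come from those of the symbol through the Leibniz rule
    ([mclass_reciprocal]). The operator products of [a] and [b] are then the
    identity up to arrays of order [- rho]. A Neumann series, summed
    asymptotically, removes these errors up to arrays of order [- oo], on each
    side separately, and associativity shows that the left and the right
    parametrices so obtained agree up to such an array
    ([coefficient_parametrix]). *)

(** * Complex modulus and unordered sums *)

Section Modulus.
Variable R : realType.
Implicit Types z w : R[i].

Lemma cabs_ge0 z : 0 <= cabs z.
Proof. by case: z => a b; rewrite /cabs /= sqrtr_ge0. Qed.

Lemma cabsM z w : cabs (z * w) = cabs z * cabs w.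
Proof. exact: Normc.normcM. Qed.

Lemma cabsV z : cabs z^-1 = (cabs z)^-1.
Proof. exact: Normc.normcV. Qed.

Lemma cabsN z : cabs (- z) = cabs z.
Proof. exact: normcN. Qed.

Lemma cabsD z w : cabs (z + w) <= cabs z + cabs w.
Proof. exact: le_normcD. Qed.

Lemma cabsB z w : cabs (z - w) <= cabs z + cabs w.
Proof. by rewrite -(cabsN w) cabsD. Qed.

Lemma cabsBC z w : cabs (z - w) = cabs (w - z).
Proof. by rewrite -cabsN opprB. Qed.

Lemma cabs0 : cabs (0 : R[i]) = 0.
Proof. exact: Normc.normc0. Qed.

Lemma cabs1 : cabs (1 : R[i]) = 1.
Proof. exact: Normc.normc1. Qed.

Lemma cabs0_eq0 z : cabs z <= 0 -> z = 0.
Proof.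
by move=> h; apply: Normc.eq0_normc; apply/eqP; rewrite eq_le h cabs_ge0.
Qed.

Lemma cabs_gt0 z : (0 < cabs z) = (z != 0).
Proof.
apply/idP/idP => [h|/eqP h]; first by apply/eqP => z0; rewrite z0 cabs0 ltxx in h.
by rewrite ltNge; apply/negP => /cabs0_eq0.
Qed.

Lemma cabs_real (a : R) : cabs (Complex a 0) = `|a|.
Proof. by rewrite /cabs /= expr0n addr0 sqrtr_sqr. Qed.

Lemma cabs_imag (a : R) : cabs (Complex 0 a) = `|a|.
Proof. by rewrite /cabs /= expr0n add0r sqrtr_sqr. Qed.

Lemma cabs_natr k : cabs (k%:R : R[i]) = k%:R.
Proof. by rewrite -(rmorph_nat (real_complex R)) cabs_real normr_nat. Qed.

Lemma cabs_intr (k : int) : cabs (k%:~R : R[i]) = `|k%:~R|.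
Proof. by rewrite -(rmorph_int (real_complex R)) cabs_real. Qed.

Lemma Re_le_cabs z : `|complex.Re z| <= cabs z.
Proof.
by case: z => a b; rewrite /cabs /= -sqrtr_sqr ler_sqrt ?lerDl ?addr_ge0 ?sqr_ge0.
Qed.

Lemma Im_le_cabs z : `|complex.Im z| <= cabs z.
Proof.
by case: z => a b; rewrite /cabs /= -sqrtr_sqr ler_sqrt ?lerDr ?addr_ge0 ?sqr_ge0.
Qed.

Lemma complex_splitE z : z = Complex (complex.Re z) 0 + Complex 0 (complex.Im z).
Proof. by case: z => a b; apply/eqP; rewrite eq_complex /= !addr0 add0r !eqxx. Qed.

Lemma cabs_le_ReIm z : cabs z <= `|complex.Re z| + `|complex.Im z|.
Proof. by rewrite {1}(complex_splitE z) (le_trans (cabsD _ _)) // cabs_real cabs_imag. Qed.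

Lemma cabs_sum (I : Type) (F : seq I) (u : I -> R[i]) :
  cabs (\sum_(i <- F) u i) <= \sum_(i <- F) cabs (u i).
Proof.
elim: F => [|i F IH]; first by rewrite !big_nil cabs0.
by rewrite !big_cons (le_trans (cabsD _ _)) // lerD2l.
Qed.

Lemma cabs_sum_cond (I : Type) (F : seq I) (P : pred I) (u : I -> R[i]) :
  cabs (\sum_(i <- F | P i) u i) <= \sum_(i <- F | P i) cabs (u i).
Proof. by rewrite -big_filter -[leRHS]big_filter cabs_sum. Qed.

Lemma eq_small_cabs z w : (forall e : R, 0 < e -> cabs (z - w) <= e) -> z = w.
Proof.
move=> h; apply/eqP; rewrite -subr_eq0; apply/eqP/cabs0_eq0.
rewrite leNgt; apply/negP => h0.
have := h (cabs (z - w) / 2) (divr_gt0 h0 (ltr0Sn R 1)); rewrite leNgt.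
by rewrite ltr_pdivrMr // mulr_natr mulr2n ltrDl h0.
Qed.

Lemma cReM z w : complex.Re (z * w) =
  complex.Re z * complex.Re w - complex.Im z * complex.Im w.
Proof. by case: z w => [a b] [c d]. Qed.

Lemma cImM z w : complex.Im (z * w) =
  complex.Re z * complex.Im w + complex.Im z * complex.Re w.
Proof. by case: z w => [a b] [c d]. Qed.

Lemma cReD z w : complex.Re (z + w) = complex.Re z + complex.Re w.
Proof. by case: z w => [a b] [c d]. Qed.

Lemma cImD z w : complex.Im (z + w) = complex.Im z + complex.Im w.
Proof. by case: z w => [a b] [c d]. Qed.

Lemma cReN z : complex.Re (- z) = - complex.Re z.
Proof. by case: z. Qed.

Lemma cImN z : complex.Im (- z) = - complex.Im z.
Proof. by case: z. Qed.

Lemma cRe_sum (I : Type) (F : seq I) (u : I -> R[i]) :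
  complex.Re (\sum_(i <- F) u i) = \sum_(i <- F) complex.Re (u i).
Proof. by elim/big_rec2: _ => // i x y _ <-; rewrite cReD. Qed.

Lemma cIm_sum (I : Type) (F : seq I) (u : I -> R[i]) :
  complex.Im (\sum_(i <- F) u i) = \sum_(i <- F) complex.Im (u i).
Proof. by elim/big_rec2: _ => // i x y _ <-; rewrite cImD. Qed.

End Modulus.

Section UnorderedSums.
Variables (R : realType) (I : choiceType).
Implicit Types (u v : I -> R[i]) (F : seq I).

Definition abs_summable u :=
  exists B : R, forall F, uniq F -> \sum_(i <- F) cabs (u i) <= B.

(** Convergence of the net of finite partial sums; limits along a net are
    unique and additive, which gives all the algebra of [csum]. *)
Definition has_sum u (S : R[i]) := forall e : R, 0 < e -> exists2 F0, uniq F0 &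
  forall F, uniq F -> {subset F0 <= F} -> cabs (\sum_(i <- F) u i - S) <= e.

Lemma big_subset_ge0 (v : I -> R) F0 F : (forall i, 0 <= v i) -> uniq F0 -> uniq F ->
  {subset F0 <= F} -> \sum_(i <- F0) v i <= \sum_(i <- F) v i.
Proof.
move=> v0 uF0 uF sF; have -> : \sum_(i <- F0) v i = \sum_(i <- F | i \in F0) v i.
  rewrite -[RHS]big_filter; apply: perm_big; apply: uniq_perm => //.
    exact: filter_uniq.
  by move=> i; rewrite mem_filter; apply/idP/andP => [h|[]] //; rewrite h sF.
rewrite [leRHS](bigID (mem F0)) /=.
by rewrite lerDl sumr_ge0.
Qed.

(** The extended sum of a nonnegative family is the supremum of its finite
    partial sums, and a bound [B] on these makes it finite. *)
Lemma esum_nneg_sup (v : I -> R) (B : R) : (forall i, 0 <= v i) ->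
  (forall F, uniq F -> \sum_(i <- F) v i <= B) ->
  let S := fine (\esum_(i in [set: I]) (v i)%:E) in
  (forall F, uniq F -> \sum_(i <- F) v i <= S) /\
  forall e : R, 0 < e -> exists2 F0, uniq F0 & S - e < \sum_(i <- F0) v i.
Proof.
move=> v0 vB S.
have sumE (A : set I) : finite_set A -> (\sum_(i \in A) (v i)%:E)%E =
    (\sum_(i <- finmap.enum_fset (fset_set A)) v i)%:E by move=> fA; rewrite fsbig_finite //= sumEFin.
have le1 F : uniq F -> ((\sum_(i <- F) v i)%:E <= \esum_(i in [set: I]) (v i)%:E)%E.
  move=> uF; apply: esum_ge; exists [set` F]; first by split => //; exists F.
  rewrite -fsbig_seq // -sumEFin.
  by rewrite lexx.
have fin : (\esum_(i in [set: I]) (v i)%:E)%E \is a fin_num.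
  rewrite ge0_fin_numE; last by apply: esum_ge0 => i _; rewrite lee_fin.
  apply: (@le_lt_trans _ _ B%:E); last exact: ltry.
  apply: ge_ereal_sup => _ [A [fA _] <-].
  by rewrite sumE // lee_fin vB.
split=> [F uF|e e0]; first by rewrite -lee_fin fineK // le1.
have : (\esum_(i in [set: I]) (v i)%:E - e%:E < \esum_(i in [set: I]) (v i)%:E)%E.
  by rewrite lteBlDr // lteDl // lte_fin.
rewrite {2}/esum => /ereal_sup_gt [_ [A [fA _] <-]].
rewrite sumE // -(fineK fin) -EFinB lte_fin => h.
by exists (finmap.enum_fset (fset_set A)) => //; exact: finmap.fset_uniq.
Qed.

Lemma fine_esum_funepos (w : I -> R) :
  \esum_(i in [set: I]) ((EFin \o w)^\+%E i) =
  \esum_(i in [set: I]) (Num.max (w i) 0)%:E.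
Proof. by apply: eq_esum => i _; rewrite funeposE /= EFin_max. Qed.

Lemma fine_esum_funeneg (w : I -> R) :
  \esum_(i in [set: I]) ((EFin \o w)^\-%E i) =
  \esum_(i in [set: I]) (Num.max (- w i) 0)%:E.
Proof. by apply: eq_esum => i _; rewrite funenegE /= EFin_max. Qed.

(** Positive and negative parts are treated separately, each by
    [esum_nneg_sup]; a set of indices good for both is good for [w]. *)
Lemma rsum_net (w : I -> R) (B : R) :
  (forall F, uniq F -> \sum_(i <- F) `|w i| <= B) ->
  forall e : R, 0 < e -> exists2 F0, uniq F0 &
  forall F, uniq F -> {subset F0 <= F} -> `|\sum_(i <- F) w i - rsum w| <= e.
Proof.
move=> wB e e0.
pose p i := Num.max (w i) 0; pose q i := Num.max (- w i) 0.
have p0 i : 0 <= p i by rewrite le_max lexx orbT.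
have q0 i : 0 <= q i by rewrite le_max lexx orbT.
have pB F : uniq F -> \sum_(i <- F) p i <= B.
  move=> uF; apply: le_trans (wB F uF); apply: ler_sum => i _.
  by rewrite ge_max normr_ge0 ler_norm.
have qB F : uniq F -> \sum_(i <- F) q i <= B.
  move=> uF; apply: le_trans (wB F uF); apply: ler_sum => i _.
  by rewrite ge_max normr_ge0 -normrN ler_norm.
have [pS pe] := esum_nneg_sup p0 pB; have [qS qe] := esum_nneg_sup q0 qB.
rewrite /rsum fine_esum_funepos fine_esum_funeneg.
set P := fine _ in pS pe *; set Q := fine _ in qS qe *.
have [F1 uF1 h1] := pe e e0; have [F2 uF2 h2] := qe e e0.
exists (undup (F1 ++ F2)); first exact: undup_uniq.
move=> F uF sF.
have -> : \sum_(i <- F) w i = \sum_(i <- F) p i - \sum_(i <- F) q i.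
  rewrite -sumrB; apply: eq_bigr => i _; rewrite /p /q /Num.max.
  by case: (ltgtP (w i) 0) => h; case: ltP; lra.
have s1 : \sum_(i <- F1) p i <= \sum_(i <- F) p i.
  apply: big_subset_ge0 => // i iF; apply: sF.
  by rewrite mem_undup mem_cat iF.
have s2 : \sum_(i <- F2) q i <= \sum_(i <- F) q i.
  apply: big_subset_ge0 => // i iF; apply: sF.
  by rewrite mem_undup mem_cat iF orbT.
have := pS F uF; have := qS F uF; rewrite ler_norml; lra.
Qed.

Lemma csum_has_sum u : abs_summable u -> has_sum u (csum u).
Proof.
move=> [B uB] e e0; have e2 : 0 < e / 2 by rewrite divr_gt0.
have reB F : uniq F -> \sum_(i <- F) `|complex.Re (u i)| <= B.
  move=> uF; apply: le_trans (uB F uF); apply: ler_sum => i _; exact: Re_le_cabs.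
have imB F : uniq F -> \sum_(i <- F) `|complex.Im (u i)| <= B.
  move=> uF; apply: le_trans (uB F uF); apply: ler_sum => i _; exact: Im_le_cabs.
have [F1 uF1 h1] := rsum_net reB e2; have [F2 uF2 h2] := rsum_net imB e2.
exists (undup (F1 ++ F2)); first exact: undup_uniq.
move=> F uF sF; apply: (le_trans (cabs_le_ReIm _)).
rewrite cReD cImD cReN cImN cRe_sum cIm_sum /=.
have i1 := h1 F uF; have i2 := h2 F uF; rewrite [leRHS](splitr e); apply: lerD.
  by apply: i1 => i iF; apply: sF; rewrite mem_undup mem_cat iF.
by apply: i2 => i iF; apply: sF; rewrite mem_undup mem_cat iF orbT.
Qed.

Lemma has_sum_uniq u S T : has_sum u S -> has_sum u T -> S = T.
Proof.
move=> hS hT; apply: eq_small_cabs => e e0; have e2 : 0 < e / 2 by rewrite divr_gt0.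
have [F1 uF1 h1] := hS _ e2; have [F2 uF2 h2] := hT _ e2.
pose F := undup (F1 ++ F2); have uF : uniq F := undup_uniq _.
have {}h1 : cabs (\sum_(i <- F) u i - S) <= e / 2.
  by apply: h1 => // i iF; rewrite mem_undup mem_cat iF.
have {}h2 : cabs (\sum_(i <- F) u i - T) <= e / 2.
  by apply: h2 => // i iF; rewrite mem_undup mem_cat iF orbT.
have -> : S - T = (\sum_(i <- F) u i - T) - (\sum_(i <- F) u i - S) by ring.
by rewrite (le_trans (cabsB _ _)) // (splitr e) lerD.
Qed.

Lemma has_sumD u v S T : has_sum u S -> has_sum v T ->
  has_sum (fun i => u i + v i) (S + T).
Proof.
move=> hS hT e e0; have e2 : 0 < e / 2 by rewrite divr_gt0.
have [F1 uF1 h1] := hS _ e2; have [F2 uF2 h2] := hT _ e2.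
exists (undup (F1 ++ F2)) => [|F uF sF]; first exact: undup_uniq.
rewrite big_split /= opprD addrACA (le_trans (cabsD _ _)) // (splitr e).
apply: lerD; [apply: h1 => // i iF|apply: h2 => // i iF];
  by apply: sF; rewrite mem_undup mem_cat iF ?orbT.
Qed.

Lemma has_sumZ u S c : has_sum u S -> has_sum (fun i => c * u i) (c * S).
Proof.
move=> hS e e0; have c0 : 0 < cabs c + 1 by rewrite ltr_wpDl ?cabs_ge0.
have [F1 uF1 h1] := hS _ (divr_gt0 e0 c0).
exists F1 => // F uF sF; rewrite -mulr_sumr -mulrBr cabsM.
have := h1 F uF sF; rewrite ler_pdivlMr // => h; apply: le_trans h.
by rewrite mulrC ler_wpM2l ?cabs_ge0 // lerDl.
Qed.

Lemma has_sum_delta i0 c : has_sum (fun i => if i == i0 then c else 0) c.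
Proof.
move=> e e0; exists [:: i0] => // F uF sF.
rewrite -big_mkcond /= big_const_seq count_uniq_mem //.
by rewrite sF ?inE //= addr0 subrr cabs0 ltW.
Qed.

Lemma has_sum_le u S (B : R) : has_sum u S ->
  (forall F, uniq F -> \sum_(i <- F) cabs (u i) <= B) -> cabs S <= B.
Proof.
move=> hS uB; apply/ler_addgt0Pr => e e0; have [F0 uF0 /(_ F0 uF0) h] := hS _ e0.
have -> : S = \sum_(i <- F0) u i - (\sum_(i <- F0) u i - S) by ring.
rewrite (le_trans (cabsB _ _)) // lerD ?h //.
by rewrite (le_trans (cabs_sum _ _)) // uB.
Qed.

Lemma has_sum_reindex (h h' : I -> I) u S : cancel h h' -> cancel h' h ->
  has_sum u S -> has_sum (u \o h) S.
Proof.
move=> hK hK' hS e e0; have [F0 uF0 h0] := hS _ e0.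
exists (map h' F0) => [|F uF sF]; first by rewrite map_inj_uniq //; exact: can_inj hK'.
rewrite -(big_map h xpredT u); apply: h0.
  by rewrite map_inj_uniq //; exact: can_inj hK.
by move=> i iF; rewrite -(hK' i) map_f // sF // map_f.
Qed.

Lemma abs_summableD u v : abs_summable u -> abs_summable v ->
  abs_summable (fun i => u i + v i).
Proof.
move=> [B uB] [B' vB]; exists (B + B') => F uF.
apply: le_trans (lerD (uB F uF) (vB F uF)); rewrite -big_split /=.
by apply: ler_sum => i _; exact: cabsD.
Qed.

Lemma abs_summableZ c u : abs_summable u -> abs_summable (fun i => c * u i).
Proof.
move=> [B uB]; exists (cabs c * B) => F uF.
rewrite (le_trans _ (ler_wpM2l (cabs_ge0 c) (uB F uF))) // mulr_sumr.
by apply: ler_sum => i _; rewrite cabsM.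
Qed.

Lemma csumD u v : abs_summable u -> abs_summable v ->
  csum (fun i => u i + v i) = csum u + csum v.
Proof.
move=> su sv; apply: (@has_sum_uniq (fun i => u i + v i)).
  exact/csum_has_sum/abs_summableD.
by apply: has_sumD; exact: csum_has_sum.
Qed.

Lemma csumZ c u : abs_summable u -> csum (fun i => c * u i) = c * csum u.
Proof.
move=> su; apply: (@has_sum_uniq (fun i => c * u i)).
  exact/csum_has_sum/abs_summableZ.
by apply: has_sumZ; exact: csum_has_sum.
Qed.

Lemma csumN u : abs_summable u -> csum (fun i => - u i) = - csum u.
Proof.
move=> su; rewrite -mulN1r -csumZ //; congr csum.
by apply/funext => i; rewrite mulN1r.
Qed.

Lemma csum_reindex (h h' : I -> I) u : cancel h h' -> cancel h' h ->
  abs_summable u -> csum (u \o h) = csum u.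
Proof.
move=> hK hK' su; have [B uB] := su; apply: (@has_sum_uniq (u \o h)).
  apply: csum_has_sum; exists B => F uF; rewrite -(big_map h xpredT (cabs \o u)).
  by apply: uB; rewrite map_inj_uniq //; exact: can_inj hK.
exact: has_sum_reindex hK hK' (csum_has_sum su).
Qed.

Lemma abs_summable_delta i0 (c : R[i]) : abs_summable (fun i : I => if i == i0 then c else 0).
Proof.
exists (cabs c) => F uF.
under eq_bigr => i _ do rewrite (fun_if cabs) cabs0.
rewrite -big_mkcond /= big_const_seq count_uniq_mem //.
by case: (_ \in _) => /=; rewrite ?addr0 ?cabs_ge0.
Qed.

Lemma csum_delta i0 (c : R[i]) : csum (fun i : I => if i == i0 then c else 0) = c.
Proof.
apply: (@has_sum_uniq (fun i => if i == i0 then c else 0)).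
  exact/csum_has_sum/abs_summable_delta.
exact: has_sum_delta.
Qed.

End UnorderedSums.

(** * The lattice: length, weights, domination *)

Section Lattice.
Variables (R : realType) (n : nat).
Implicit Types (p q k : 'rV[int]_n) (j : 'I_n).

Definition len1 p : nat := (\sum_(j < n) `|p ord0 j|)%N.

Definition jap p : R := (len1 p).+1%:R.

Notation e_ j := (delta_mx ord0 j : 'rV[int]_n).

Lemma len1D p q : (len1 (p + q) <= len1 p + len1 q)%N.
Proof.
rewrite /len1 -big_split /=; apply: leq_sum => j _; rewrite !mxE.
by move: (p ord0 j) (q ord0 j) => a b; lia.
Qed.

Lemma len1N p : len1 (- p) = len1 p.
Proof. by apply: eq_bigr => j _; rewrite !mxE; move: (p ord0 j) => a; lia. Qed.

Lemma len1_0 : len1 0 = 0%N.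
Proof. by apply: big1 => j _; rewrite !mxE. Qed.

Lemma len1_eq0 p : len1 p = 0%N -> p = 0.
Proof.
move=> /eqP; rewrite sum_nat_eq0 => /forallP h; apply/rowP => j.
have := h j; rewrite !mxE /= absz_eq0 => /eqP; exact.
Qed.

Lemma len1_coord p j : (`|p ord0 j| <= len1 p)%N.
Proof. by rewrite /len1 (bigD1 j) //= leq_addr. Qed.

(** Induction on [len1]: the step moves one coordinate away from zero, so
    every point is reached by a monotone path from the origin. *)
Lemma lattice_ind (P : 'rV[int]_n -> Prop) : P 0 ->
  (forall p j, P p -> len1 (p + e_ j) = (len1 p).+1 -> P (p + e_ j)) ->
  (forall p j, P p -> len1 (p - e_ j) = (len1 p).+1 -> P (p - e_ j)) ->
  forall p, P p.
Proof.
move=> P0 Pp Pm p; have [d] := ubnP (len1 p); elim: d p => // d IH p lpd.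
have [/len1_eq0 ->//|l0] := eqVneq (len1 p) 0%N.
have [j pj] : exists j, p ord0 j != 0.
  apply/existsP; rewrite -negb_forall; apply: contra l0 => /forallP h.
  by rewrite /len1 big1 // => j _; move/eqP: (h j) => ->.
have lenE (q : 'rV[int]_n) (i : int) : `|(q ord0 j + i)%R|%N = `|q ord0 j|%N.+1 ->
    len1 (q + i *: e_ j) = (len1 q).+1.
  move=> h; rewrite /len1 (bigD1 j) //= [in RHS](bigD1 j) //= !mxE !eqxx /= mulr1.
  rewrite h addSn; congr (_ + _).+1; apply: eq_bigr => l lj.
  by rewrite !mxE (negbTE lj) andbF mulr0 addr0.
have [pos|neg] := ltP 0 (p ord0 j).
  have l1 : len1 ((p - e_ j) + e_ j) = (len1 (p - e_ j)).+1.
    have := @lenE (p - e_ j) 1; rewrite scale1r; apply; rewrite !mxE !eqxx /=.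
    by move: (p ord0 j) pos => a; lia.
  rewrite -(subrK (e_ j) p); apply: (Pp _ _ _ l1).
  by apply: IH; rewrite subrK in l1; rewrite l1 in lpd.
have l1 : len1 ((p + e_ j) - e_ j) = (len1 (p + e_ j)).+1.
  have := @lenE (p + e_ j) (- 1); rewrite scaleN1r; apply; rewrite !mxE !eqxx /=.
  by move: (p ord0 j) neg pj => a; lia.
rewrite -(addrK (e_ j) p); apply: (Pm _ _ _ l1).
by apply: IH; rewrite addrK in l1; rewrite l1 in lpd.
Qed.

Lemma jap_ge1 p : 1 <= jap p. Proof. by rewrite /jap ler1n. Qed.
Lemma jap_gt0 p : 0 < jap p. Proof. by rewrite /jap ltr0n. Qed.
Lemma jap_ge0 p : 0 <= jap p. Proof. exact/ltW/jap_gt0. Qed.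

Lemma japN p : jap (- p) = jap p. Proof. by rewrite /jap len1N. Qed.

Lemma japD p q : jap (p + q) <= jap p * jap q.
Proof. rewrite /jap -natrM ler_nat; have := len1D p q; nia. Qed.

Lemma jap_coord p j : `|(p ord0 j)%:~R : R| <= jap p.
Proof.
rewrite -intr_norm /jap pmulrn ler_int.
have := len1_coord p j; move: (p ord0 j) => a; lia.
Qed.

Lemma japX_gt0 p M : 0 < jap p ^+ M.
Proof. by rewrite exprn_gt0 // jap_gt0. Qed.

Lemma japX_le p M N : (M <= N)%N -> jap p ^+ M <= jap p ^+ N.
Proof. by move=> MN; rewrite ler_weXn2l // jap_ge1. Qed.

Lemma japXV_le p M N : (M <= N)%N -> jap p ^- N <= jap p ^- M.
Proof. by move=> MN; rewrite lef_pV2 ?posrE ?japX_gt0 // japX_le. Qed.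

(** Peetre's inequality, from [jap p <= jap (p - q) * jap q]. *)
Lemma japXV_sub p q M : jap (p - q) ^- M <= jap q ^+ M * jap p ^- M.
Proof.
rewrite ler_pdivlMr ?japX_gt0 // mulrC ler_pdivrMr ?japX_gt0 // -exprMn.
rewrite lerXn2r ?nnegrE ?mulr_ge0 ?jap_ge0 //.
by rewrite -{1}(subrK q p) mulrC japD.
Qed.

Lemma enorm_ge0 k : 0 <= (enorm k : R).
Proof. exact: sqrtr_ge0. Qed.

Lemma jap_le_enorm k : jap k <= n.+1%:R * (1 + enorm k).
Proof.
have h j : (`|k ord0 j|%N%:R : R) <= enorm k.
  rewrite /enorm -[leLHS]ger0_norm // -sqrtr_sqr ler_wsqrtr //.
  rewrite (bigD1 j) //= pmulrn abszE intr_norm real_normK ?num_real // lerDl.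
  by apply: sumr_ge0 => i _; rewrite sqr_ge0.
have e0 := enorm_ge0 k.
have : ((len1 k)%:R : R) <= n%:R * enorm k.
  rewrite /len1 natr_sum (le_trans (ler_sum _ (fun j _ => h j))) //.
  by rewrite sumr_const card_ord mulr_natl.
have : (0 : R) <= n%:R by [].
rewrite /jap -!natr1; nra.
Qed.

(** The exponent [2 n] makes [wt p] smaller than the product over [j] of the
    summable weights [(1 + `|p_j|) ^- 2]. *)
Definition wt p : R := jap p ^- n.*2.

Lemma wt_ge0 p : 0 <= wt p.
Proof. by rewrite invr_ge0 ltW // japX_gt0. Qed.

Lemma wt_0 : wt 0 = 1.
Proof. by rewrite /wt /jap len1_0 expr1n invr1. Qed.

(** Telescoping: [(1 + x) ^- 2 <= x^-1 - (x + 1)^-1]. The term subtracted on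
    the right makes the induction go through. *)
Lemma sum_inv_sqr K : \sum_(i < K.*2.+1) (1 + `|(i%:Z - K%:Z)%:~R|) ^- 2 <= 4 - 2 / K.+1%:R :> R.
Proof.
elim: K => [|K IH].
  by rewrite big_ord_recl big_ord0 /= subrr mulr0z normr0 !addr0 expr1n invr1 mulr1; lra.
rewrite doubleS big_ord_recl big_ord_recr /=.
under eq_bigr => i _ do
  (have -> : (bump 0 i)%:Z - K.+1%:Z = i%:Z - K%:Z by rewrite /bump /=; lia).
have -> : 0%:Z - K.+1%:Z = - K.+1%:Z by lia.
have -> : (bump 0 K.*2.+1)%:Z - K.+1%:Z = K.+1%:Z by rewrite /bump /=; lia.
rewrite mulrNz normrN -pmulrn normr_nat.
set S := \sum_(i < _) _ in IH *.
have h0 : (0 : R) < K.+1%:R by rewrite ltr0n.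
have -> : (K.+2%:R : R) = K.+1%:R + 1 by rewrite natr1.
move: h0 IH; move: (K.+1%:R : R) => x x0 IH.
have : (1 + x) ^- 2 <= x^-1 - (x + 1)^-1.
  have -> : x^-1 - (x + 1)^-1 = (x * (x + 1))^-1 by field; lra.
  by rewrite lef_pV2 ?posrE; nra.
lra.
Qed.

(** Enlarging [F] to a cube turns the sum into the [n]-th power of a
    one-dimensional sum. *)
Lemma wt_sum_le F : uniq F -> \sum_(p <- F) wt p <= 4 ^+ n.
Proof.
move=> uF; pose K := (\max_(p <- F) len1 p)%N.
pose pt (f : {ffun 'I_n -> 'I_K.*2.+1}) : 'rV[int]_n := \row_j ((f j)%:Z - K%:Z).
pose c (i : int) : R := (1 + `|i%:~R|) ^- 2.
have c0 i : 0 <= c i by rewrite invr_ge0 exprn_ge0 // addr_ge0.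
have wc p : wt p <= \prod_j c (p ord0 j).
  rewrite /wt -mul2n exprM -exprVn -[n in leLHS]card_ord -prodr_const.
  apply: ler_prod => j _; rewrite invr_ge0 exprn_ge0 ?jap_ge0 //=.
  rewrite lef_pV2 ?posrE ?exprn_gt0 ?jap_gt0 ?ltr_pwDl //.
  rewrite lerXn2r ?nnegrE ?jap_ge0 ?addr_ge0 //.
  rewrite /jap -natr1 addrC lerD2r -intr_norm pmulrn ler_int.
  by have := len1_coord p j; move: (p ord0 j) => a; lia.
apply: (@le_trans _ _ (\sum_(p <- F) \prod_j c (p ord0 j))); first exact: ler_sum.
(* pt enumerates the cube of side 2 K + 1 around the origin, which contains F *)
have pt_inj : injective pt.
  move=> f g /rowP h; apply/ffunP => j; apply: val_inj.
  by have := h j; rewrite !mxE /=; move: (val (f j)) (val (g j)) => a b; lia.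
apply: (@le_trans _ _ (\sum_(p <- [seq pt f | f : {ffun 'I_n -> 'I_K.*2.+1}])
   \prod_j c (p ord0 j))).
  apply: big_subset_ge0 => // [p||p pF]; first exact: prodr_ge0.
    by rewrite map_inj_uniq // enum_uniq.
  have lpK : (len1 p <= K)%N by rewrite /K (big_rem p) //= leq_max leqnn.
  have hj j : (`|(p ord0 j + K%:Z)%R| < K.*2.+1)%N by have := len1_coord p j; move: (p ord0 j) => a; lia.
  apply/mapP; exists [ffun j => Ordinal (hj j)]; first by rewrite mem_enum.
  by apply/rowP => j; rewrite !mxE ffunE /=; have := len1_coord p j; move: (p ord0 j) => a; lia.
rewrite big_map big_enum /=.
under eq_bigr => f _ do under eq_bigr => j _ do rewrite mxE.
rewrite -(bigA_distr_bigA (fun _ (i : 'I_K.*2.+1) => c (i%:Z - K%:Z))) /=.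
rewrite prodr_const card_ord lerXn2r ?nnegrE ?sumr_ge0 //.
apply: le_trans (sum_inv_sqr K) _.
by rewrite gerBl divr_ge0.
Qed.

(** The constants of the estimates below are multiples of this upper bound
    for the total mass of [wt]. *)
Definition wmass : R := 4 ^+ n.

Lemma wmass_gt0 : 0 < wmass. Proof. by rewrite exprn_gt0. Qed.

Lemma dominated_summable (u : 'rV[int]_n -> R[i]) C :
  (forall p, cabs (u p) <= C * wt p) -> abs_summable u.
Proof.
move=> uC; exists (`|C| * wmass) => F uF.
apply: (@le_trans _ _ (\sum_(p <- F) `|C| * wt p)).
  by apply: ler_sum => p _; rewrite (le_trans (uC p)) // ler_wpM2r ?wt_ge0 ?ler_norm.
by rewrite -mulr_sumr ler_wpM2l // wt_sum_le.
Qed.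

Lemma dominated_csum_le (u : 'rV[int]_n -> R[i]) C :
  (forall p, cabs (u p) <= C * wt p) -> cabs (csum u) <= C * wmass.
Proof.
move=> uC; apply: (has_sum_le (csum_has_sum (dominated_summable uC))) => F uF.
apply: (le_trans (ler_sum _ (fun p _ => uC p))); rewrite -mulr_sumr.
have [C0|C0] := leP 0 C; first by rewrite ler_wpM2l // wt_sum_le.
have := uC 0; rewrite leNgt => /negP[]; apply: lt_le_trans (cabs_ge0 _).
by rewrite pmulr_llt0 // invr_gt0 japX_gt0.
Qed.

(** One finite set captures, up to [e], every sum dominated by [wt]: this
    uniformity is what allows [csum] to be exchanged with bounded functionals. *)
Lemma dominated_csum_approx (e : R) : 0 < e -> exists2 F, uniq F &
  forall (u : 'rV[int]_n -> R[i]) C, (forall p, cabs (u p) <= C * wt p) ->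
    cabs (csum u - \sum_(p <- F) u p) <= C * e.
Proof.
(* F captures the total mass of wt up to e *)
move=> e0; have [ub /(_ _ e0) [F uF hF]] := esum_nneg_sup wt_ge0 wt_sum_le.
exists F => // u C uC; have hs := csum_has_sum (dominated_summable uC).
have C0 : 0 <= C.
  rewrite leNgt; apply/negP => C0; have := uC 0; rewrite leNgt => /negP[].
  by apply: lt_le_trans (cabs_ge0 _); rewrite pmulr_llt0 // invr_gt0 japX_gt0.
apply/ler_addgt0Pr => d d0; have [G uG /(_ (undup (F ++ G)) (undup_uniq _))] := hs d d0.
have sG : {subset G <= undup (F ++ G)} by move=> p pG; rewrite mem_undup mem_cat pG orbT.
move=> /(_ sG); set H := undup _ => hH.
have uH : uniq H := undup_uniq _.
have split_sum (V : zmodType) (v : 'rV[int]_n -> V) :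
    \sum_(p <- H) v p = \sum_(p <- F) v p + \sum_(p <- H | p \notin F) v p.
  rewrite (bigID (mem F)) /=; congr (_ + _); rewrite -[LHS]big_filter.
  apply: perm_big; apply: uniq_perm => //; first exact: filter_uniq.
  move=> p; rewrite mem_filter mem_undup mem_cat.
  by case: (p \in F).
have -> : csum u - \sum_(p <- F) u p =
    \sum_(p <- H | p \notin F) u p - (\sum_(p <- H) u p - csum u).
  by rewrite split_sum; ring.
rewrite (le_trans (cabsB _ _)) // lerD //.
have -> : cabs (\sum_(p <- H | p \notin F) u p) =
          cabs (\sum_(p <- [seq p <- H | p \notin F]) u p) by rewrite big_filter.
rewrite (le_trans (cabs_sum _ _)) // big_filter.
apply: (le_trans (ler_sum _ (fun p _ => uC p))); rewrite -mulr_sumr ler_wpM2l //.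
by have := ub H uH; rewrite split_sum; lra.
Qed.

End Lattice.

(** * Weight functions are moderate *)

Section CompBig.
Variables (T : Type) (I : eqType).
Implicit Types (F : I -> T -> T) (r : seq I).

Lemma comp_big_cons F i r x :
  (\big[comp/idfun]_(j <- i :: r) F j) x = F i ((\big[comp/idfun]_(j <- r) F j) x).
Proof. by rewrite big_cons. Qed.

Lemma comp_big_single F r i : uniq r -> (forall j, j != i -> F j = idfun) ->
  \big[comp/idfun]_(j <- r) F j = if i \in r then F i else idfun.
Proof.
move=> + Fi; elim: r => [|j r IH] /=; first by rewrite big_nil.
case/andP => jr /IH {}IH; rewrite big_cons IH inE; apply/funext => x /=.
have [->|ij] := eqVneq i j; first by rewrite (negbTE jr).
by rewrite (Fi j) // eq_sym.
Qed.

Lemma comp_big_commute F r (g : T -> T) : (forall i x, g (F i x) = F i (g x)) ->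
  forall x, g ((\big[comp/idfun]_(j <- r) F j) x) = (\big[comp/idfun]_(j <- r) F j) (g x).
Proof.
move=> gF x; elim: r => [|i r IH]; first by rewrite !big_nil.
by rewrite !comp_big_cons gF IH.
Qed.

End CompBig.

Lemma comp_big_morph (T U : Type) (I : eqType) (F : I -> T -> T) (G : I -> U -> U)
    (h : T -> U) (r : seq I) : (forall i x, h (F i x) = G i (h x)) ->
  forall x, h ((\big[comp/idfun]_(j <- r) F j) x) = (\big[comp/idfun]_(j <- r) G j) (h x).
Proof.
move=> hF x; elim: r => [|i r IH]; first by rewrite !big_nil.
by rewrite !comp_big_cons hF IH.
Qed.

Lemma diffm_unit (V : zmodType) (n : nat) (j : 'I_n) (f : 'rV[int]_n -> V) :
  diffm (fun i => nat_of_bool (i == j)) f = diff1 j f.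
Proof.
rewrite /diffm (@comp_big_single _ _ _ _ j) ?index_enum_uniq // => [|i ij].
  by rewrite mem_index_enum eqxx.
by rewrite (negbTE ij); apply/funext.
Qed.

Section Moderate.
Variables (R : realType) (n : nat).
Implicit Types (q k : 'rV[int]_n) (j : 'I_n).

Notation e_ j := (delta_mx ord0 j : 'rV[int]_n).
Local Notation jap := (@jap R n).

(** Summing one-step increments along a lattice path from [k] to [k + q];
    the metric [d] and the target are abstract as this is applied to powers of
    the weight and to arrays. *)
Lemma lattice_path (T : Type) (d : T -> T -> R) (f : 'rV[int]_n -> T) (g : nat -> R) k :
  (forall x, d x x = 0) -> (forall x y, d x y = d y x) ->
  (forall x y z, d x z <= d x y + d y z) ->
  {homo g : x y / (x <= y)%N >-> x <= y} ->
  (forall q j, d (f (k + q + e_ j)) (f (k + q)) <= g (len1 q)) ->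
  forall q, d (f (k + q)) (f k) <= (len1 q)%:R * g (len1 q).
Proof.
move=> d0 dC dT gm step; elim/(@lattice_ind n) => [|q j IH lq|q j IH lq].
- by rewrite addr0 d0 len1_0 mul0r.
- apply: (le_trans (dT _ (f (k + q)) _)); rewrite addrA.
  have gq : g (len1 q) <= g (len1 q).+1 by apply: gm.
  apply: (le_trans (lerD (step q j) IH)); rewrite lq -natr1.
  have : (0 : R) <= (len1 q)%:R by [].
  nra.
- apply: (le_trans (dT _ (f (k + q)) _)).
  have gq : g (len1 q) <= g (len1 q).+1 by apply: gm.
  have := step (q - e_ j) j; rewrite lq -[k + _ + _]addrA subrK dC => st.
  apply: (le_trans (lerD st IH)); rewrite -natr1.
  have : (0 : R) <= (len1 q)%:R by [].
  nra.
Qed.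

Lemma powR_le (x y t : R) : 0 <= t -> 0 <= x -> x <= y -> x `^ t <= y `^ t.
Proof.
move=> t0 x0 xy; have y0 := le_trans x0 xy.
by apply: (ge0_ler_powR t0) => //; rewrite nnegrE.
Qed.

(** Two-sided comparability is needed because [t] may be negative. *)
Lemma powR_comparable (x y A t : R) : 0 < x -> 0 < y -> 0 < A ->
  x <= A * y -> y <= A * x -> x `^ t <= A `^ `|t| * y `^ t.
Proof.
move=> x0 y0 A0 xy yx; have [t0|/ltW t0] := leP 0 t.
  rewrite ger0_norm // -powRM ?(ltW A0) ?(ltW y0) //.
  by apply: powR_le; rewrite ?(ltW x0).
rewrite ler0_norm // -[in leLHS](opprK t) -[X in y `^ X](opprK t).
rewrite [leLHS]powRN [X in _ * X]powRN ler_pdivlMr ?powR_gt0 //.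
rewrite mulrC ler_pdivrMr ?powR_gt0 // -powRM ?(ltW A0) ?(ltW x0) //.
by apply: powR_le; rewrite ?oppr_ge0 ?(ltW y0).
Qed.

Lemma expR_le1Dx (t : R) : 0 <= t -> expR t <= 1 + t * expR t.
Proof.
move=> t0; have h := expR_ge1Dx (- t); have e0 := expR_gt0 t.
have : expR t * expR (- t) = 1 by rewrite expRxMexpNx_1.
nra.
Qed.

(** Mean value estimate for [x `^ s] when [y / x] is bounded: the increment
    [C * x `^ (1 - s)] of [x] is divided by [x `^ (1 - s)]. *)
Lemma powR_increment (x y A C s : R) : 0 < x -> 0 < y -> 0 < s -> 0 <= C ->
  y <= (1 + A) * x -> y - x <= C * x `^ (1 - s) -> y `^ s <= x `^ s + s * C * expR (s * A).
Proof.
move=> x0 y0 s0 C0 yA yx.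
have D0 : 0 <= s * C * expR (s * A) by rewrite !mulr_ge0 ?expR_ge0 ?(ltW s0).
have [le_yx|lt_xy] := leP y x.
  rewrite -[leLHS]addr0 lerD //.
  by apply: powR_le; rewrite ?(ltW s0) ?(ltW y0).
(* y = x (1 + dl) with dl <= A, and (1 + dl)^s <= exp (s dl) *)
pose dl := y / x - 1.
have dl0 : 0 < dl by rewrite subr_gt0 ltr_pdivlMr // mul1r.
have yE : y = x * (1 + dl) by rewrite /dl addrCA subrr addr0 mulrC divfK ?gt_eqF.
clearbody dl; have dlA : dl <= A by move: yA; rewrite yE; nra.
have dlC : x `^ s * dl <= C.
  have : x * dl <= C * x `^ (1 - s) by move: yx; rewrite yE; lra.
  have -> : x `^ (1 - s) = x * (x `^ s)^-1.
    by rewrite powRB ?powRr1 ?(gt_eqF x0) ?(ltW x0) ?implybT.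
  have p0 : 0 < x `^ s by rewrite powR_gt0.
  rewrite mulrCA ler_pM2l // ler_pdivlMr // mulrC //.
rewrite yE powRM ?(ltW x0) ?addr_ge0 ?(ltW dl0) //.
have pE : (1 + dl) `^ s <= 1 + s * dl * expR (s * A).
  rewrite /powR gt_eqF ?addr_gt0 //.
  apply: (@le_trans _ _ (expR (s * dl))).
    by rewrite ler_expR ler_pM2l // le_ln1Dx //; lra.
  apply: (le_trans (expR_le1Dx _)); first by rewrite mulr_ge0 ?(ltW s0) ?(ltW dl0).
  by rewrite lerD2l ler_wpM2l ?mulr_ge0 ?(ltW s0) ?(ltW dl0) // ler_expR ler_pM2l.
apply: (le_trans (ler_wpM2l (powR_ge0 _ _) pE)).
have e0 := expR_gt0 (s * A); rewrite mulrDr mulr1 lerD2l.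
have -> : x `^ s * (s * dl * expR (s * A)) = s * (x `^ s * dl) * expR (s * A) by ring.
by rewrite ler_wpM2r ?(ltW e0) // ler_pM2l.
Qed.

(** The growth properties of a weight function that the calculus uses; the
    bound on [Lam (k + q) `^ m] is Peetre's inequality for [Lam]. *)
Definition moderate (Lam : 'rV[int]_n -> R) : Prop :=
  [/\ forall k, 0 < Lam k,
      forall m : R, exists2 C : R, 0 < C & exists K : nat, forall k q,
        Lam (k + q) `^ m <= C * Lam k `^ m * jap q ^+ K,
      exists2 kap : R, 0 <= kap & exists2 C : R, 0 < C & forall k, jap k <= C * Lam k `^ kap &
      exists2 c : R, 0 < c & forall k, c <= Lam k].

(** A power [Lam `^ (1 / mu)] has bounded increments, because those of [Lam]
    are [O(Lam `^ (1 - 1 / mu))]; hence it grows at most linearly along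
    lattice paths. *)
Lemma weight_moderate mu0 mu1 mu C0 C1 Lam :
  weight_function mu0 mu1 mu C0 C1 Lam -> moderate Lam.
Proof.
move=> [[mu0_gt0 le01 le1] [C0_gt0 C1_gt0] Lam0 Lamb Lamd].
have mu_gt0 : 0 < mu by lra.
have c0L k : C0 <= Lam k.
  apply: le_trans (proj1 (Lamb k)); rewrite ler_pMr //.
  rewrite -[leLHS](powRr0 (1 + enorm k)); apply: ler_powR; last exact: ltW.
  by rewrite lerDl enorm_ge0.
pose s := mu^-1; have s_gt0 : 0 < s by rewrite invr_gt0.
(* one constant for the increments in all directions *)
have [C C_gt0 LamC] : exists2 C : R, 0 < C & forall k j,
    `|Lam (k + e_ j) - Lam k| <= C * Lam k `^ (1 - s).
  have step j : exists C : R, 0 < C /\ forall k,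
      `|Lam (k + e_ j) - Lam k| <= C * Lam k `^ (1 - s).
    have [C C_gt0 h] := Lamd (fun i => nat_of_bool (i == j)) (fun=> false).
    exists C; split=> // k; have := h k.
    have -> : (fun i => (i == j) + false)%N = (fun i => nat_of_bool (i == j)).
      by apply/funext => i; rewrite addn0.
    rewrite diffm_unit /diff1 /monomial big1 ?mul1r; last by move=> i _; rewrite expr0.
    have -> : mlength (fun i => nat_of_bool (i == j)) = 1%N.
      by rewrite /mlength (bigD1 j) //= eqxx big1 // => i /negbTE ->.
    by rewrite div1r.
  have /choice [Cj hC] := step.
  exists (1 + \sum_j Cj j) => [|k j].
    by rewrite ltr_pwDl // sumr_ge0 // => j _; have [/ltW] := hC j.
  have [_ /(_ k) h] := hC j; apply: (le_trans h); rewrite ler_wpM2r ?powR_ge0 //.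
  rewrite (bigD1 j) //= addrCA lerDl addr_ge0 // sumr_ge0 // => i _.
  by have [/ltW] := hC i.
have cs0 : 0 < C0 `^ s by rewrite powR_gt0.
(* neighbouring values of Lam are comparable: upwards as Lam^(1 - s) is
   O(Lam), downwards also because a large Lam loses at most one half *)
pose A := C / C0 `^ s; have A_gt0 : 0 < A by rewrite divr_gt0.
have up k j : Lam (k + e_ j) <= (1 + A) * Lam k.
  have := LamC k j; rewrite ler_norml => /andP[_].
  rewrite powRB ?powRr1 ?(gt_eqF (Lam0 k)) ?(ltW (Lam0 k)) ?implybT // => h.
  have : C * (Lam k / Lam k `^ s) <= A * Lam k.
    rewrite /A mulrCA mulrC ler_pM2r // ler_pM2l // lef_pV2 ?posrE ?powR_gt0 //.
    by apply: powR_le; rewrite ?(ltW s_gt0) ?(ltW C0_gt0) ?(ltW (Lam0 _)).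
  lra.
(* below the threshold A0 the lower bound on Lam suffices *)
pose A0 := (C * 2) `^ mu; have A0_gt0 : 0 < A0 by rewrite powR_gt0 ?mulr_gt0.
pose B := 1 + A0 / C0.
have B_gt0 : 0 < A0 / C0 by rewrite divr_gt0.
have dn k j : Lam k <= (1 + B) * Lam (k + e_ j).
  have L0 := Lam0 (k + e_ j).
  have [small|large] := leP (Lam k) A0.
    have := c0L (k + e_ j) => h.
    have : A0 <= A0 / C0 * Lam (k + e_ j) by rewrite mulrAC ler_pdivlMr // ler_pM2l.
    rewrite /B; nra.
  have := LamC k j; rewrite ler_norml => /andP[+ _].
  rewrite powRB ?powRr1 ?(gt_eqF (Lam0 k)) ?(ltW (Lam0 k)) ?implybT // => h.
  have : C * (Lam k / Lam k `^ s) <= Lam k / 2.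
    rewrite mulrCA ler_pM2l // ler_pdivrMr ?powR_gt0 // mulrC ler_pdivlMr //.
    have -> : C * 2 = A0 `^ s.
      by rewrite /A0 -powRrM divff ?gt_eqF // powRr1 // mulr_ge0 // ltW.
    apply: powR_le; rewrite ?(ltW s_gt0) ?(ltW C0_gt0) ?(ltW (Lam0 _)) ?(ltW A0_gt0) ?(ltW large) //.
  rewrite /B; nra.
pose M := (1 + A) + (1 + B).
have M_gt0 : 0 < M by rewrite /M /B; lra.
pose L k := Lam k `^ s.
have L_gt0 k : 0 < L k by rewrite powR_gt0.
(* bounded increments of L = Lam^(1 / mu), in both directions *)
pose C' := C * M `^ `|1 - s|.
have C'_ge0 : 0 <= C' by rewrite mulr_ge0 ?powR_ge0 ?(ltW C_gt0).
pose D := s * C * expR (s * A) + s * C' * expR (s * B).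
have D1 : 0 <= s * C * expR (s * A) by rewrite !mulr_ge0 ?expR_ge0 ?(ltW s_gt0) ?(ltW C_gt0).
have D2 : 0 <= s * C' * expR (s * B).
  by rewrite !mulr_ge0 ?expR_ge0 ?powR_ge0 ?(ltW s_gt0) ?(ltW C_gt0).
have stepL k j : `|L (k + e_ j) - L k| <= D.
  have i1 : L (k + e_ j) <= L k + s * C * expR (s * A).
    apply: powR_increment => //; first exact: ltW.
    by have := LamC k j; rewrite ler_norml => /andP[].
  have i2 : L k <= L (k + e_ j) + s * C' * expR (s * B).
    apply: powR_increment => //.
    have := LamC k j; rewrite distrC ler_norml => /andP[_ /le_trans]; apply.
    rewrite -mulrA ler_pM2l //; apply: powR_comparable => //.
      apply: (le_trans (dn k j)); rewrite ler_wpM2r ?(ltW (Lam0 _)) // /M; lra.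
    apply: (le_trans (up k j)); rewrite ler_wpM2r ?(ltW (Lam0 _)) // /M /B; lra.
  rewrite ler_norml /D; lra.
pose E := 1 + D / C0 `^ s.
have E_gt0 : 0 < E by rewrite ltr_pwDl // divr_ge0 ?powR_ge0 // addr_ge0.
have growL k q : L (k + q) <= E * jap q * L k.
  have := @lattice_path R (fun x y => `|x - y|) L (fun=> D) k.
  move=> /(_ _ _ _ _ _ q) h.
  have {}h : `|L (k + q) - L k| <= (len1 q)%:R * D.
    apply: h => [x|x y|x y z|//|q' j]; first by rewrite subrr normr0.
    - by rewrite distrC.
    - exact: ler_distD.
    - exact: stepL.
  have cL : C0 `^ s <= L k by apply: powR_le; rewrite ?(ltW s_gt0) ?(ltW C0_gt0) ?(ltW (Lam0 _)).
  have : D <= D / C0 `^ s * L k.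
    by rewrite mulrAC ler_pdivlMr // ler_wpM2l // addr_ge0.
  have l0 : (0 : R) <= (len1 q)%:R by [].
  move: h; rewrite ler_norml => /andP[_ h].
  rewrite /E /jap -natr1; have := L_gt0 k; set X := D / _.
  have X0 : 0 <= X by rewrite divr_ge0 ?powR_ge0 // addr_ge0.
  move=> Lk DX; have : (len1 q)%:R * D <= (len1 q)%:R * (X * L k) by rewrite ler_wpM2l.
  have : 0 <= X * L k by rewrite mulr_ge0 // ltW.
  nra.
(* arbitrary powers of Lam are powers of L *)
have LamE k m : Lam k `^ m = L k `^ (m * mu).
  by rewrite /L -powRrM mulrCA mulVf ?mulr1 // gt_eqF.
split => //.
- move=> m; pose K := Num.bound `|m * mu|.
  exists (E `^ `|m * mu|) => [|]; first exact: powR_gt0.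
  exists K => k q; rewrite !LamE.
  have EJ : 0 < E * jap q by rewrite mulr_gt0 ?jap_gt0.
  apply: (@le_trans _ _ ((E * jap q) `^ `|m * mu| * L k `^ (m * mu))).
    apply: powR_comparable => //.
    by have := growL (k + q) (- q); rewrite addrK japN.
  rewrite powRM ?jap_ge0 ?(ltW E_gt0) // -!mulrA ler_wpM2l ?powR_ge0 //.
  rewrite mulrC ler_wpM2l ?powR_ge0 // -powR_mulrn ?jap_ge0 //.
  by apply: ler_powR; rewrite ?jap_ge1 // ltW // archi_boundP.
(* the lower growth bound on Lam, inverted *)
- exists mu0^-1; first by rewrite invr_ge0 ltW.
  exists (n.+1%:R * (C0 `^ mu0^-1)^-1).
    by rewrite mulr_gt0 ?ltr0n // invr_gt0 powR_gt0.
  move=> k; apply: (le_trans (jap_le_enorm _ _)); rewrite -mulrA ler_wpM2l //.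
  have e1 : 0 <= 1 + (enorm k : R) by rewrite addr_ge0 ?enorm_ge0.
  rewrite [leRHS]mulrC ler_pdivlMr ?powR_gt0 //.
  have {1}-> : 1 + enorm k = (1 + enorm k) `^ mu0 `^ mu0^-1 :> R.
    by rewrite -powRrM mulfV ?powRr1 ?gt_eqF.
  rewrite -powRM ?powR_ge0 ?(ltW C0_gt0) //.
  apply: powR_le; rewrite ?invr_ge0 ?(ltW mu0_gt0) ?mulr_ge0 ?powR_ge0 ?(ltW C0_gt0) //.
  by rewrite mulrC; exact: (proj1 (Lamb k)).
- by exists C0.
Qed.

End Moderate.

(** * Double sums over the lattice *)

Section DoubleSums.
Variables (R : realType) (n : nat).
Implicit Types (p q : 'rV[int]_n).
Local Notation wt := (@wt R n).

Lemma csum_finite_sum (T : Type) (F : seq T) (u : T -> 'rV[int]_n -> R[i]) :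
  (forall t, abs_summable (u t)) ->
  csum (fun p => \sum_(t <- F) u t p) = \sum_(t <- F) csum (u t) /\
  abs_summable (fun p => \sum_(t <- F) u t p).
Proof.
move=> su; have s0 : abs_summable (fun _ : 'rV[int]_n => 0 : R[i]).
  by exists 0 => F' _; rewrite big1 // => i _; rewrite cabs0.
elim: F => [|i F [IH1 IH2]].
  have -> : (fun p => \sum_(t <- [::]) u t p) = (fun=> 0).
    by apply/funext => p; rewrite big_nil.
  by split=> //; rewrite big_nil; have := csumZ 0 s0; rewrite !mul0r => ->.
have -> : (fun p => \sum_(t <- i :: F) u t p) = (fun p => u i p + \sum_(t <- F) u t p).
  by apply/funext => p; rewrite big_cons.
by rewrite big_cons csumD // IH1; split => //; exact: abs_summableD.
Qed.

(** Exchange of [csum] with a functional that is additive on the finite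
    truncations and bounded by the dominating weight. Such sums are
    approximated by finite ones uniformly in the parameter [t], so both sides
    are close to the same finite sum. *)
Lemma csum_functional (T : Type) (Phi : (T -> R[i]) -> R[i]) (u : T -> 'rV[int]_n -> R[i])
    (K : R) :
  (forall p, cabs (Phi (u ^~ p)) <= K * wt p) ->
  (forall (F : seq 'rV[int]_n) (e : R),
     (forall t, cabs (csum (u t) - \sum_(p <- F) u t p) <= e) -> 
     cabs (Phi (fun t => csum (u t)) - \sum_(p <- F) Phi (u ^~ p)) <= K * e) ->
  (exists2 C : R, 0 < C & forall t p, cabs (u t p) <= C * wt p) ->
  Phi (fun t => csum (u t)) = csum (fun p => Phi (u ^~ p)).
Proof.
move=> PhiK approx [C C0 uC]; apply: eq_small_cabs => e e0.
have K0 : 0 <= K.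
  have := PhiK 0; rewrite wt_0 mulr1.
  exact/le_trans/cabs_ge0.
have KC : 0 <= K * C by rewrite mulr_ge0 // ltW.
have D0 : 0 < K * C + K + 1 by lra.
have e1 : 0 < e / (K * C + K + 1) by rewrite divr_gt0.
have [F uF hF] := @dominated_csum_approx R n _ e1.
have h1 := approx F _ (fun t => hF _ _ (uC t)).
have h2 := hF _ _ PhiK.
set X := Phi _ in h1 *; set Y := csum _ in h2 *; set Z := \sum_(p <- F) _ in h1 h2 *.
have -> : X - Y = (X - Z) - (Y - Z) by ring.
apply: (le_trans (cabsB _ _)); apply: (le_trans (lerD h1 h2)).
have -> : K * (C * (e / (K * C + K + 1))) + K * (e / (K * C + K + 1)) =
  e * ((K * C + K) / (K * C + K + 1)) by field; rewrite gt_eqF.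
by rewrite ler_piMr ?(ltW e0) // ler_pdivrMr // mul1r; lra.
Qed.

(** A single finite set of indices approximates all the inner sums at once
    ([dominated_csum_approx]). *)
Lemma csum_swap (u : 'rV[int]_n -> 'rV[int]_n -> R[i]) (D : R) :
  (forall q t, cabs (u q t) <= D * wt q * wt t) ->
  csum (fun q => csum (u q)) = csum (fun t => csum (u ^~ t)).
Proof.
move=> uD; have D0 : 0 <= D.
  have := uD 0 0; rewrite wt_0 !mulr1.
  exact/le_trans/cabs_ge0.
have su t : abs_summable (u ^~ t).
  by apply: (@dominated_summable R n _ (D * wt t)) => q; rewrite mulrAC.
apply: eq_small_cabs => e e0; have m0 := wmass_gt0 R n.
have E0 : 0 < D * wmass R n * 2 + 1 by rewrite ltr_wpDl // !mulr_ge0 // ltW.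
have [F uF hF] := @dominated_csum_approx R n _ (divr_gt0 e0 E0).
set d := e / _ in hF.
have h1 q : cabs (csum (u q) - \sum_(t <- F) u q t) <= D * d * wt q.
  by have := hF (u q) (D * wt q) (uD q); rewrite mulrAC.
have h2 := @dominated_csum_le R n _ _ h1.
have [sF1 sF2] := csum_finite_sum F su.
have sq : abs_summable (fun q => csum (u q)).
  apply: (@dominated_summable R n _ (D * wmass R n)) => q.
  by rewrite mulrAC; apply: dominated_csum_le; exact: uD.
have {h2} h2 : cabs (csum (fun q => csum (u q)) - \sum_(t <- F) csum (u ^~ t)) <= D * d * wmass R n.
  move: h2; rewrite -sF1 -csumN // -csumD //.
  have := abs_summableZ (-1) sF2; congr abs_summable.
  by apply/funext => q; rewrite mulN1r.
have h3 : cabs (csum (fun t => csum (u ^~ t)) - \sum_(t <- F) csum (u ^~ t)) <= D * wmass R n * d.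
  apply: hF => t; rewrite mulrAC.
  by apply: dominated_csum_le => q; rewrite mulrAC uD.
set X := csum _ in h2 *; set Y := csum _ in h3 *; set Z := \sum_(p <- F) _ in h2 h3 *.
have -> : X - Y = (X - Z) - (Y - Z) by ring.
apply: (le_trans (cabsB _ _)); apply: (le_trans (lerD h2 h3)).
have -> : D * d * wmass R n + D * wmass R n * d = (D * wmass R n * 2) * d by ring.
rewrite /d mulrA ler_pdivrMr // mulrC ler_wpM2l ?(ltW e0) //; lra.
Qed.

(** After [t = q + r] this is an exchange of two sums. *)
Lemma csum_assoc (A C : 'rV[int]_n -> R[i]) (B : 'rV[int]_n -> 'rV[int]_n -> R[i]) (D : R) :
  (forall q t, cabs (A q * B q (t - q) * C t) <= D * wt q * wt t) ->
  (forall t, abs_summable (fun q => A q * B q (t - q))) ->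
  (forall q, abs_summable (fun r => B q r * C (q + r))) ->
  csum (fun t => csum (fun q => A q * B q (t - q)) * C t) =
  csum (fun q => A q * csum (fun r => B q r * C (q + r))).
Proof.
move=> dom s1 s2; transitivity (csum (fun t => csum (fun q => A q * B q (t - q) * C t))).
  congr csum; apply/funext => t; rewrite mulrC -csumZ //.
  by congr csum; apply/funext => q; rewrite mulrC.
rewrite -(csum_swap dom); congr csum; apply/funext => q; rewrite -csumZ //.
have <- : (fun t => A q * B q (t - q) * C t) \o (fun r => q + r) =
    (fun r => A q * (B q r * C (q + r))).
  by apply/funext => r /=; rewrite mulrA [q + r]addrC addrK.
rewrite (csum_reindex (h' := fun t => t - q)) //.
- by move=> t; rewrite addrAC subrr add0r.
- by move=> t; rewrite addrCA subrr addr0.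
- by apply: (@dominated_summable R n _ (D * wt q)) => t; exact: dom.
Qed.

End DoubleSums.

(** * Order classes of coefficient arrays *)

Section CoefficientClasses.
Variables (R : realType) (n : nat) (Lam : 'rV[int]_n -> R) (rho : R).
Hypotheses (Lam_mod : moderate Lam) (rho_ge0 : 0 <= rho).
Implicit Types (p q k : 'rV[int]_n) (j : 'I_n) (m Q : R).

Local Notation e_ j := (delta_mx ord0 j : 'rV[int]_n).
Local Notation wt := (@wt R n).
Local Notation jap := (@jap R n).
Local Notation coef := ('rV[int]_n -> 'rV[int]_n -> R[i]).
Implicit Types (a b c : coef) (beta : 'rV[int]_n -> 'rV[int]_n -> 'rV[int]_n -> R[i]).

Lemma Lam_gt0 k : 0 < Lam k. Proof. by have [] := Lam_mod. Qed.
Lemma LamX_gt0 m k : 0 < Lam k `^ m. Proof. exact/powR_gt0/Lam_gt0. Qed.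
Lemma LamX_ge0 m k : 0 <= Lam k `^ m. Proof. exact/ltW/LamX_gt0. Qed.

Lemma LamXD m m' k : Lam k `^ (m + m') = Lam k `^ m * Lam k `^ m'.
Proof. by rewrite powRD // (gt_eqF (Lam_gt0 k)) implybT. Qed.

Lemma LamX_le m m' : m <= m' ->
  exists2 C : R, 0 < C & forall k, Lam k `^ m <= C * Lam k `^ m'.
Proof.
move=> mm; have [Lam0 _ _ [c c0 cL]] := Lam_mod.
exists (c `^ (m - m')) => [|k]; first exact: powR_gt0.
rewrite -{1}(subrK m' m) LamXD ler_wpM2r ?LamX_ge0 //.
rewrite -(opprB m' m) !powRN lef_pV2 ?posrE ?powR_gt0 //.
by apply: powR_le; rewrite ?subr_ge0 // (ltW c0).
Qed.

Definition decay M m a := exists2 C : R, 0 < C &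
  forall k p, cabs (a k p) <= C * Lam k `^ m * jap p ^- M.

(** Decay faster than any power in the frequency variable [p], as for the
    Fourier coefficients of a smooth function; [m] is the order in [k]. *)
Definition has_order m a := forall M, decay M m a.

Lemma decay_ge0 M m k p : 0 <= Lam k `^ m * jap p ^- M.
Proof. by rewrite mulr_ge0 ?LamX_ge0 // invr_ge0 ltW // japX_gt0. Qed.

Lemma decay_le M M' m m' a : (M' <= M)%N -> m <= m' -> decay M m a -> decay M' m' a.
Proof.
move=> MM mm [C C0 aC]; have [B B0 BL] := LamX_le mm.
exists (C * B) => [|k p]; first exact: mulr_gt0.
apply: (le_trans (aC k p)); rewrite -(mulrA C B) -!(mulrA C) ler_pM2l //.
by apply: ler_pM; rewrite ?LamX_ge0 ?BL ?japXV_le // invr_ge0 ltW // japX_gt0.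
Qed.

Lemma decayD M m a b : decay M m a -> decay M m b -> decay M m (a + b).
Proof.
move=> [C C0 aC] [D D0 bD]; exists (C + D) => [|k p]; first exact: addr_gt0.
apply: (le_trans (cabsD _ _)); apply: (le_trans (lerD (aC k p) (bD k p))).
by rewrite !mulrDl.
Qed.

Lemma decayN M m a : decay M m a -> decay M m (- a).
Proof. by move=> [C C0 aC]; exists C => // k p; rewrite cabsN. Qed.

Lemma has_order_le m m' a : m <= m' -> has_order m a -> has_order m' a.
Proof. by move=> mm oa M; apply: decay_le (oa M). Qed.

Lemma has_orderD m a b : has_order m a -> has_order m b -> has_order m (a + b).
Proof. by move=> oa ob M; exact: decayD. Qed.

Lemma has_orderN m a : has_order m a -> has_order m (- a).
Proof. by move=> oa M; exact: decayN. Qed.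

Lemma has_orderB m a b : has_order m a -> has_order m b -> has_order m (a - b).
Proof. by move=> oa ob; exact/has_orderD/has_orderN. Qed.

Lemma has_order0 m : has_order m 0.
Proof.
by move=> M; exists 1 => // k p; rewrite cabs0 mul1r decay_ge0.
Qed.

Definition shiftk j a : coef := fun k p => a (k + e_ j) p.
Definition diffk j a : coef := shiftk j a - a.
Definition mulk j a : coef := fun k p => (k ord0 j)%:~R * a k p.
Definition mulp j a : coef := fun k p => (p ord0 j)%:~R * a k p.

Lemma has_order_shiftk j m a : has_order m a -> has_order m (shiftk j a).
Proof.
move=> oa M; have [C C0 aC] := oa M; have [_ /(_ m) [B B0 [K BK]] _ _] := Lam_mod.
exists (C * B * jap (e_ j) ^+ K) => [|k p].
  by rewrite !mulr_gt0 // japX_gt0.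
apply: (le_trans (aC _ _)); rewrite ler_wpM2r ?invr_ge0 ?(ltW (japX_gt0 _ _ _)) //.
by rewrite -!mulrA ler_pM2l // (mulrC (_ ^+ K)) mulrA.
Qed.

Lemma has_order_diffk j m a : has_order m a -> has_order m (diffk j a).
Proof. by move=> oa; apply: has_orderB => //; exact: has_order_shiftk. Qed.

Lemma has_order_mulp j m a : has_order m a -> has_order m (mulp j a).
Proof.
move=> oa M; have [C C0 aC] := oa M.+1; exists C => // k p.
have j0 := jap_gt0 R p; have jM0 := japX_gt0 R p M.
have -> : C * Lam k `^ m * jap p ^- M = jap p * (C * Lam k `^ m * jap p ^- M.+1).
  by rewrite exprSr; field; rewrite !gt_eqF.
rewrite cabsM cabs_intr; apply: ler_pM; rewrite ?cabs_ge0 ?normr_ge0 ?aC //.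
exact: jap_coord.
Qed.

(** By the polynomial lower bound on [Lam], the factor [k_j] costs a fixed
    power of [Lam]. *)
Lemma has_order_mulk : exists2 kap : R, 0 <= kap &
  forall j m a, has_order m a -> has_order (m + kap) (mulk j a).
Proof.
have [_ _ [kap kap0 [B B0 hB]] _] := Lam_mod; exists kap => // j m a oa M.
have [C C0 aC] := oa M; exists (B * C) => [|k p]; first exact: mulr_gt0.
rewrite cabsM cabs_intr LamXD.
have -> : B * C * (Lam k `^ m * Lam k `^ kap) * jap p ^- M =
  (B * Lam k `^ kap) * (C * Lam k `^ m * jap p ^- M) by ring.
by apply: ler_pM; rewrite ?cabs_ge0 ?aC // (le_trans (jap_coord R k j)).
Qed.

(** ** Twisted convolutions *)

(** [beta k q r] stands for an array [b] evaluated at [(k, r)] or at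
    [(k + q, r)]; the loss in [q] is polynomial and is paid by the decay of
    the left factor. *)
Definition amplitude m beta := exists K : nat, forall M, exists2 C : R, 0 < C &
  forall k q r, cabs (beta k q r) <= C * Lam k `^ m * jap q ^+ K * jap r ^- M.

Definition twist a beta : coef := fun k p => csum (fun q => a k q * beta k q (p - q)).

Lemma twist_dominated m m' a beta : has_order m a -> amplitude m' beta ->
  forall M, exists2 C : R, 0 < C & forall k p q,
    cabs (a k q * beta k q (p - q)) <= (C * Lam k `^ (m + m') * jap p ^- M) * wt q.
Proof.
move=> oa [K bK] M; have [C C0 aC] := oa (n.*2 + M + K)%N; have [B B0 bB] := bK M.
exists (C * B) => [|k p q]; first exact: mulr_gt0.
rewrite cabsM; apply: (le_trans (ler_pM (cabs_ge0 _) (cabs_ge0 _) (aC k q) (bB k q _))).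
rewrite LamXD; set x := Lam k `^ m; set y := Lam k `^ m'.
have x0 : 0 <= x := LamX_ge0 _ _; have y0 : 0 <= y := LamX_ge0 _ _.
have h := japXV_sub R p q M; have j0 M' : 0 < jap q ^+ M' := japX_gt0 R q M'.
have -> : C * x * jap q ^- (n.*2 + M + K) * (B * y * jap q ^+ K * jap (p - q) ^- M) =
    (C * B * (x * y)) * (wt q * (jap q ^- M * jap (p - q) ^- M)).
  by rewrite /wt !exprD; field; rewrite !gt_eqF ?japX_gt0.
have -> : C * B * (x * y) * jap p ^- M * wt q =
    (C * B * (x * y)) * (wt q * jap p ^- M) by ring.
rewrite ler_wpM2l ?mulr_ge0 ?(ltW C0) ?(ltW B0) // ler_wpM2l ?wt_ge0 //.
by rewrite mulrC ler_pdivrMr // mulrC.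
Qed.

Lemma twist_summable m m' a beta : has_order m a -> amplitude m' beta ->
  forall k p, abs_summable (fun q => a k q * beta k q (p - q)).
Proof.
move=> oa ob k p; have [C _ h] := twist_dominated oa ob 0%N.
exact: (dominated_summable (h k p)).
Qed.

Lemma has_order_twist m m' a beta : has_order m a -> amplitude m' beta ->
  has_order (m + m') (twist a beta).
Proof.
move=> oa ob M; have [C C0 h] := twist_dominated oa ob M.
exists (C * wmass R n) => [|k p]; first by rewrite mulr_gt0 // wmass_gt0.
apply: (le_trans (dominated_csum_le (h k p))).
by rewrite le_eqVlt; apply/orP; left; apply/eqP; ring.
Qed.

Lemma twistBl m m' a a' beta : has_order m a -> has_order m a' -> amplitude m' beta ->
  twist (a - a') beta = twist a beta - twist a' beta.
Proof.
move=> oa oa' ob; apply/funext => k; apply/funext => p.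
rewrite /twist -[RHS]/(csum _ - csum _) -csumN; last exact: twist_summable oa' ob _ _.
rewrite -csumD; last 2 first.
- exact: twist_summable oa ob _ _.
- have := abs_summableZ (-1) (twist_summable oa' ob k p); congr abs_summable.
  by apply/funext => q; rewrite mulN1r.
by congr csum; apply/funext => q; rewrite -mulNr -mulrDl.
Qed.

Lemma twistBr m m' a beta beta' : has_order m a -> amplitude m' beta -> amplitude m' beta' ->
  twist a (fun k q r => beta k q r - beta' k q r) = twist a beta - twist a beta'.
Proof.
move=> oa ob ob'; apply/funext => k; apply/funext => p.
rewrite /twist -[RHS]/(csum _ - csum _) -csumN; last exact: twist_summable oa ob' _ _.
rewrite -csumD; last 2 first.
- exact: twist_summable oa ob _ _.
- have := abs_summableZ (-1) (twist_summable oa ob' k p); congr abs_summable.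
  by apply/funext => q; rewrite mulN1r.
by congr csum; apply/funext => q; rewrite -mulrN -mulrDr.
Qed.

(** With [a] the array of Fourier coefficients of a symbol in the torus
    variable, [coef_comp a b] is that of the symbol of the operator product,
    and [coef_conv a b] that of the pointwise product of the symbols. *)
Definition coef_comp a b : coef := twist a (fun k q r => b (k + q) r).
Definition coef_conv a b : coef := twist a (fun k q r => b k r).

Lemma amplitude_comp m b : has_order m b -> amplitude m (fun k q r => b (k + q) r).
Proof.
move=> ob; have [_ /(_ m) [B B0 [K BK]] _ _] := Lam_mod; exists K => M.
have [C C0 bC] := ob M; exists (C * B) => [|k q r]; first exact: mulr_gt0.
apply: (le_trans (bC _ _)); rewrite ler_wpM2r ?invr_ge0 ?(ltW (japX_gt0 _ _ _)) //.
by rewrite -!mulrA ler_pM2l // mulrA.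
Qed.

Lemma amplitude_conv m b : has_order m b -> amplitude m (fun k q r => b k r).
Proof.
move=> ob; exists 0%N => M; have [C C0 bC] := ob M; exists C => // k q r.
by rewrite expr0 mulr1.
Qed.

Lemma has_order_comp m m' a b : has_order m a -> has_order m' b ->
  has_order (m + m') (coef_comp a b).
Proof. by move=> oa ob; apply: has_order_twist => //; exact: amplitude_comp. Qed.

Lemma has_order_conv m m' a b : has_order m a -> has_order m' b ->
  has_order (m + m') (coef_conv a b).
Proof. by move=> oa ob; apply: has_order_twist => //; exact: amplitude_conv. Qed.

Lemma compBl m m' a a' b : has_order m a -> has_order m a' -> has_order m' b ->
  coef_comp (a - a') b = coef_comp a b - coef_comp a' b.
Proof. by move=> oa oa' ob; apply: twistBl oa oa' (amplitude_comp ob). Qed.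

Lemma compBr m m' a b b' : has_order m a -> has_order m' b -> has_order m' b' ->
  coef_comp a (b - b') = coef_comp a b - coef_comp a b'.
Proof. by move=> oa ob ob'; apply: twistBr oa (amplitude_comp ob) (amplitude_comp ob'). Qed.

Lemma convBl m m' a a' b : has_order m a -> has_order m a' -> has_order m' b ->
  coef_conv (a - a') b = coef_conv a b - coef_conv a' b.
Proof. by move=> oa oa' ob; apply: twistBl oa oa' (amplitude_conv ob). Qed.

Lemma convBr m m' a b b' : has_order m a -> has_order m' b -> has_order m' b' ->
  coef_conv a (b - b') = coef_conv a b - coef_conv a b'.
Proof. by move=> oa ob ob'; apply: twistBr oa (amplitude_conv ob) (amplitude_conv ob'). Qed.

Lemma shiftk_comp j a b : shiftk j (coef_comp a b) = coef_comp (shiftk j a) (shiftk j b).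
Proof.
apply/funext => k; apply/funext => p; congr csum; apply/funext => q.
by rewrite /shiftk addrAC.
Qed.

Lemma shiftk_conv j a b : shiftk j (coef_conv a b) = coef_conv (shiftk j a) (shiftk j b).
Proof. by []. Qed.

(** The array of the constant symbol 1, a unit for both products. *)
Definition onec : coef := fun k p => if p == 0 then 1 else 0.

Lemma has_order_onec : has_order 0 onec.
Proof.
move=> M; exists 1 => // k p; rewrite powRr0 !mul1r /onec.
case: eqP => [->|_]; first by rewrite cabs1 /jap len1_0 expr1n invr1.
by rewrite cabs0 invr_ge0 ltW // japX_gt0.
Qed.

Lemma twist1l beta k p : twist onec beta k p = beta k 0 p.
Proof.
rewrite /twist -[RHS](csum_delta (0 : 'rV[int]_n)); congr csum; apply/funext => q.
by rewrite /onec; case: eqP => [->|]; rewrite ?mul0r // mul1r subr0.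
Qed.

Lemma csum_onecr (u : 'rV[int]_n -> R[i]) k p :
  csum (fun q => u q * onec k (p - q)) = u p.
Proof.
rewrite -[RHS](csum_delta p); congr csum; apply/funext => q.
by rewrite /onec subr_eq0 eq_sym; case: eqP => [->|]; rewrite ?mulr1 ?mulr0.
Qed.

Lemma comp1l b : coef_comp onec b = b.
Proof. by apply/funext => k; apply/funext => p; rewrite /coef_comp twist1l addr0. Qed.

Lemma conv1l b : coef_conv onec b = b.
Proof. by apply/funext => k; apply/funext => p; rewrite /coef_conv twist1l. Qed.

Lemma comp1r a : coef_comp a onec = a.
Proof. by apply/funext => k; apply/funext => p; exact: (@csum_onecr (a k) k p). Qed.

Lemma conv1r a : coef_conv a onec = a.
Proof. by apply/funext => k; apply/funext => p; exact: (@csum_onecr (a k) k p). Qed.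

Lemma conv_comm m m' a b : has_order m a -> has_order m' b -> coef_conv a b = coef_conv b a.
Proof.
move=> oa ob; apply/funext => k; apply/funext => p; rewrite /coef_conv /twist.
rewrite -(csum_reindex (h := fun q => p - q) (h' := fun q => p - q)).
- by congr csum; apply/funext => q /=; rewrite mulrC opprB addrCA subrr addr0.
- by move=> q; rewrite opprB addrCA subrr addr0.
- by move=> q; rewrite opprB addrCA subrr addr0.
- exact: twist_summable oa (amplitude_conv ob) k p.
Qed.

(** The double series behind a product of three operators converges
    absolutely: the decay of [a] in [q] and that of [C] in [t] absorb the
    polynomial growth of [beta]. *)
Lemma triple_sum m m' a beta (C : 'rV[int]_n -> R[i]) k : has_order m a -> amplitude m' beta ->
  (forall M, exists2 D : R, 0 < D & forall t, cabs (C t) <= D * jap t ^- M) ->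
  csum (fun t => twist a beta k t * C t) =
  csum (fun q => a k q * csum (fun r => beta k q r * C (q + r))).
Proof.
move=> oa ob hC; have [B B0 hB] := twist_dominated oa ob 0%N.
have [D D0 hD] := hC n.*2.
have pos M p : 0 < jap p ^+ M := japX_gt0 R p M.
apply: (@csum_assoc R n (a k) C (beta k) (B * Lam k `^ (m + m') * D)).
- move=> q t; rewrite cabsM; apply: (le_trans (ler_pM _ _ (hB k t q) (hD t))); rewrite ?cabs_ge0 //.
  by rewrite expr0 invr1 mulr1 -/(wt t) le_eqVlt; apply/orP; left; apply/eqP; ring.
- by move=> t; exact: twist_summable oa ob k t.
move=> q; have [K bK] := ob; have [E E0 hE] := bK 0%N.
have [F F0 hF] := hC n.*2.
apply: (@dominated_summable R n _ (E * Lam k `^ m' * jap q ^+ K * (F * jap q ^+ n.*2))) => r.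
rewrite cabsM; apply: (le_trans (ler_pM _ _ (hE k q r) (hF (q + r)))); rewrite ?cabs_ge0 //.
rewrite expr0 invr1 mulr1 -[leRHS]mulrA; apply: ler_wpM2l.
  by rewrite !mulr_ge0 ?LamX_ge0 ?(ltW E0) ?(ltW (pos _ _)).
rewrite -mulrA ler_pM2l // addrC -(opprK q) japN.
by have := japXV_sub R r (- q) n.*2; rewrite japN.
Qed.

(** The column of [a] that enters a product with [a] on the right decreases
    rapidly, by Peetre's inequality and since [Lam (k + t)] grows at most
    polynomially in [t]. *)
Lemma has_order_column m a k p : has_order m a ->
  forall M, exists2 D : R, 0 < D & forall t, cabs (a (k + t) (p - t)) <= D * jap t ^- M.
Proof.
move=> oa M; have [K bK] := amplitude_comp oa; have [C C0 hC] := bK (M + K)%N.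
exists (C * Lam k `^ m * jap p ^+ (M + K)) => [|t].
  by rewrite !mulr_gt0 ?LamX_gt0 ?japX_gt0.
apply: (le_trans (hC k t (p - t))); have h := japXV_sub R t p (M + K).
have -> : C * Lam k `^ m * jap t ^+ K * jap (p - t) ^- (M + K) =
  (C * Lam k `^ m) * (jap t ^+ K * jap (t - p) ^- (M + K)).
  by rewrite -(opprB t p) japN !mulrA.
rewrite -[leRHS]mulrA ler_wpM2l ?mulr_ge0 ?LamX_ge0 ?(ltW C0) //.
have -> : jap p ^+ (M + K) * jap t ^- M = jap t ^+ K * (jap p ^+ (M + K) * jap t ^- (M + K)).
  by rewrite !exprD; field; rewrite !gt_eqF ?japX_gt0.
by rewrite ler_pM2l ?japX_gt0.
Qed.

(** Both sides are the triple sum of [triple_sum], the column of [c] being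
    the rapidly decreasing factor. *)
Lemma compA m1 m2 m3 a b c : has_order m1 a -> has_order m2 b -> has_order m3 c ->
  coef_comp (coef_comp a b) c = coef_comp a (coef_comp b c).
Proof.
move=> oa ob oc; apply/funext => k; apply/funext => p.
rewrite [LHS](triple_sum (C := fun t => c (k + t) (p - t)) _ oa (amplitude_comp ob)).
  congr csum; apply/funext => q; congr (_ * csum _); apply/funext => r.
  by rewrite addrA opprD addrA.
exact: has_order_column oc.
Qed.

Lemma convA m1 m2 m3 a b c : has_order m1 a -> has_order m2 b -> has_order m3 c ->
  coef_conv (coef_conv a b) c = coef_conv a (coef_conv b c).
Proof.
move=> oa ob oc; apply/funext => k; apply/funext => p.
rewrite [LHS](triple_sum (C := fun t => c k (p - t)) _ oa (amplitude_conv ob)).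
  by congr csum; apply/funext => q; congr (_ * csum _); apply/funext => r; rewrite opprD addrA.
move=> M; have [D D0 hD] := oc M; exists (D * Lam k `^ m3 * jap p ^+ M) => [|t].
  by rewrite !mulr_gt0 ?LamX_gt0 ?japX_gt0.
apply: (le_trans (hD _ _)); rewrite -[leRHS]mulrA ler_wpM2l ?mulr_ge0 ?LamX_ge0 ?(ltW D0) //.
by have := japXV_sub R t p M; rewrite -(opprB t p) japN.
Qed.

(** All that the composition formula adds to its leading term. *)
Definition comp_err a b : coef := coef_comp a b - coef_conv a b.

Lemma comp_errE m m' a b : has_order m a -> has_order m' b ->
  comp_err a b = twist a (fun k q r => b (k + q) r - b k r).
Proof.
by move=> oa ob; rewrite (twistBr oa (amplitude_comp ob) (amplitude_conv ob)).
Qed.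

(** Only first differences of [b] enter the error, each of order [m' - rho]:
    they are summed along a lattice path from [k] to [k + q]. *)
Lemma has_order_comp_err m m' a b : has_order m a -> has_order m' b ->
  (forall j, has_order (m' - rho) (diffk j b)) -> has_order (m + (m' - rho)) (comp_err a b).
Proof.
move=> oa ob db; rewrite (comp_errE oa ob); apply: has_order_twist => //.
have [_ /(_ (m' - rho)) [B B0 [K BK]] _ _] := Lam_mod; exists K.+1 => M.
have /choice [C hC] : forall j, exists C : R, 0 < C /\ forall k p,
    cabs (diffk j b k p) <= C * Lam k `^ (m' - rho) * jap p ^- M.
  by move=> j; have [C C0 h] := db j M; exists C.
pose D := 1 + \sum_j C j.
have D0 : 0 < D by rewrite ltr_pwDl // sumr_ge0 // => j _; have [/ltW] := hC j.
have CD j : C j <= D.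
  rewrite /D (bigD1 j) //= addrCA lerDl addr_ge0 // sumr_ge0 // => i _.
  by have [/ltW] := hC i.
exists (D * B) => [|k q r]; first exact: mulr_gt0.
have jr0 : 0 < jap r ^- M by rewrite invr_gt0 japX_gt0.
(* the bound for one step at distance l from k, increasing in l *)
pose g (l : nat) : R := D * B * Lam k `^ (m' - rho) * jap r ^- M * l.+1%:R ^+ K.
have g0 : 0 <= D * B * Lam k `^ (m' - rho) * jap r ^- M.
  by rewrite !mulr_ge0 ?LamX_ge0 ?(ltW D0) ?(ltW B0) ?(ltW jr0).
apply: (le_trans (@lattice_path R n _ (fun x y => cabs (x - y)) (fun k => b k r) g k _ _ _ _ _ q)).
- by move=> x; rewrite subrr cabs0.
- by move=> x y; rewrite cabsBC.
- by move=> x y z; rewrite -{1}(subrK y x) -addrA cabsD.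
- by move=> x y xy; rewrite ler_wpM2l // lerXn2r ?nnegrE // ler_nat.
- move=> q' j; have [_ h] := hC j; apply: (le_trans (h (k + q') r)).
  rewrite /g -/(jap q') -!mulrA; apply: ler_pM; rewrite ?(ltW (proj1 (hC j))) //.
    by rewrite mulr_ge0 ?LamX_ge0 ?(ltW jr0).
  rewrite (mulrC (_ ^- M)) !mulrA ler_pM2r //; exact: BK.
rewrite /g -/(jap q) exprSr.
have -> : D * B * Lam k `^ (m' - rho) * (jap q ^+ K * jap q) * jap r ^- M =
  jap q * (D * B * Lam k `^ (m' - rho) * jap r ^- M * jap q ^+ K) by ring.
apply: ler_wpM2r; first by rewrite mulr_ge0 // ltW ?japX_gt0.
by rewrite /jap ler_nat.
Qed.

(** ** Difference estimates *)

(** Symbol estimates up to a finite number of differences: the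
    estimate of a product loses differences of the right factor, and this is
    tracked by [N]. *)
Fixpoint symb_upto N m a : Prop :=
  has_order m a /\
  if N is N'.+1 then forall j, symb_upto N' (m - rho) (diffk j a) else True.

Lemma symb_upto_order N m a : symb_upto N m a -> has_order m a.
Proof. by case: N => [|N] []. Qed.

Lemma symb_upto_pred N m a : symb_upto N.+1 m a -> symb_upto N m a.
Proof.
elim: N m a => [|N IH] m a; first by case.
by case=> oa da; split => // j; apply: IH; exact: da.
Qed.

Lemma diffkD j a b : diffk j (a + b) = diffk j a + diffk j b.
Proof. by rewrite /diffk opprD addrACA. Qed.

Lemma diffkN j a : diffk j (- a) = - diffk j a.
Proof. by rewrite /diffk opprD.  Qed.

Lemma diffkC i j a : diffk i (diffk j a) = diffk j (diffk i a).
Proof.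
apply/funext => k; apply/funext => p.
change (a (k + e_ i + e_ j) p - a (k + e_ i) p - (a (k + e_ j) p - a k p) =
  a (k + e_ j + e_ i) p - a (k + e_ j) p - (a (k + e_ i) p - a k p)).
rewrite [k + e_ j + e_ i]addrAC; ring.
Qed.

Lemma symb_uptoD N m a b : symb_upto N m a -> symb_upto N m b -> symb_upto N m (a + b).
Proof.
elim: N m a b => [|N IH] m a b [oa da] [ob db]; split => //; try exact: has_orderD.
by move=> j; rewrite diffkD; exact: IH (da j) (db j).
Qed.

Lemma symb_uptoN N m a : symb_upto N m a -> symb_upto N m (- a).
Proof.
elim: N m a => [|N IH] m a [oa da]; split => //; try exact: has_orderN.
by move=> j; rewrite diffkN; exact: IH (da j).
Qed.

Lemma symb_upto_le N m m' a : m <= m' -> symb_upto N m a -> symb_upto N m' a.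
Proof.
elim: N m m' a => [|N IH] m m' a mm [oa da]; split => //; try exact: has_order_le oa.
by move=> j; apply: IH (da j); rewrite lerD2r.
Qed.

Lemma symb_upto_shiftk N i m a : symb_upto N m a -> symb_upto N m (shiftk i a).
Proof.
elim: N m a => [|N IH] m a [oa da]; split => //; try exact: has_order_shiftk.
move=> j; have -> : diffk j (shiftk i a) = shiftk i (diffk j a); last exact: IH (da j).
apply/funext => k; apply/funext => p.
change (a (k + e_ j + e_ i) p - a (k + e_ i) p = a (k + e_ i + e_ j) p - a (k + e_ i) p).
by rewrite addrAC.
Qed.

Lemma symb_upto_mulp N i m a : symb_upto N m a -> symb_upto N m (mulp i a).
Proof.
elim: N m a => [|N IH] m a [oa da]; split => //; try exact: has_order_mulp.
move=> j; have -> : diffk j (mulp i a) = mulp i (diffk j a); last exact: IH (da j).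
by apply/funext => k; apply/funext => p; rewrite -[LHS]mulrBr.
Qed.

(** A bilinear product commuting with shifts satisfies the Leibniz rule of
    differences. Abstracting it lets [coef_comp], [coef_conv] and [comp_err]
    share the inductions below. *)
Definition leibniz_product (B : coef -> coef -> coef) :=
  (forall m m' a b j, has_order m a -> has_order m' b ->
     diffk j (B a b) = B (diffk j a) b + B (shiftk j a) (diffk j b)).

Lemma leibniz_of_bilinear (B : coef -> coef -> coef) :
  (forall m m' a a' b, has_order m a -> has_order m a' -> has_order m' b ->
     B (a - a') b = B a b - B a' b) ->
  (forall m m' a b b', has_order m a -> has_order m' b -> has_order m' b' ->
     B a (b - b') = B a b - B a b') ->
  (forall j a b, shiftk j (B a b) = B (shiftk j a) (shiftk j b)) ->
  leibniz_product B.
Proof.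
move=> Bl Br Bs m m' a b j oa ob.
have sa := has_order_shiftk j oa; have sb := has_order_shiftk j ob.
rewrite /diffk (Bl _ _ _ _ _ sa oa ob) (Br _ _ _ _ _ sa sb ob) -Bs.
by rewrite [RHS]addrC addrA subrK.
Qed.

Lemma comp_leibniz : leibniz_product coef_comp.
Proof.
apply: leibniz_of_bilinear; [exact: compBl|exact: compBr|exact: shiftk_comp].
Qed.

Lemma conv_leibniz : leibniz_product coef_conv.
Proof.
apply: leibniz_of_bilinear; [exact: convBl|exact: convBr|by []].
Qed.

Lemma comp_err_leibniz : leibniz_product comp_err.
Proof.
move=> m m' a b j oa ob; rewrite /comp_err diffkD diffkN.
rewrite (comp_leibniz j oa ob) (conv_leibniz j oa ob).
by rewrite opprD addrACA.
Qed.

(** The order estimate [Bo] of the product may use [d] differences of the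
    right factor; the Leibniz rule then gives [N] differences of the product
    from [d + N] of the right factor. *)
Lemma symb_upto_product (B : coef -> coef -> coef) d g : leibniz_product B ->
  (forall m m' a b, has_order m a -> symb_upto d m' b -> has_order (m + m' + g) (B a b)) ->
  forall N m m' a b, symb_upto N m a -> symb_upto (d + N) m' b ->
    symb_upto N (m + m' + g) (B a b).
Proof.
move=> BL Bo; elim=> [|N IH] m m' a b sa sb.
  by split=> //; apply: Bo; [exact: symb_upto_order sa|rewrite addn0 in sb].
have oa := symb_upto_order sa; have ob := symb_upto_order sb.
have sb' : symb_upto (d + N) m' b by apply: symb_upto_pred; rewrite -addnS.
have sd : symb_upto d m' b.
  elim: {IH sa} N.+1 sb {sb'} => [|N' IH]; first by rewrite addn0.
  by rewrite addnS => /symb_upto_pred.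
split; first exact: Bo.
move=> j; rewrite (BL _ _ _ _ j oa ob); apply: symb_uptoD.
  have -> : m + m' + g - rho = m - rho + m' + g by ring.
  by apply: IH => //; exact: (proj2 sa j).
have -> : m + m' + g - rho = m + (m' - rho) + g by ring.
apply: IH; first exact/symb_upto_shiftk/symb_upto_pred.
by move: sb; rewrite addnS => sb; exact: (proj2 sb j).
Qed.

Lemma symb_upto_conv N m m' a b : symb_upto N m a -> symb_upto N m' b ->
  symb_upto N (m + m') (coef_conv a b).
Proof.
move=> sa sb; rewrite -[m + m']addr0.
apply: (@symb_upto_product coef_conv 0 0 conv_leibniz) => // m1 m2 a1 b1 o1 /symb_upto_order o2.
by rewrite addr0; exact: has_order_conv.
Qed.

Lemma symb_upto_comp N m m' a b : symb_upto N m a -> symb_upto N m' b ->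
  symb_upto N (m + m') (coef_comp a b).
Proof.
move=> sa sb; rewrite -[m + m']addr0.
apply: (@symb_upto_product coef_comp 0 0 comp_leibniz) => // m1 m2 a1 b1 o1 /symb_upto_order o2.
by rewrite addr0; exact: has_order_comp.
Qed.

Lemma symb_upto_comp_err N m m' a b : symb_upto N m a -> symb_upto N.+1 m' b ->
  symb_upto N (m + m' - rho) (comp_err a b).
Proof.
move=> sa sb.
apply: (@symb_upto_product comp_err 1 (- rho) comp_err_leibniz) => // m1 m2 a1 b1 o1 hb.
have [bo bd] := hb.
rewrite -addrA; apply: has_order_comp_err => // j; exact: (proj1 (bd j)).
Qed.

(** ** The classes with the weighted differences [k_j Delta_j] *)

(** Peeling off one direction at a time: [a] belongs to the class for
    [j :: s] when [a] and [k_j Delta_j a] belong to the class for [s]. When [s]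
    enumerates all directions, this amounts to all the [k^g Delta^g a] being
    symbols, and it allows induction on [s]. *)
Fixpoint mclass (s : seq 'I_n) m a : Prop :=
  if s is j :: s' then mclass s' m a /\ mclass s' m (mulk j (diffk j a))
  else forall N, symb_upto N m a.

Lemma mclass_symb s m a N : mclass s m a -> symb_upto N m a.
Proof. by elim: s a => [|j s IH] a; [|case=> /IH]. Qed.

Lemma mclass_order s m a : mclass s m a -> has_order m a.
Proof. by move=> /(mclass_symb 0)/symb_upto_order. Qed.

Lemma mulkD j a b : mulk j (a + b) = mulk j a + mulk j b.
Proof. by apply/funext => k; apply/funext => p; rewrite -[RHS]mulrDr. Qed.

Lemma mulkN j a : mulk j (- a) = - mulk j a.
Proof. by apply/funext => k; apply/funext => p; rewrite -[RHS]mulrN. Qed.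

Lemma mclassD s m a b : mclass s m a -> mclass s m b -> mclass s m (a + b).
Proof.
elim: s a b => [|j s IH] a b /=; first by move=> sa sb N; exact: symb_uptoD.
by move=> [a1 a2] [b1 b2]; rewrite diffkD mulkD; split; [exact: IH a1 b1|exact: IH a2 b2].
Qed.

Lemma mclassN s m a : mclass s m a -> mclass s m (- a).
Proof.
elim: s a => [|j s IH] a /=; first by move=> sa N; exact: symb_uptoN.
by move=> [a1 a2]; rewrite diffkN mulkN; split; [exact: IH a1|exact: IH a2].
Qed.

Lemma mclassB s m a b : mclass s m a -> mclass s m b -> mclass s m (a - b).
Proof. by move=> sa sb; exact/mclassD/mclassN. Qed.

Lemma mclass_le s m m' a : m <= m' -> mclass s m a -> mclass s m' a.
Proof.
move=> mm; elim: s a => [|j s IH] a /=; first by move=> sa N; exact: symb_upto_le (sa N).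
by move=> [a1 a2]; split; [exact: IH a1|exact: IH a2].
Qed.

Lemma mclass_mulp s i m a : mclass s m a -> mclass s m (mulp i a).
Proof.
elim: s a => [|j s IH] a /=; first by move=> sa N; exact: symb_upto_mulp.
move=> [a1 a2]; split; first exact: IH a1.
have -> : mulk j (diffk j (mulp i a)) = mulp i (mulk j (diffk j a)); last exact: IH a2.
by apply/funext => k; apply/funext => p; rewrite /mulk /mulp -[X in _ * X]mulrBr mulrCA.
Qed.

(** The weight and the difference in the same direction do not commute: the
    commutator is a shift. *)
Lemma diffk_mulk i j a : diffk i (mulk j a) =
  mulk j (diffk i a) + (if i == j then shiftk i a else 0).
Proof.
apply/funext => k; apply/funext => p.
rewrite -[LHS]/((((k + e_ i) ord0 j)%:~R * a (k + e_ i) p) - (k ord0 j)%:~R * a k p).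
rewrite -[RHS]/((k ord0 j)%:~R * (a (k + e_ i) p - a k p) +
  ((if i == j then shiftk i a else 0) : coef) k p).
rewrite !mxE eqxx /= [j == i]eq_sym; case: eqP => _ /=.
  by rewrite rmorphD /= -[shiftk i a k p]/(a (k + e_ i) p) mulr1z; ring.
by rewrite addr0 -[(0 : coef) k p]/(0 : R[i]); ring.
Qed.

(** Differencing gains [rho] although the differences do not commute with the
    weights: the commutator is a shift of an already differenced array. *)
Lemma mclass_diffk_shiftk s i m a : mclass s m a ->
  mclass s (m - rho) (diffk i a) /\ mclass s m (shiftk i a).
Proof.
suff dk : forall m a, mclass s m a -> mclass s (m - rho) (diffk i a).
  move=> sa; split; first exact: dk.
  rewrite -(subrK a (shiftk i a)); apply: mclassD => //.
  by apply: mclass_le (dk _ _ sa); rewrite gerBl.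
elim: s => [|j s IH] {}m {}a /=; first by move=> sa N; exact: (proj2 (sa N.+1) i).
move=> [a1 a2]; split; first exact: IH _ _ a1.
have -> : mulk j (diffk j (diffk i a)) =
  diffk i (mulk j (diffk j a)) - (if i == j then shiftk i (diffk j a) else 0).
  by rewrite diffk_mulk addrK diffkC.
apply: mclassB; first exact: IH a2.
case: eqP => [<-|_]; last first.
  rewrite -(subrr (diffk i a)).
  by apply: mclassB; exact: IH a1.
have d1 := IH _ _ a1; rewrite -(subrK (diffk i a) (shiftk i _)); apply: mclassD => //.
by apply: mclass_le (IH _ _ d1); rewrite gerBl.
Qed.

Lemma mclass_diffk s i m a : mclass s m a -> mclass s (m - rho) (diffk i a).
Proof. by move=> /(mclass_diffk_shiftk i)[]. Qed.

Lemma mclass_shiftk s i m a : mclass s m a -> mclass s m (shiftk i a).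
Proof. by move=> /(mclass_diffk_shiftk i)[]. Qed.

Lemma mulk_twist j m m' a beta : has_order m a -> amplitude m' beta ->
  mulk j (twist a beta) = twist (mulk j a) beta.
Proof.
move=> oa ob; apply/funext => k; apply/funext => p.
rewrite -[LHS]/(_ * csum _) -csumZ; last exact: twist_summable oa ob k p.
by congr csum; apply/funext => q; rewrite mulrA.
Qed.

Lemma mulk_conv j m m' a b : has_order m a -> has_order m' b ->
  mulk j (coef_conv a b) = coef_conv a (mulk j b).
Proof.
move=> oa ob; apply/funext => k; apply/funext => p.
rewrite -[LHS]/(_ * csum _) -csumZ; last exact: twist_summable oa (amplitude_conv ob) k p.
by congr csum; apply/funext => q; rewrite mulrCA.
Qed.

(** The weight [k_j] reaches the right factor as [(k + q)_j]; the difference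
    [q_j] is absorbed by the decay of the left factor. *)
Lemma mulk_comp j m m' a b : has_order m a -> has_order m' b ->
  mulk j (coef_comp a b) = coef_comp a (mulk j b) - coef_comp (mulp j a) b.
Proof.
move=> oa ob; have [kap _ hk] := has_order_mulk; have okb := hk j _ _ ob.
apply/funext => k; apply/funext => p.
rewrite -[LHS]/(_ * csum _) -csumZ; last exact: twist_summable oa (amplitude_comp ob) k p.
rewrite -[RHS]/(csum _ - csum _) -csumN; last first.
  exact: twist_summable (has_order_mulp j oa) (amplitude_comp ob) k p.
rewrite -csumD; last 2 first.
- exact: twist_summable oa (amplitude_comp okb) k p.
- have := abs_summableZ (-1) (twist_summable (has_order_mulp j oa) (amplitude_comp ob) k p).
  by congr abs_summable; apply/funext => q; rewrite mulN1r.
by congr csum; apply/funext => q; rewrite /mulk /mulp mxE rmorphD /=; ring.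
Qed.

Lemma mclass_conv s m m' a b : mclass s m a -> mclass s m' b ->
  mclass s (m + m') (coef_conv a b).
Proof.
elim: s a b => [|j s IH] a b /=; first by move=> sa sb N; exact: symb_upto_conv.
move=> [a1 a2] [b1 b2]; split; first exact: IH a1 b1.
have oa := mclass_order a1; have ob := mclass_order b1.
rewrite (conv_leibniz j oa ob) mulkD.
rewrite (mulk_twist j (has_order_diffk j oa) (amplitude_conv ob)) -/(coef_conv _ _).
rewrite (mulk_conv j (has_order_shiftk j oa) (has_order_diffk j ob)).
apply: mclassD; first exact: IH a2 b1.
exact: IH (mclass_shiftk j a1) b2.
Qed.

(** Induction on the directions: [k_j Delta_j] acts as a derivation up to
    the terms with [mulp j a] of [mulk_comp], which stay in the class. *)
Lemma mclass_comp s m m' a b : mclass s m a -> mclass s m' b ->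
  mclass s (m + m') (coef_comp a b).
Proof.
elim: s m m' a b => [|j s IH] m m' a b /=; first by move=> sa sb N; exact: symb_upto_comp.
move=> [a1 a2] [b1 b2]; split; first exact: IH a1 b1.
have oa := mclass_order a1; have ob := mclass_order b1.
rewrite (comp_leibniz j oa ob) mulkD.
rewrite (mulk_twist j (has_order_diffk j oa) (amplitude_comp ob)) -/(coef_comp _ _).
rewrite (mulk_comp j (has_order_shiftk j oa) (has_order_diffk j ob)).
apply: mclassD; first exact: IH a2 b1.
apply: mclassB; first exact: IH (mclass_shiftk j a1) b2.
apply: (@mclass_le _ (m + (m' - rho))); first by rewrite addrA gerBl.
exact: IH (mclass_mulp j (mclass_shiftk j a1)) (mclass_diffk j b1).
Qed.

(** As in [mclass_comp]. In the extra term of [mulk_comp] the right factor is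
    [diffk j b], which has order [m' - rho], so it is as small as the error. *)
Lemma mclass_comp_err s m m' a b : mclass s m a -> mclass s m' b ->
  mclass s (m + m' - rho) (comp_err a b).
Proof.
elim: s m m' a b => [|j s IH] m m' a b /=; first by move=> sa sb N; exact: symb_upto_comp_err.
move=> [a1 a2] [b1 b2]; split; first exact: IH a1 b1.
have oa := mclass_order a1; have ob := mclass_order b1.
rewrite (comp_err_leibniz j oa ob) mulkD.
have oda := has_order_diffk j oa; have odb := has_order_diffk j ob.
have osa := has_order_shiftk j oa.
have -> : mulk j (comp_err (diffk j a) b) = comp_err (mulk j (diffk j a)) b.
  rewrite /comp_err mulkD mulkN (mulk_twist j oda (amplitude_comp ob)).
  by rewrite (mulk_twist j oda (amplitude_conv ob)).
have -> : mulk j (comp_err (shiftk j a) (diffk j b)) =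
    comp_err (shiftk j a) (mulk j (diffk j b)) - coef_comp (mulp j (shiftk j a)) (diffk j b).
  rewrite /comp_err mulkD mulkN (mulk_comp j osa odb) (mulk_conv j osa odb).
  by rewrite addrAC.
apply: mclassD; first exact: IH a2 b1.
apply: mclassB; first exact: IH (mclass_shiftk j a1) b2.
rewrite -addrA.
exact: mclass_comp (mclass_mulp j (mclass_shiftk j a1)) (mclass_diffk j b1).
Qed.

(** ** Reciprocals *)

(** The discrete form of [(1 / a)' = - a' / a ^ 2]. *)
Lemma diffk_reciprocal j m a b : has_order m a -> has_order (- m) b -> coef_conv a b = onec ->
  diffk j b = - coef_conv (coef_conv (shiftk j b) (diffk j a)) b.
Proof.
move=> oa ob ab; have sa := has_order_shiftk j oa; have sb := has_order_shiftk j ob.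
have sab : coef_conv (shiftk j b) (shiftk j a) = onec.
  by rewrite (conv_comm sb sa) -shiftk_conv ab.
have c1 := has_order_conv sb sa; have c2 := has_order_conv sb oa.
rewrite /diffk (convBr sb sa oa) (convBl c1 c2 ob) sab conv1l.
by rewrite (convA sb oa ob) ab conv1r opprB.
Qed.

Lemma symb_upto_reciprocal N m a b : has_order (- m) b -> symb_upto N m a ->
  coef_conv a b = onec -> symb_upto N (- m) b.
Proof.
move=> ob + ab; elim: N => [//|N IH] sa; split=> // j.
have sb := IH (symb_upto_pred sa); have [oa da] := sa.
rewrite (diffk_reciprocal j oa ob ab); apply: symb_uptoN.
have -> : - m - rho = - m + (m - rho) + - m by ring.
apply: symb_upto_conv => //; apply: symb_upto_conv; last exact: da.
exact: symb_upto_shiftk.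
Qed.

(** The order estimate of [b] alone is given; those of its differences
    follow from [diffk_reciprocal]. *)
Lemma mclass_reciprocal s m a b : has_order (- m) b -> mclass s m a ->
  coef_conv a b = onec -> mclass s (- m) b.
Proof.
move=> ob + ab; elim: s => [|j s IH] /=.
  by move=> sa N; exact: symb_upto_reciprocal ob (sa N) ab.
move=> [a1 a2]; have b1 := IH a1; split => //.
have oa := mclass_order a1; have oda := has_order_diffk j oa.
have sb := has_order_shiftk j ob.
rewrite (diffk_reciprocal j oa ob ab) mulkN; apply: mclassN.
rewrite (mulk_twist j (has_order_conv sb oda) (amplitude_conv ob)) -/(coef_conv _ _).
rewrite (mulk_conv j sb oda).
have -> : - m = - m + m + - m by ring.
by apply: mclass_conv => //; apply: mclass_conv => //; exact: mclass_shiftk.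
Qed.

(** ** Residual arrays and asymptotic sums *)

(** Order [- oo]; differences and weights preserve this class
    ([residual_mclass]). *)
Definition residual a := forall Q, has_order Q a.

Lemma residualD a b : residual a -> residual b -> residual (a + b).
Proof. by move=> ra rb Q; exact: has_orderD. Qed.

Lemma residualN a : residual a -> residual (- a).
Proof. by move=> ra Q; exact: has_orderN. Qed.

Lemma residual_compl m a b : residual a -> has_order m b -> residual (coef_comp a b).
Proof.
move=> ra ob Q; rewrite -(subrK m Q); exact: has_order_comp (ra (Q - m)) ob.
Qed.

Lemma residual_compr m a b : has_order m a -> residual b -> residual (coef_comp a b).
Proof.
move=> oa rb Q; have -> : Q = m + (Q - m) by ring.
exact: has_order_comp oa (rb (Q - m)).
Qed.

(** Differences and weights cost only finitely many powers of [Lam], so an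
    array that is approximable to every order within the class is in it. *)
Lemma mclass_approx s m a :
  (forall Q, exists2 b, mclass s m b & has_order Q (a - b)) -> mclass s m a.
Proof.
have [kap kap0 hk] := has_order_mulk.
(* N differences of an array of very low order, estimated crudely *)
have low N Q b : has_order (Q - rho *+ N) b -> symb_upto N Q b.
  elim: N Q b => [|N IH] Q b ob; first by split => //; rewrite mulr0n subr0 in ob.
  split; first by apply: has_order_le ob; rewrite gerBl mulrn_wge0.
  move=> j; apply: IH; apply: has_order_diffk.
  by have -> : Q - rho - rho *+ N = Q - rho *+ N.+1 by rewrite mulrS; ring.
elim: s a => [|j s IH] a ha /=.
  move=> N; have [b sb /low rb] := ha (m - rho *+ N).
  by rewrite -(subrK b a); exact: symb_uptoD.
split; first by apply: IH => Q; have [b [sb _] rb] := ha Q; exists b.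
apply: IH => Q; have [b [_ sb] rb] := ha (Q - kap); exists (mulk j (diffk j b)) => //.
have -> : mulk j (diffk j a) - mulk j (diffk j b) = mulk j (diffk j (a - b)).
  by rewrite diffkD mulkD diffkN mulkN.
rewrite -(subrK kap Q); apply: hk; exact: has_order_diffk.
Qed.

Lemma mclass0 s m : mclass s m 0.
Proof.
elim: s => [|j s IH] /=; last first.
  split=> //; have -> : mulk j (diffk j 0) = 0; last exact: IH.
  by apply/funext => k; apply/funext => p; rewrite -[LHS]/(_ * (0 - 0)) subrr mulr0.
move=> N; elim: N m => [|N IH] m; split; try exact: has_order0; first by [].
move=> j; have -> : diffk j 0 = 0; last exact: IH.
by apply/funext => k; apply/funext => p; rewrite -[LHS]/(0 - 0) subrr.
Qed.

Lemma residual_mclass s m a : residual a -> mclass s m a.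
Proof.
move=> ra; apply: mclass_approx => Q; exists 0; first exact: mclass0.
by rewrite subr0; exact: ra.
Qed.

(** On a bounded set of [k] all powers of [Lam] are comparable. *)
Lemma bounded_support_residual m a (B : nat) : has_order m a ->
  (forall k p, (B <= len1 k)%N -> a k p = 0) -> residual a.
Proof.
move=> oa a0 Q M; have [C C0 aC] := oa M.
have [_ /(_ (m - Q)) [D D0 [K hK]] _ _] := Lam_mod.
exists (C * (D * Lam 0 `^ (m - Q) * B.+1%:R ^+ K)) => [|k p].
  by rewrite !mulr_gt0 ?LamX_gt0 // exprn_gt0.
have [Bk|kB] := leqP B (len1 k).
  by rewrite a0 // cabs0 -mulrA mulr_ge0 ?decay_ge0 // !mulr_ge0 ?LamX_ge0 ?exprn_ge0 // ltW.
apply: (le_trans (aC k p)); rewrite ler_wpM2r ?invr_ge0 ?(ltW (japX_gt0 _ _ _)) //. 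
rewrite -[leRHS]mulrA ler_pM2l //.
have -> : Lam k `^ m = Lam k `^ (m - Q) * Lam k `^ Q by rewrite -LamXD subrK.
apply: ler_wpM2r; first exact: LamX_ge0.
rewrite -{1}(add0r k); apply: (le_trans (hK 0 k)); apply: ler_wpM2l.
  by rewrite mulr_ge0 ?LamX_ge0 // ltW.
by rewrite lerXn2r ?nnegrE ?jap_ge0 // /jap ler_nat ltnW.
Qed.

Lemma has_order_sum m (I : Type) (r : seq I) (P : pred I) (u : I -> coef) :
  (forall i, P i -> has_order m (u i)) -> has_order m (\sum_(i <- r | P i) u i).
Proof.
move=> ou; elim/big_rec: _ => [|i x Pi ox]; first exact: has_order0.
exact: has_orderD (ou i Pi) ox.
Qed.

Lemma coef_sumE (I : Type) (r : seq I) (P : pred I) (u : I -> coef) k p :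
  (\sum_(i <- r | P i) u i) k p = \sum_(i <- r | P i) u i k p.
Proof. by elim/big_rec2: _ => // i x y _ <-. Qed.

Lemma decay_mono_rho M (l l' : nat) a : (l' <= l)%N -> decay M (- (rho *+ l)) a ->
  decay M (- (rho *+ l')) a.
Proof.
by move=> ll; apply: decay_le => //; rewrite lerN2 ler_wpMn2l.
Qed.

(** ** Asymptotic summation *)

(** The sum is cut off sharply in [k]: the [l]-th array enters once [len1 k]
    exceeds [l] and the constants of its estimates. A sharp cut-off does no
    harm as only the absence of finitely many terms on a bounded set of [k] has
    to be controlled, which is residual. At [k] there are then at most [len1 k]
    terms with constants at most [len1 k], at the cost of a fixed power of
    [Lam]. *)
Lemma asymptotic_sum (u : nat -> coef) : 0 < rho ->
  (forall l, has_order (- (rho *+ l)) (u l)) ->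
  exists S : coef, forall N, has_order (- (rho *+ N)) (S - \sum_(l < N) u l).
Proof.
move=> rho0 ou.
have [_ _ [kap kap0 [J J0 hJ]] _] := Lam_mod.
(* one constant for all the weaker estimates on u l *)
have /choice [E hE] : forall l, exists E : nat, forall N M, (N <= l)%N -> (M <= l)%N ->
    forall k p, cabs (u l k p) <= E%:R * Lam k `^ (- (rho *+ N)) * jap p ^- M.
  move=> l.
  have /choice [C hC] : forall i : 'I_l.+1 * 'I_l.+1, exists C : R, 0 < C /\ forall k p,
      cabs (u l k p) <= C * Lam k `^ (- (rho *+ i.1)) * jap p ^- i.2.
    move=> i; have il : (i.1 <= l)%N by rewrite -ltnS.
    by have [C C0 h] := decay_mono_rho il (ou l i.2); exists C.
  exists (Num.bound (\sum_i C i)) => N M Nl Ml k p.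
  pose i := (Ordinal (Nl : (N < l.+1)%N), Ordinal (Ml : (M < l.+1)%N)).
  have [_ /(_ k p) h] := hC i; apply: (le_trans h).
  rewrite /= -!mulrA; apply: ler_wpM2r; first exact: decay_ge0.
  have s0 i' : 0 <= C i' by have [/ltW] := hC i'.
  apply: (@le_trans _ _ (\sum_i C i)); last by rewrite ltW // archi_boundP ?sumr_ge0.
  by rewrite (bigD1 i) //= lerDl sumr_ge0.
pose on l k := (l < len1 k)%N && (E l <= len1 k)%N.
pose S : coef := fun k p => \sum_(0 <= l < len1 k | on l k) u l k p.
(* the part of u l that is left out of S *)
pose off l : coef := fun k p => if on l k then 0 else u l k p.
have off_res l : residual (off l).
  apply: (@bounded_support_residual (- (rho *+ l)) _ (maxn l.+1 (E l))).
    move=> M; have [C C0 h] := ou l M; exists C => // k p.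
    by rewrite /off; case: ifP => // _; rewrite cabs0 -mulrA mulr_ge0 ?decay_ge0 ?(ltW C0).
  by move=> k p; rewrite geq_max /off /on => ->.
pose tail N1 : coef := fun k p => \sum_(N1 <= l < len1 k | on l k) u l k p.
have SE N1 : S - \sum_(l < N1) u l = tail N1 - \sum_(l < N1) off l.
  apply/funext => k; apply/funext => p.
  rewrite -[LHS]/(S k p - (\sum_(l < N1) u l) k p) -[RHS]/(tail N1 k p - (\sum_(l < N1) off l) k p).
  rewrite !coef_sumE /S /tail.
  have -> : \sum_(0 <= l < len1 k | on l k) u l k p =
      \sum_(0 <= l < N1 | on l k) u l k p + \sum_(N1 <= l < len1 k | on l k) u l k p.
    have [Nk|kN] := leqP N1 (len1 k); first by rewrite -big_cat_nat.
    rewrite [X in _ = _ + X]big_geq ?(ltnW kN) // addr0 (@big_cat_nat _ _ _ (len1 k) 0 N1) ?(ltnW kN) //=.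
    rewrite [X in _ = _ + X]big_nat_cond [X in _ = _ + X]big_pred0 ?addr0 // => l.
    by rewrite /on; case: (ltnP l (len1 k)) => h; rewrite ?andbF // leqNgt h.
  have -> : \sum_(l < N1) off l k p =
      \sum_(l < N1) u l k p - \sum_(0 <= l < N1 | on l k) u l k p.
    rewrite big_mkord (bigID (fun l : 'I_N1 => on l k) xpredT) /=.
    rewrite [in RHS](bigID (fun l : 'I_N1 => on l k) xpredT) /= addrAC subrr add0r.
    rewrite big1 ?add0r => [|l]; last by rewrite /off => ->.
    by apply: eq_bigr => l; rewrite /off => /negbTE ->.
  by ring.
exists S => N M.
(* beyond N1 the two factors len1 k are paid by the gain in order *)
pose N1 := maxn M (N + Num.bound (kap *+ 2 / rho)).
have N1r : kap *+ 2 - rho *+ N1 <= - (rho *+ N).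
  have h : kap *+ 2 / rho < (Num.bound (kap *+ 2 / rho))%:R.
    by apply: archi_boundP; rewrite divr_ge0 ?mulrn_wge0 // ltW.
  move: h; rewrite ltr_pdivrMr // mulr_natl => /ltW h.
  rewrite -lerN2 opprB opprK lerBrDr (le_trans (lerD (lexx _) h)) // -mulrnDr.
  by apply: ler_wpMn2l => //; rewrite leq_maxr.
have tail_dec : decay M (- (rho *+ N)) (tail N1).
  apply: (@decay_le M M (kap *+ 2 - rho *+ N1)) => //.
  exists (J * J) => [|k p]; first exact: mulr_gt0.
  have x0 := LamX_ge0 (- (rho *+ N1)) k; have y0 : 0 <= jap p ^- M.
    by rewrite invr_ge0 ltW // japX_gt0.
  have jl : ((len1 k)%:R : R) <= jap k by rewrite /jap ler_nat.
  have term l : (N1 <= l)%N -> on l k ->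
      cabs (u l k p) <= (len1 k)%:R * Lam k `^ (- (rho *+ N1)) * jap p ^- M.
    move=> Nl /andP[_ El]; apply: (le_trans (hE l N1 M _ _ k p)) => //.
      by rewrite (leq_trans _ Nl) // leq_maxl.
    by rewrite -!mulrA ler_wpM2r ?mulr_ge0 // ler_nat.
  have -> : J * J * Lam k `^ (kap *+ 2 - rho *+ N1) * jap p ^- M =
     (J * Lam k `^ kap) * (J * Lam k `^ kap * Lam k `^ (- (rho *+ N1)) * jap p ^- M).
    by rewrite LamXD mulr2n LamXD; ring.
  apply: (@le_trans _ _ ((len1 k)%:R * ((len1 k)%:R * Lam k `^ (- (rho *+ N1)) * jap p ^- M))).
    rewrite /tail big_nat_cond (le_trans (cabs_sum_cond _ _ _)) //.
    apply: (@le_trans _ _ (\sum_(N1 <= l < len1 k)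
        (len1 k)%:R * Lam k `^ (- (rho *+ N1)) * jap p ^- M)).
      rewrite [leRHS]big_nat_cond [leRHS](bigID (fun l => on l k)) /=.
      rewrite -[leLHS]addr0 lerD //; last by rewrite sumr_ge0 // => *; rewrite !mulr_ge0.
      rewrite [leRHS](eq_bigl (fun l => (N1 <= l < len1 k)%N && on l k)); last first.
        by move=> l; rewrite andbT.
      by apply: ler_sum => l /andP[/andP[Nl _] ol]; exact: term.
    rewrite sumr_const_nat -[leLHS]mulr_natl ler_wpM2r ?mulr_ge0 // ler_nat leq_subr //.
  have jk := le_trans jl (hJ k).
  apply: ler_pM; rewrite ?mulr_ge0 //.
  by rewrite !ler_wpM2r.
(* the terms between N and N1 already have order at most - N rho *)
rewrite (_ : S - _ = (S - \sum_(l < N1) u l) + \sum_(N <= l < N1) u l).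
  apply: decayD.
    rewrite SE; apply: decayD => //; apply: decayN.
    by apply: (@has_order_sum (- (rho *+ N))) => l _; exact: off_res.
  rewrite big_nat_cond; apply: has_order_sum => l /andP[/andP[Nl _] _].
  by apply: has_order_le (ou l); rewrite lerN2 ler_wpMn2l.
have NN : (N <= N1)%N by apply: leq_trans (leq_maxr _ _); exact: leq_addr.
rewrite -!(big_mkord xpredT u) (@big_cat_nat _ _ _ N 0 N1) //=.
by rewrite opprD addrA subrK.
Qed.

(** ** Neumann series and the parametrix *)

Lemma coef_ext a b : (forall k p, a k p = b k p) -> a = b.
Proof. by move=> h; apply/funext => k; apply/funext => p. Qed.

Lemma coefDE a b k p : (a + b) k p = a k p + b k p. Proof. by []. Qed.
Lemma coefNE a k p : (- a) k p = - a k p. Proof. by []. Qed.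

Lemma compNr m m' a b : has_order m a -> has_order m' b -> coef_comp a (- b) = - coef_comp a b.
Proof.
move=> oa ob; have o0 := has_order0 m'.
have := compBr oa o0 ob; have := compBr oa ob ob; rewrite !subrr => h0.
by rewrite h0 !sub0r.
Qed.

Lemma compDr m m' a b b' : has_order m a -> has_order m' b -> has_order m' b' ->
  coef_comp a (b + b') = coef_comp a b + coef_comp a b'.
Proof.
move=> oa ob ob'; have := compBr oa ob (has_orderN ob').
by rewrite opprK (compNr oa ob') opprK.
Qed.

Lemma compNl m m' a b : has_order m a -> has_order m' b -> coef_comp (- a) b = - coef_comp a b.
Proof.
move=> oa ob; have o0 := has_order0 m.
have := compBl o0 oa ob; have := compBl oa oa ob; rewrite !subrr => h0.
by rewrite h0 !sub0r.
Qed.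

Lemma compDl m m' a a' b : has_order m a -> has_order m a' -> has_order m' b ->
  coef_comp (a + a') b = coef_comp a b + coef_comp a' b.
Proof.
move=> oa oa' ob; have := compBl oa (has_orderN oa') ob.
by rewrite opprK (compNl oa' ob) opprK.
Qed.

Lemma mclass_onec s : mclass s 0 onec.
Proof.
have d0 j : diffk j onec = 0 by rewrite /diffk /shiftk; exact: subrr.
elim: s => [|j s IH] /=; last first.
  split=> //; have -> : mulk j (diffk j onec) = 0; last exact: mclass0.
  by rewrite d0; apply/funext => k; apply/funext => p; exact: mulr0.
case=> [|N]; split; try exact: has_order_onec; first by [].
by move=> j; rewrite d0; exact: (@mclass0 [::]).
Qed.

Definition comp_pow a l : coef := iter l (coef_comp a) onec.

Lemma mclass_comp_pow s a l : mclass s (- rho) a -> mclass s (- (rho *+ l)) (comp_pow a l).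
Proof.
move=> sa; elim: l => [|l IH]; first by rewrite mulr0n oppr0; exact: mclass_onec.
by rewrite mulrS opprD; exact: mclass_comp.
Qed.

Lemma comp_powSr a l : has_order (- rho) a -> coef_comp (comp_pow a l) a = comp_pow a l.+1.
Proof.
move=> oa; have op l' : has_order (- (rho *+ l')) (comp_pow a l').
  elim: l' => [|l' IH]; first by rewrite mulr0n oppr0; exact: has_order_onec.
  by rewrite mulrS opprD; exact: has_order_comp.
elim: l => [|l IH]; first by rewrite [RHS]comp1r comp1l.
by rewrite [LHS](compA oa (op l) oa) IH.
Qed.

Lemma has_order_comp_pow a l : has_order (- rho) a -> has_order 0 (comp_pow a l).
Proof.
move=> oa; elim: l => [|l IH]; first exact: has_order_onec.
by apply: has_order_le (has_order_comp oa IH); rewrite addr0 oppr_le0.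
Qed.

Lemma geometric_sumr a N : has_order (- rho) a ->
  coef_comp (onec - a) (\sum_(l < N) comp_pow a l) = onec - comp_pow a N.
Proof.
move=> oa; have o1 := has_order_onec.
have oa0 : has_order 0 a by apply: has_order_le oa; rewrite oppr_le0.
have op l := has_order_comp_pow l oa.
have od := has_orderB o1 oa0.
elim: N => [|N IH].
  rewrite big_ord0; have := compBr od o1 o1; rewrite !subrr => ->.
  by [].
rewrite big_ord_recr /= (compDr od _ (op N)); last exact: has_order_sum.
by rewrite IH (compBl o1 oa0 (op N)) comp1l addrA subrK.
Qed.

Lemma geometric_suml a N : has_order (- rho) a ->
  coef_comp (\sum_(l < N) comp_pow a l) (onec - a) = onec - comp_pow a N.
Proof.
move=> oa; have o1 := has_order_onec.
have oa0 : has_order 0 a by apply: has_order_le oa; rewrite oppr_le0.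
have op l := has_order_comp_pow l oa.
have od := has_orderB o1 oa0.
elim: N => [|N IH].
  rewrite big_ord0; have := compBl o1 o1 od; rewrite !subrr => ->.
  by [].
rewrite big_ord_recr /= (compDl _ (op N) od); last exact: has_order_sum.
by rewrite IH (compBr (op N) o1 oa0) comp1r (comp_powSr _ oa) addrA subrK.
Qed.

Lemma rho_archi Q : 0 < rho -> exists N : nat, - (rho *+ N) <= Q.
Proof.
move=> rho0; exists (Num.bound (`|Q| / rho)).
have : `|Q| / rho < (Num.bound (`|Q| / rho))%:R.
  by apply: archi_boundP; rewrite divr_ge0.
rewrite ltr_pdivrMr // mulr_natl => /ltW h.
by rewrite lerNl (le_trans _ h) // -normrN ler_norm.
Qed.

(** The asymptotic sum of the powers of [a] differs from the partial sums by
    arrays of very low order, and these invert [onec - a] up to a high power of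
    [a]. *)
Lemma neumann_series s a : 0 < rho -> mclass s (- rho) a ->
  exists S : coef, [/\ mclass s 0 S, residual (coef_comp (onec - a) S - onec) &
    residual (coef_comp S (onec - a) - onec)].
Proof.
move=> rho0 sa; have oa := mclass_order sa; have o1 := has_order_onec.
have oa0 : has_order 0 a by apply: has_order_le oa; rewrite oppr_le0.
have od := has_orderB o1 oa0.
have spow l := mclass_comp_pow l sa.
have [S hS] := asymptotic_sum rho0 (fun l => mclass_order (spow l)).
pose T N := \sum_(l < N) comp_pow a l.
have sT N : mclass s 0 (T N).
  rewrite /T; elim/big_rec: _ => [|l x _ sx]; first exact: mclass0.
  by apply: mclassD => //; apply: mclass_le (spow l); rewrite oppr_le0 mulrn_wge0.
have sS : mclass s 0 S.
  apply: mclass_approx => Q; have [N NQ] := rho_archi Q rho0.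
  by exists (T N) => //; exact: has_order_le NQ (hS N).
have oS := mclass_order sS.
exists S; split=> // Q; have [N NQ] := rho_archi Q rho0;
  apply: has_order_le NQ _; have oT := mclass_order (sT N).
- have -> : coef_comp (onec - a) S - onec = coef_comp (onec - a) (S - T N) - comp_pow a N.
    rewrite (compBr od oS oT) /T (geometric_sumr N oa).
    by apply: coef_ext => k p; rewrite !(coefDE, coefNE); ring.
  apply: has_orderB; last exact: mclass_order (spow N).
  by have := has_order_comp od (hS N); rewrite add0r.
have -> : coef_comp S (onec - a) - onec = coef_comp (S - T N) (onec - a) - comp_pow a N.
  rewrite (compBl oS oT od) /T (geometric_suml N oa).
  by apply: coef_ext => k p; rewrite !(coefDE, coefNE); ring.
apply: has_orderB; last exact: mclass_order (spow N).
by have := has_order_comp (hS N) od; rewrite addr0.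
Qed.

(** [b] inverts the array [a'] for the pointwise product; the operator
    products of [a'] and [b], in both orders, then differ from the identity by
    arrays of order [- rho], which the Neumann series inverts on either side.
    The left and right parametrices so obtained agree up to residual terms. *)
Theorem coefficient_parametrix s m a a' b : 0 < rho -> mclass s m a -> residual (a' - a) ->
  has_order (- m) b -> coef_conv a' b = onec ->
  exists t : coef, [/\ mclass s (- m) t, residual (coef_comp t a - onec) &
    residual (coef_comp a t - onec)].
Proof.
move=> rho0 sa raa ob ab.
have sa' : mclass s m a'.
  by rewrite -(subrK a a'); apply: mclassD => //; exact: residual_mclass.
have oa := mclass_order sa; have oa' := mclass_order sa'.
have sb := mclass_reciprocal ob sa' ab.
have ba : coef_conv b a' = onec by rewrite (conv_comm ob oa').
have o1 := has_order_onec.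
have s1 : mclass s (- rho) (- comp_err a' b).
  by apply: mclassN; have := mclass_comp_err sa' sb; rewrite subrr sub0r.
have s2 : mclass s (- rho) (- comp_err b a').
  by apply: mclassN; have := mclass_comp_err sb sa'; rewrite addNr sub0r.
have E1 : onec - (- comp_err a' b) = coef_comp a' b by rewrite opprK /comp_err ab addrC subrK.
have E2 : onec - (- comp_err b a') = coef_comp b a' by rewrite opprK /comp_err ba addrC subrK.
have [S1 [sS1 r1 _]] := neumann_series rho0 s1.
have [S2 [sS2 _ r2]] := neumann_series rho0 s2.
rewrite E1 in r1; rewrite E2 in r2.
have oS1 := mclass_order sS1; have oS2 := mclass_order sS2.
pose t := coef_comp b S1; pose t' := coef_comp S2 b.
have st : mclass s (- m) t by have := mclass_comp sb sS1; rewrite addr0.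
have ot := mclass_order st.
have ot' : has_order (- m) t' by have := has_order_comp oS2 ob; rewrite add0r.
have {}r1 : residual (coef_comp a' t - onec) by rewrite /t -(compA oa' ob oS1).
have {}r2 : residual (coef_comp t' a' - onec) by rewrite /t' (compA oS2 ob oa').
(* t - t' = t' (a' t - 1) - (t' a' - 1) t, by associativity *)
have rt : residual (t - t').
  have -> : t - t' = coef_comp t' (coef_comp a' t - onec) - coef_comp (coef_comp t' a' - onec) t.
    have oat := has_order_comp oa' ot; rewrite subrr in oat.
    have ota := has_order_comp ot' oa'; rewrite addNr in ota.
    rewrite (compBr ot' oat o1) (compBl ota o1 ot) comp1r comp1l (compA ot' oa' ot).
    by apply: coef_ext => k p; rewrite !(coefDE, coefNE); ring.
  apply: residualD; first exact: residual_compr ot' r1.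
  exact/residualN/(residual_compl r2 ot).
exists t; split => //.
- have -> : coef_comp t a - onec = coef_comp (t - t') a' + (coef_comp t' a' - onec) - coef_comp t (a' - a).
    rewrite (compBl ot ot' oa') (compBr ot oa' oa).
    by apply: coef_ext => k p; rewrite !(coefDE, coefNE); ring.
  apply: residualD; first apply: residualD => //.
    exact: residual_compl rt oa'.
  exact/residualN/(residual_compr ot raa).
have -> : coef_comp a t - onec = (coef_comp a' t - onec) - coef_comp (a' - a) t.
  rewrite (compBl oa' oa ot); apply: coef_ext => k p; rewrite !(coefDE, coefNE); ring.
apply: residualD => //; exact/residualN/(residual_compl raa ot).
Qed.
End CoefficientClasses.

(** * Integration over the torus *)

Section UnitInterval.
Variable R : realType.
Implicit Types (G H : R -> R).

Local Notation J G := (\int[@lebesgue_measure R]_(t in `[0%R, 1%R]) (G t))%R.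

Lemma unit_integrable G : continuous G ->
  (@lebesgue_measure R).-integrable `[0%R, 1%R] (EFin \o G).
Proof.
move=> cG; apply: (@continuous_compact_integrable R); first exact: segment_compact.
exact: continuous_subspaceT.
Qed.

Lemma unit_integralD G H : continuous G -> continuous H ->
  J (fun t => G t + H t) = J G + J H.
Proof. by move=> cG cH; apply: RintegralD => //; exact: unit_integrable. Qed.

Lemma unit_integralZ c G : continuous G -> J (fun t => c * G t) = c * J G.
Proof. by move=> cG; apply: RintegralZl => //; exact: unit_integrable. Qed.

Lemma unit_integral_cst (c : R) : J (fun=> c) = c.
Proof. 
rewrite Rintegral_cst //= lebesgue_measure_itv /= lte_fin ltr01 /= oppr0 addr0 mulr1 //.
Qed.

Lemma unit_integral_le G H : continuous G -> continuous H ->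
  (forall t, t \in `[0, 1] -> G t <= H t) -> J G <= J H.
Proof. by move=> cG cH GH; apply: le_Rintegral => //; exact: unit_integrable. Qed.

Lemma unit_integral_norm G B : continuous G -> (forall t, `|G t| <= B) -> `|J G| <= B.
Proof.
move=> cG GB; rewrite ler_norml -{1}(unit_integral_cst (- B)) -{2}(unit_integral_cst B).
have cB (b : R) : continuous (fun _ : R => b) by move=> ?; exact: cvg_cst.
by apply/andP; split; apply: unit_integral_le => // t _; have := GB t; rewrite ler_norml => /andP[].
Qed.

Lemma unit_integral_bounded_cvg (G_ : nat -> R -> R) G (B : R) : (forall k, continuous (G_ k)) ->
  continuous G -> (forall k t, `|G_ k t| <= B) ->
  (forall t, G_ k t @[k --> \oo] --> G t) -> J (G_ k) @[k --> \oo] --> J G.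
Proof.
move=> cG_ cG GB GG.
have mG H (cH : continuous H) := measurable_int _ (unit_integrable cH).
have GGe t : (EFin \o G_ k) t @[k --> \oo] --> (EFin \o G) t.
  by apply: cvg_EFin; [exact: nearW|exact: GG].
have [||_ _ cvgJ] := @dominated_convergence _ _ R (@lebesgue_measure R) `[0%R, 1%R]%classic
  (measurable_itv _) (fun k => EFin \o G_ k) (EFin \o G) (fun=> B%:E)
  (fun k => mG _ (cG_ k)) (mG _ cG) _ (unit_integrable (fun x => cvg_cst B)).
- by apply: aeW => t _; exact: GGe.
- by apply: aeW => t k _; rewrite lee_fin; exact: GB.
apply: fine_cvg; rewrite fineK //.
by apply: integrable_fin_num => //; exact: unit_integrable.
Qed.

Lemma unit_integral_derive (F G : R -> R) : continuous G ->
  (forall t : R, is_derive t (1 : R) F (G t)) ->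
  J G = F 1 - F 0.
Proof.
move=> cG dF; rewrite /Rintegral (@continuous_FTC2 _ G F) //=.
- exact: continuous_subspaceT.
- have cF t : {for t, continuous F}.
    by apply: differentiable_continuous; apply/derivable1_diffP; exact: ex_derive.
  split=> [t _||]; first exact: ex_derive.
    by apply: cvg_at_right_filter; exact: cF.
  by apply: cvg_at_left_filter; exact: cF.
- by move=> t _; rewrite derive1E; exact: derive_val.
Qed.

End UnitInterval.

Section TorusIntegral.
Variable R : realType.

Lemma row_cvg (T : Type) (F : set_system T) {FF : Filter F} n (f : T -> 'rV[R]_n) (v : 'rV[R]_n) :
  (forall j, (fun t => f t ord0 j) @ F --> v ord0 j) -> f @ F --> v.
Proof.
move=> fv; apply/cvg_ballP => e e0.
have h : \forall t \near F, forall j, ball (v ord0 j) e (f t ord0 j).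
  by apply: filter_forall => j; move: (fv j) => /cvg_ballP; exact.
apply: filterS h => t h; split => // i j; rewrite (ord1 i); exact: h.
Qed.

(** The point of the torus with first coordinate [t] and remaining
    coordinates [y], as in the iterated integral. *)
Definition tcons p (t : R) (y : 'rV[R]_p) : 'rV[R]_p.+1 := row_mx (t%:M : 'rV[R]_1) y.

Lemma tcons0 p t (y : 'rV[R]_p) : tcons t y ord0 ord0 = t.
Proof.
rewrite /tcons; have -> : (ord0 : 'I_(1 + p)) = lshift p ord0 by exact: val_inj.
by apply: (etrans (row_mxEl _ _ _ _)); rewrite mxE.
Qed.

Lemma tconsS p t (y : 'rV[R]_p) j : tcons t y ord0 (lift ord0 j) = y ord0 j.
Proof. by rewrite /tcons -rshift1; exact: row_mxEr. Qed.

Lemma tcons_continuousl p (y : 'rV[R]_p) : continuous (fun t => tcons t y).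
Proof.
move=> t; apply: row_cvg => j; have [i ->|->] := unliftP ord0 j.
  under eq_fun do rewrite tconsS; rewrite tconsS; exact: cvg_cst.
by under eq_fun do rewrite tcons0; rewrite tcons0; exact: cvg_id.
Qed.

Lemma tcons_continuousr p (t : R) : continuous (@tcons p t).
Proof.
move=> y; apply: (@row_cvg _ _ (nbhs_filter y)) => j; have [i ->|->] := unliftP ord0 j.
  by under eq_fun do rewrite tconsS; rewrite tconsS; exact: (@coord_continuous R 1 p ord0 i y).
by under eq_fun do rewrite tcons0; rewrite tcons0; exact: cvg_cst.
Qed.

Lemma tcons_surj p (x : 'rV[R]_p.+1) : exists t y, x = tcons t y.
Proof.
exists (x ord0 ord0), (\row_j x ord0 (lift ord0 j)); apply/rowP => j.
by have [i ->|->] := unliftP ord0 j; rewrite ?tconsS ?tcons0 ?mxE.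
Qed.

Lemma tcons_shift0 p (t h : R) (y : 'rV[R]_p) :
  h *: (delta_mx ord0 ord0 : 'rV[R]_p.+1) + tcons t y = tcons (h + t) y.
Proof.
apply/rowP => j; have [i ->|->] := unliftP ord0 j; rewrite 2!mxE ?tconsS ?tcons0 mxE.
  by rewrite eqxx mulr0 add0r.
by rewrite !eqxx mulr1.
Qed.

Lemma tcons_shiftS p (t h : R) (y : 'rV[R]_p) i :
  h *: (delta_mx ord0 (lift ord0 i) : 'rV[R]_p.+1) + tcons t y =
  tcons t (h *: (delta_mx ord0 i : 'rV[R]_p) + y).
Proof.
apply/rowP => j; have [l ->|->] := unliftP ord0 j; rewrite 2!mxE ?tconsS ?tcons0 !mxE.
  by rewrite (inj_eq lift_inj).
by rewrite mulr0 add0r.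
Qed.

Lemma cont_cst n (c : R) : continuous (fun _ : 'rV[R]_n => c).
Proof. by move=> x; apply: (@cvg_cst _ _ _ (nbhs x) (nbhs_filter x)). Qed.

Lemma contD n (g h : 'rV[R]_n -> R) : continuous g -> continuous h ->
  continuous (fun x => g x + h x).
Proof. by move=> cg ch x; apply: (@cvgD _ _ _ (nbhs x) (nbhs_filter x)); [exact: cg|exact: ch]. Qed.

Lemma contM n (g h : 'rV[R]_n -> R) : continuous g -> continuous h ->
  continuous (fun x => g x * h x).
Proof. by move=> cg ch x; apply: (@cvgM _ _ (nbhs x) (nbhs_filter x)); [exact: cg|exact: ch]. Qed.

Lemma contN n (g : 'rV[R]_n -> R) : continuous g -> continuous (fun x => - g x).
Proof. by move=> cg x; apply: (@cvgN _ _ _ (nbhs x) (nbhs_filter x)); exact: cg. Qed.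

(** Bounded continuous functions form an algebra on which the iterated
    integral behaves as the integral of a probability measure. *)
Definition bcont n (g : 'rV[R]_n -> R) :=
  continuous g /\ exists B : R, forall x, `|g x| <= B.

Lemma bcont_cst n (c : R) : bcont (fun _ : 'rV[R]_n => c).
Proof. by split; [exact: cont_cst|exists `|c|]. Qed.

Lemma bcontD n (g h : 'rV[R]_n -> R) : bcont g -> bcont h -> bcont (fun x => g x + h x).
Proof.
move=> [cg [B gB]] [ch [C hC]]; split; first exact: contD.
by exists (B + C) => x; rewrite (le_trans (ler_normD _ _)) // lerD.
Qed.

Lemma bcontM n (g h : 'rV[R]_n -> R) : bcont g -> bcont h -> bcont (fun x => g x * h x).
Proof.
move=> [cg [B gB]] [ch [C hC]]; split; first exact: contM.
by exists (B * C) => x; rewrite normrM ler_pM.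
Qed.

Lemma bcontN n (g : 'rV[R]_n -> R) : bcont g -> bcont (fun x => - g x).
Proof.
by move=> [cg [B gB]]; split; [exact: contN|exists B => x; rewrite normrN].
Qed.

Lemma bcont_slice p (g : 'rV[R]_p.+1 -> R) t : bcont g -> bcont (fun y => g (tcons t y)).
Proof.
move=> [cg [B gB]]; split; last by exists B.
by move=> y; apply: continuous_comp; [exact: tcons_continuousr|exact: cg].
Qed.

(** The two statements are proved together by induction on the dimension:
    bounded convergence for the outer integral needs the bound for the inner
    one, and both need the inner integral to be continuous. *)
Lemma rtorus_int_norm_cvg n :
  (forall (g : 'rV[R]_n -> R) B, continuous g -> (forall x, `|g x| <= B) ->
     `|rtorus_int g| <= B) /\
  (forall (g_ : nat -> 'rV[R]_n -> R) g B, (forall k, continuous (g_ k)) -> continuous g ->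
     (forall k x, `|g_ k x| <= B) -> (forall x, g_ k x @[k --> \oo] --> g x) ->
     rtorus_int (g_ k) @[k --> \oo] --> rtorus_int g).
Proof.
elim: n => [|p [IHn IHc]]; first by split=> [g B _|g_ g B _ _ _] h /=.
have slice (g : 'rV[R]_p.+1 -> R) : continuous g -> forall t, continuous (fun y => g (tcons t y)).
  by move=> cg t y; apply: continuous_comp; [exact: tcons_continuousr|exact: cg].
have cont (g : 'rV[R]_p.+1 -> R) B : continuous g -> (forall x, `|g x| <= B) ->
    continuous (fun t => rtorus_int (fun y => g (tcons t y))).
  move=> cg gB t; apply/(@cvg_nbhsP _ R^o) => u ut.
  apply: (IHc _ _ B) => [k||k y|y] //; try exact: slice.
  have : continuous (fun s => g (tcons s y)).
    by move=> s; apply: continuous_comp; [exact: tcons_continuousl|exact: cg].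
  by move=> ct; exact: (cvg_comp _ _ ut (ct t)).
split=> [g B cg gB|g_ g B cg_ cg gB gg] /=.
  apply: unit_integral_norm; first exact: cont gB.
  by move=> t; apply: IHn => //; exact: slice.
have gB' x : `|g x| <= B.
  have := gg x; move=> /cvg_norm => h; have := cvg_lim (@Rhausdorff R) h => <-.
  by apply: limr_le; [apply/cvg_ex; eexists; exact: h|exact: nearW].
apply: (@unit_integral_bounded_cvg _ _ _ B).
- by move=> k; apply: cont (gB k).
- exact: cont gB'.
- by move=> k t; apply: IHn => // y; exact: slice.
by move=> t; apply: (IHc _ _ B) => //; [move=> k; exact: slice|exact: slice].
Qed.

Lemma rtorus_int_norm n (g : 'rV[R]_n -> R) B : continuous g -> (forall x, `|g x| <= B) ->
  `|rtorus_int g| <= B.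
Proof. by have [h _] := rtorus_int_norm_cvg n; exact: h. Qed.

Lemma rtorus_int_cvg n (g_ : nat -> 'rV[R]_n -> R) g B : (forall k, continuous (g_ k)) ->
  continuous g -> (forall k x, `|g_ k x| <= B) -> (forall x, g_ k x @[k --> \oo] --> g x) ->
  rtorus_int (g_ k) @[k --> \oo] --> rtorus_int g.
Proof. by have [_ h] := rtorus_int_norm_cvg n; exact: h. Qed.

Lemma rtorus_slice_continuous p (g : 'rV[R]_p.+1 -> R) : bcont g ->
  continuous (fun t => rtorus_int (fun y => g (tcons t y))).
Proof.
move=> [cg [B gB]] t; apply/(@cvg_nbhsP _ R^o) => u ut; apply: (@rtorus_int_cvg _ _ _ B).
- by move=> k y; apply: continuous_comp; [exact: tcons_continuousr|exact: cg].
- by move=> y; apply: continuous_comp; [exact: tcons_continuousr|exact: cg].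
- by move=> k y.
move=> y; have : continuous (fun s => g (tcons s y)).
  by move=> s; apply: continuous_comp; [exact: tcons_continuousl|exact: cg].
by move=> ct; exact: (cvg_comp _ _ ut (ct t)).
Qed.

Lemma rtorus_intD n (g h : 'rV[R]_n -> R) : bcont g -> bcont h ->
  rtorus_int (fun x => g x + h x) = rtorus_int g + rtorus_int h.
Proof.
elim: n g h => [//|p IH] g h bg bh /=.
rewrite -unit_integralD; last 2 first.
- exact: rtorus_slice_continuous.
- exact: rtorus_slice_continuous.
by congr Rintegral; apply/funext => t; apply: IH; exact: bcont_slice.
Qed.

Lemma rtorus_intZ n (g : 'rV[R]_n -> R) c : bcont g ->
  rtorus_int (fun x => c * g x) = c * rtorus_int g.
Proof.
elim: n g => [//|p IH] g bg /=; rewrite -unit_integralZ; last exact: rtorus_slice_continuous.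
by congr Rintegral; apply/funext => t; apply: IH; exact: bcont_slice.
Qed.

Lemma rtorus_int_cst n (c : R) : rtorus_int (fun _ : 'rV[R]_n => c) = c.
Proof.
elim: n => [//|p IH] /=; rewrite -[RHS]unit_integral_cst.
by congr Rintegral; apply/funext => t; exact: IH.
Qed.

(** ** The integral of a derivative vanishes *)

Lemma is_derive_transport m n (f : 'rV[R]_m -> R) (g : 'rV[R]_n -> R) x v y w d :
  (forall h : R, f (h *: v + x) = g (h *: w + y)) -> is_derive x v f d -> is_derive y w g d.
Proof.
move=> fg [df fd].
have E : (fun h : R => h^-1 *: ((f \o shift x) (h *: v) - f x)) =
         (fun h : R => h^-1 *: ((g \o shift y) (h *: w) - g y)).
  apply/funext => h /=; have := fg 0; rewrite !scale0r !add0r => <-.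
  by rewrite fg.
split; first by rewrite /derivable -E.
by rewrite /derive -E.
Qed.

Lemma is_derive_transport1 n (f : 'rV[R]_n -> R) (g : R -> R) x v (t d : R) :
  (forall h : R, f (h *: v + x) = g (h + t)) -> is_derive x v f d -> is_derive t (1 : R) g d.
Proof.
move=> fg [df fd].
have E : (fun h : R => h^-1 *: ((f \o shift x) (h *: v) - f x)) =
         (fun h : R => h^-1 *: ((g \o shift t) (h *: (1 : R)) - g t)).
  apply/funext => h /=; have := fg 0; rewrite scale0r !add0r => <-.
  by rewrite fg -[h *: 1]/(h * 1) mulr1.
split; first by rewrite /derivable -E.
by rewrite /derive -E.
Qed.

Lemma lipschitz_of_derive (F dF : R -> R) B : (forall t : R, is_derive t (1 : R) F (dF t)) ->
  (forall t, `|dF t| <= B) -> forall s t, `|F t - F s| <= B * `|t - s|.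
Proof.
move=> dFF dB; have cF : continuous F.
  move=> t; apply: differentiable_continuous; apply/derivable1_diffP; exact: ex_derive.
have le_case s t : s < t -> `|F t - F s| <= B * `|t - s|.
  move=> st; have [c _ ->] := MVT st (fun x _ => dFF x) (continuous_subspaceT cF).
  by rewrite normrM ler_wpM2r.
move=> s t; have [st|ts|->] := ltgtP s t; first exact: le_case.
  by rewrite distrC (distrC t); exact: le_case.
by rewrite !subrr normr0 mulr0.
Qed.

(** Along the first coordinate the derivative passes under the inner
    integral: its difference quotients are bounded by the mean value theorem,
    so that bounded convergence applies. *)
Lemma rtorus_slice_derive p (g dg : 'rV[R]_p.+1 -> R) : bcont g -> bcont dg ->
  (forall x, is_derive x (delta_mx ord0 ord0) g (dg x)) ->
  forall t : R, is_derive t (1 : R) (fun t => rtorus_int (fun y => g (tcons t y)))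
    (rtorus_int (fun y => dg (tcons t y))).
Proof.
move=> bg bdg dgg t; have [cg [_ _]] := bg; have [cdg [B dgB]] := bdg.
pose q (h : R) y := if h == 0 then dg (tcons t y) else h^-1 * (g (tcons (h + t) y) - g (tcons t y)).
have dslice s y : is_derive s (1 : R) (fun s => g (tcons s y)) (dg (tcons s y)).
  by apply: is_derive_transport1 (dgg (tcons s y)) => h; rewrite tcons_shift0.
have sl (f : 'rV[R]_p.+1 -> R) s : continuous f -> continuous (fun y => f (tcons s y)).
  by move=> cf y; apply: continuous_comp; [exact: tcons_continuousr|exact: cf].
have cq h : continuous (q h).
  rewrite /q; case: eqP => _; first exact: sl.
  by apply: contM; [exact: cont_cst|apply: contD; [exact: sl|apply: contN; exact: sl]].
have qB h y : `|q h y| <= B.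
  rewrite /q; case: eqP => [_|/eqP h0]; first exact: dgB.
  rewrite normrM normfV ler_pdivrMl ?normr_gt0 // mulrC.
  have := @lipschitz_of_derive _ _ B (fun s => dslice s y) (fun s => dgB _) t (h + t).
  by rewrite addrK.
have qcvg y : q h y @[h --> (0 : R)] --> q 0 y.
  have := continuous_withinNx (fun h => q h y) 0; case=> _; apply.
  rewrite {2}/q eqxx; have [dd dE] := dslice t y.
  rewrite -dE.
  have dlim : (fun h : R => h^-1 *: (((fun s => g (tcons s y)) \o shift t) (h *: (1 : R))
    - g (tcons t y))) @ 0^' --> 'D_1 (fun s => g (tcons s y)) t := dd.
  apply: cvg_trans dlim; apply: near_eq_cvg; near=> h => /=.
  have h0 : h != 0 by near: h; exact: nbhs_dnbhs_neq.
  by rewrite /q (negbTE h0) -[_ *: 1]/(h * 1) mulr1.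
have Icvg : rtorus_int (q h) @[h --> (0 : R)] --> rtorus_int (q 0).
  apply/(@cvg_nbhsP _ R^o) => u u0; apply: (@rtorus_int_cvg _ _ _ B).
  - by move=> k; exact: cq.
  - exact: cq.
  - by move=> k y; exact: qB.
  by move=> y; exact: (cvg_comp _ _ u0 (qcvg y)).
have q0E : q 0 = (fun y => dg (tcons t y)) by rewrite /q eqxx.
have IE : (fun h : R => h^-1 *: (((fun t => rtorus_int (fun y => g (tcons t y))) \o shift t) (h *: (1 : R))
     - rtorus_int (fun y => g (tcons t y)))) @ 0^' --> rtorus_int (fun y => dg (tcons t y)).
  have Icvg' : (fun h => rtorus_int (q h)) @ (0 : R)^' --> rtorus_int (q 0).
    exact: cvg_within_filter.
  rewrite -q0E; apply: cvg_trans Icvg'; apply: near_eq_cvg; near=> h => /=.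
  have h0 : h != 0 by near: h; exact: nbhs_dnbhs_neq.
  rewrite -[h *: 1]/(h * 1) mulr1 -[h^-1 *: _]/(h^-1 * _).
  have -> : q h = (fun y => h^-1 * (g (tcons (h + t) y) + (-1) * g (tcons t y))).
    by apply/funext => y; rewrite /q (negbTE h0) mulN1r.
  have b1 := bcont_slice (h + t) bg; have b2 := bcontM (bcont_cst _ (-1)) (bcont_slice t bg).
  rewrite rtorus_intZ ?rtorus_intD ?rtorus_intZ ?mulN1r //; first exact: bcont_slice.
  exact: bcontD.
split; first by apply/cvg_ex; eexists; exact: IE.
exact: cvg_lim IE.
Unshelve. all: by end_near. Qed.

(** In the first direction the iterated integral of the derivative is a
    difference of boundary values, equal by periodicity; the other directions
    are treated inside the inner integral. *)
Lemma rtorus_int_derive n (j : 'I_n) (g dg : 'rV[R]_n -> R) : bcont g -> bcont dg ->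
  (forall x, is_derive x (delta_mx ord0 j) g (dg x)) ->
  (forall x, g (delta_mx ord0 j + x) = g x) -> rtorus_int dg = 0.
Proof.
elim: n j g dg => [[]//|p IH] j g dg bg bdg dgg per /=.
case: (unliftP ord0 j) dgg per => [i ->|->] dgg per; last first.
  rewrite (unit_integral_derive (rtorus_slice_continuous bdg) (rtorus_slice_derive bg bdg dgg)).
  suff -> : (fun y => g (tcons 1 y)) = (fun y => g (tcons 0 y)) by rewrite subrr.
  by apply/funext => y; rewrite -(per (tcons 0 y)) -{1}(scale1r (delta_mx _ _)) tcons_shift0 addr0.
have -> : (fun t => rtorus_int (fun y => dg (row_mx (t%:M : 'rV[R]_1) y))) = (fun=> 0).
  apply/funext => t; apply: (IH i (fun y => g (tcons t y))); try exact: bcont_slice.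
    move=> y; apply: is_derive_transport (dgg (tcons t y)) => h.
    by rewrite tcons_shiftS.
  move=> y; rewrite -(per (tcons t y)) -[in RHS](scale1r (delta_mx _ _)) tcons_shiftS.
  by rewrite scale1r.
exact: unit_integral_cst.
Qed.
End TorusIntegral.

(** * Uniqueness of Fourier coefficients *)

Section Uniqueness.
Variable R : realType.

Local Notation J G := (\int[@lebesgue_measure R]_(t in `[0%R, 1%R]) (G t))%R.

Lemma cos_periodicz (x : R) (z : int) : cos (x + 2 * pi * z%:~R) = cos x.
Proof.
have per k (y : R) : cos (y + 2 * pi * k%:R) = cos y.
  elim: k => [|k IH]; first by rewrite mulr0 addr0.
  have -> : y + 2 * pi * k.+1%:R = y + 2 * pi * k%:R + pi + pi by rewrite -natr1; ring.
  by rewrite !cosDpi opprK.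
case: z => k; first by rewrite -pmulrn per.
by rewrite NegzE mulrNz -pmulrn mulrN -[LHS](per k.+1) subrK.
Qed.

Lemma sin_periodicz (x : R) (z : int) : sin (x + 2 * pi * z%:~R) = sin x.
Proof.
have -> y : sin y = - cos (y + pi / 2) by rewrite cosDpihalf opprK.
by rewrite addrAC cos_periodicz cosDpihalf opprK.
Qed.

Lemma ler_cos (x y : R) : 0 <= x -> x <= y -> y <= pi -> cos y <= cos x.
Proof.
move=> x0 xy yp; have [->//|neq] := eqVneq x y.
apply/ltW; rewrite ltr_cos ?in_itv /= ?lt_neqAle ?neq ?xy //; last first.
  by rewrite yp (le_trans x0).
by rewrite x0 (le_trans xy).
Qed.

(** Its powers concentrate at [s], so a continuous function orthogonal to all
    of them vanishes at [s]; they are trigonometric polynomials. *)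
Definition peak (s t : R) : R := (1 + cos (2 * pi * (t - s))) / 2.

Lemma peak_ge0 s t : 0 <= peak s t.
Proof. rewrite /peak divr_ge0 // addrC -lerBlDr sub0r; exact: cos_geN1. Qed.

Lemma peak_continuous s : continuous (peak s).
Proof.
move=> t; apply: cvgM; last exact: cvg_cst.
apply: cvgD; first exact: cvg_cst.
apply: continuous_comp; last exact: continuous_cos.
by apply: cvgM; [exact: cvg_cst|apply: cvgB; [exact: cvg_id|exact: cvg_cst]].
Qed.

(** If [A s > 0], then [A >= c > 0] near [s], where the powers of [peak s]
    are at least [k1 ^+ N] on a smaller interval; away from [s] they are at most
    [k2 ^+ N] with [k2 < k1]. For large [N] the integral is positive. *)
Lemma powers_detect (A : R -> R) (s : R) : continuous A -> 0 < s < 1 ->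
  (exists B : R, forall t, `|A t| <= B) ->
  (forall N, J (fun t => A t * peak s t ^+ N) = 0) -> A s <= 0.
Proof.
move=> cA /andP[s0 s1] [B AB] A0; rewrite leNgt; apply/negP => As.
have pi0 := @pi_gt0 R.
pose c := A s / 2; have c0 : 0 < c by rewrite divr_gt0.
have [d [d0 ds d1s dA]] : exists d : R, [/\ 0 < d, d <= s, d <= 1 - s &
    forall t, `|t - s| <= d -> c <= A t].
  have : \forall t \near s, c < A t.
    have := cA s; move/cvgr_gt; apply; rewrite /c ltr_pdivrMr // mulr_natr mulr2n ltrDl //.
  case/nbhs_ballP => e /= e0 he.
  exists (Num.min (e / 2) (Num.min s (1 - s))); split.
  - by rewrite !lt_min divr_gt0 // s0 subr_gt0.
  - by rewrite !ge_min lexx !orbT.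
  - by rewrite !ge_min lexx !orbT.
  move=> t; rewrite !le_min => /andP[ts _]; apply/ltW/he; rewrite /ball /= distrC.
  by apply: le_lt_trans ts _; rewrite ltr_pdivrMr // mulr_natr mulr2n ltrDl.
pose k1 := (1 + cos (pi * d)) / 2; pose k2 := (1 + cos (2 * pi * d)) / 2.
have cosn t : cos (2 * pi * (t - s)) = cos (2 * pi * `|t - s|).
  have [h|h] := leP 0 (t - s); first by rewrite ger0_norm.
  by rewrite ltr0_norm // mulrN cosN.
have k20 : 0 <= k2 by rewrite /k2 divr_ge0 // addrC -lerBlDr sub0r cos_geN1.
have k21 : k2 < k1.
  rewrite /k1 /k2 ltr_pM2r ?invr_gt0 // ltrD2l ltr_cos; first by nra.
    by rewrite in_itv /=; apply/andP; split; nra.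
  by rewrite in_itv /=; apply/andP; split; nra.
have k1_gt0 : 0 < k1 := le_lt_trans k20 k21.
have near1 t : `|t - s| <= d / 2 -> k1 <= peak s t.
  move=> h; rewrite /peak cosn ler_pM2r ?invr_gt0 // lerD2l.
  have n0 := normr_ge0 (t - s).
  by apply: ler_cos; nra.
(* peak s is a function of the distance to s modulo 1 *)
have far t : 0 <= t -> t <= 1 -> d <= `|t - s| -> peak s t <= k2.
  move=> t0 t1 h; rewrite /peak cosn ler_pM2r ?invr_gt0 // lerD2l.
  have n1 : `|t - s| <= 1 - d by rewrite ler_norml; lra.
  have [hp|hp] := leP (2 * `|t - s|) 1; first by apply: ler_cos; nra.
  have -> : cos (2 * pi * `|t - s|) = cos (2 * pi * (1 - `|t - s|)).
    rewrite -cosN -(cos_periodicz _ 1) mulr1z; congr cos; ring.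
  by apply: ler_cos; nra.
have B0 : 0 <= B := le_trans (normr_ge0 _) (AB 0).
have main N : c * d * k1 ^+ N <= B * k2 ^+ N.
  (* A times the power, shifted so as to be nonnegative on [0, 1] *)
  pose f t := A t * peak s t ^+ N + B * k2 ^+ N.
  have cAN : continuous (fun t => A t * peak s t ^+ N).
    have cb : continuous (fun t => peak s t ^+ N).
      move=> t; apply: (@continuous_comp _ _ _ (peak s) (fun x => x ^+ N)); first exact: peak_continuous.
      exact: exprn_continuous.
    by move=> t; apply: cvgM; [exact: cA|exact: cb].
  have cf : continuous f by move=> t; apply: cvgD; [exact: cAN|exact: cvg_cst].
  have f0 t : t \in `[0, 1] -> 0 <= f t.
    rewrite in_itv /= => /andP[t0 t1]; rewrite /f; have [h|h] := leP `|t - s| d.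
      rewrite addr_ge0 ?mulr_ge0 ?exprn_ge0 ?peak_ge0 //.
      exact: le_trans (ltW c0) (dA t h).
    have hb := far t t0 t1 (ltW h).
    have hk : peak s t ^+ N <= k2 ^+ N by rewrite lerXn2r ?nnegrE ?peak_ge0.
    have := AB t; rewrite ler_norml => /andP[h1 _].
    have p0 : 0 <= peak s t ^+ N by rewrite exprn_ge0 ?peak_ge0.
    have p1 : 0 <= (B + A t) * peak s t ^+ N by rewrite mulr_ge0 //; lra.
    have p2 : 0 <= B * (k2 ^+ N - peak s t ^+ N) by rewrite mulr_ge0 // subr_ge0.
    lra.
  have Jf : J f = B * k2 ^+ N.
    rewrite unit_integralD //; last by move=> ?; exact: cvg_cst.
    by rewrite A0 add0r unit_integral_cst.
  have fin := unit_integrable cf; have mf := measurable_int _ fin.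
  rewrite -Jf -lee_fin /Rintegral fineK; last by apply: integrable_fin_num.
  pose I := `[s - d / 2, s + d / 2]%classic : set R.
  have IS : (I `<=` `[0%R, 1%R])%classic.
    by move=> t; rewrite /I /= !in_itv /= => /andP[h1 h2]; apply/andP; split; lra.
  apply: (@le_trans _ _ (\int[@lebesgue_measure R]_(t in I) (f t)%:E)%E); last first.
    by apply: ge0_subset_integral => //; exact: measurable_itv.
  apply: (@le_trans _ _ (\int[@lebesgue_measure R]_(t in I) (c * k1 ^+ N)%:E)%E); last first.
    apply: ge0_le_integral => //; first exact: measurable_itv.
    - by move=> t _; rewrite lee_fin mulr_ge0 ?exprn_ge0 // ltW.
    - by apply: measurable_funS mf.
    move=> t; rewrite /I /= in_itv /= => /andP[h1 h2]; rewrite lee_fin /f.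
    have hd : `|t - s| <= d / 2 by rewrite ler_norml; lra.
    have hk : k1 ^+ N <= peak s t ^+ N by rewrite lerXn2r ?nnegrE ?peak_ge0 ?(ltW k1_gt0) ?near1.
    have hc : c <= A t by apply: dA; lra.
    by rewrite -[leLHS]addr0 lerD ?mulr_ge0 ?exprn_ge0 // ler_pM ?exprn_ge0 ?(ltW c0) ?(ltW k1_gt0).
  rewrite integral_cst //=; last exact: measurable_itv.
  rewrite lebesgue_measure_itv /= lte_fin.
  rewrite ifT; last by lra.
  rewrite -EFinB -EFinM lee_fin le_eqVlt; apply/orP; left; apply/eqP; by field.
have cd0 : 0 < c * d by rewrite mulr_gt0.
have q1 : `|k2 / k1| < 1.
  by rewrite ger0_norm ?divr_ge0 ?(ltW k1_gt0) // ltr_pdivrMr // mul1r.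
have cvg0 : (B * (k2 / k1) ^+ N) @[N --> \oo] --> B * 0.
  by apply: cvgM; [exact: cvg_cst|exact: cvg_expr].
rewrite mulr0 in cvg0.
have mainq N : c * d <= B * (k2 / k1) ^+ N.
  by rewrite expr_div_n mulrA ler_pdivlMr ?exprn_gt0.
have : \forall N \near \oo, B * (k2 / k1) ^+ N < c * d by move/cvgr_lt: cvg0; apply.
case=> N0 _ /(_ N0 (leqnn N0)) /=; by rewrite ltNge mainq.
Qed.

End Uniqueness.
Section TrigMoments.
Variable R : realType.

Local Notation J G := (\int[@lebesgue_measure R]_(t in `[0%R, 1%R]) (G t))%R.
Local Notation ang q t := (2 * pi * (q%:~R * t) : R).

Lemma continuous_ang (q : int) : continuous (fun t : R => ang q t).
Proof.
move=> t; apply: cvgM; first exact: cvg_cst.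
by apply: cvgM; [exact: cvg_cst|exact: cvg_id].
Qed.

Lemma continuous_cos_ang (q : int) : continuous (fun t : R => cos (ang q t)).
Proof.
move=> t; apply: (@continuous_comp _ _ _ (fun t : R => ang q t) (@cos R)).
  exact: continuous_ang.
exact: continuous_cos.
Qed.

Lemma continuous_sin_ang (q : int) : continuous (fun t : R => sin (ang q t)).
Proof.
move=> t; apply: (@continuous_comp _ _ _ (fun t : R => ang q t) (@sin R)).
  exact: continuous_ang.
exact: continuous_sin.
Qed.

Lemma angD (q : int) (t : R) : ang (q + 1) t = ang q t + ang 1 t.
Proof. by rewrite intrD; ring. Qed.

Lemma angB (q : int) (t : R) : ang (q - 1) t = ang q t - ang 1 t.
Proof. by rewrite intrB; ring. Qed.

(** Multiplication by [peak s] shifts frequencies by at most one, so by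
    induction on [N] the products with [peak s ^+ N] still have vanishing
    moments. *)
Lemma peak_moments (A : R -> R) (s : R) : continuous A ->
  (forall q : int, J (fun t => A t * cos (ang q t)) = 0 /\ J (fun t => A t * sin (ang q t)) = 0) ->
  forall N, J (fun t => A t * peak s t ^+ N) = 0.
Proof.
move=> cA mA N.
suff: forall q : int, J (fun t => (A t * peak s t ^+ N) * cos (ang q t)) = 0 /\
                J (fun t => (A t * peak s t ^+ N) * sin (ang q t)) = 0.
  move=> /(_ 0)[+ _]; congr (_ = _); congr Rintegral.
  by apply/funext => t; rewrite mul0r mulr0 cos0 mulr1.
elim: N => [|N IH] q.
  have [h1 h2] := mA q; split; [rewrite -[RHS]h1|rewrite -[RHS]h2];
    by congr Rintegral; apply/funext => t; rewrite expr0 mulr1.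
pose D t := A t * peak s t ^+ N.
have cD : continuous D.
  have cb : continuous (fun t => peak s t ^+ N).
    move=> t; apply: (@continuous_comp _ _ _ (peak s) (fun x => x ^+ N)); first exact: peak_continuous.
    exact: exprn_continuous.
  by move=> t; apply: cvgM; [exact: cA|exact: cb].
have cM (f : R -> R) : continuous f -> continuous (fun t => D t * f t).
  by move=> cf t; apply: cvgM; [exact: cD|exact: cf].
have cZ (f : R -> R) c : continuous f -> continuous (fun t => c * f t).
  by move=> cf t; apply: cvgM; [exact: cvg_cst|exact: cf].
have cP (f g : R -> R) : continuous f -> continuous g -> continuous (fun t => f t + g t).
  by move=> cf cg t; apply: cvgD; [exact: cf|exact: cg].
(* peak s as a trigonometric polynomial of degree one *)
have bE t : peak s t = 2^-1 + cos (2 * pi * s) / 2 * cos (ang 1 t) + sin (2 * pi * s) / 2 * sin (ang 1 t).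
  rewrite /peak (_ : 2 * pi * (t - s) = ang 1 t - 2 * pi * s); last by rewrite mulr1z; ring.
  by rewrite cosD cosN sinN; ring.
set a := cos (2 * pi * s) / 2 in bE; set b := sin (2 * pi * s) / 2 in bE.
have J5 (f1 f2 f3 f4 f5 : R -> R) c1 c2 c3 : continuous f1 -> continuous f2 -> continuous f3 ->
    continuous f4 -> continuous f5 -> J f1 = 0 -> J f2 = 0 -> J f3 = 0 -> J f4 = 0 -> J f5 = 0 ->
    J (fun t => (c1 * f1 t + c2 * f2 t) + (c2 * f3 t + (c3 * f4 t + (- c3) * f5 t))) = 0.
  move=> cf1 cf2 cf3 cf4 cf5 h1 h2 h3 h4 h5.
  have k1 := cZ f1 c1 cf1; have k2 := cZ f2 c2 cf2; have k3 := cZ f3 c2 cf3.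
  have k4 := cZ f4 c3 cf4; have k5 := cZ f5 (- c3) cf5.
  rewrite (unit_integralD (cP _ _ k1 k2) (cP _ _ k3 (cP _ _ k4 k5))) (unit_integralD k1 k2).
  rewrite (unit_integralD k3 (cP _ _ k4 k5)) (unit_integralD k4 k5) !unit_integralZ //.
  by rewrite h1 h2 h3 h4 h5 !mulr0 !addr0.
have cc q' := cM _ (@continuous_cos_ang q'); have cs q' := cM _ (@continuous_sin_ang q').
split.
- rewrite -[RHS](@J5 (fun t => D t * cos (ang q t)) (fun t => D t * cos (ang (q + 1) t))
    (fun t => D t * cos (ang (q - 1) t)) (fun t => D t * sin (ang (q + 1) t))
    (fun t => D t * sin (ang (q - 1) t)) 2^-1 (a / 2) (b / 2));
    rewrite ?(proj1 (IH _)) ?(proj2 (IH _)) //.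
  congr Rintegral; apply/funext => t; rewrite exprSr mulrA -/(D t) bE angD angB.
  by rewrite !(cosD, sinD, cosN, sinN); field.
rewrite -[RHS](@J5 (fun t => D t * sin (ang q t)) (fun t => D t * sin (ang (q + 1) t))
    (fun t => D t * sin (ang (q - 1) t)) (fun t => D t * cos (ang (q - 1) t))
    (fun t => D t * cos (ang (q + 1) t)) 2^-1 (a / 2) (b / 2));
    rewrite ?(proj1 (IH _)) ?(proj2 (IH _)) //.
congr Rintegral; apply/funext => t; rewrite exprSr mulrA -/(D t) bE angD angB.
by rewrite !(cosD, sinD, cosN, sinN); field.
Qed.

(** Apply [powers_detect] to [A] and to [- A] at the interior points of the
    unit interval; the integers follow by continuity and the rest of the line
    by periodicity. *)
Lemma trig_unique1 (A : R -> R) : continuous A -> (exists B : R, forall t, `|A t| <= B) ->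
  (forall t, A (t + 1) = A t) ->
  (forall q : int, J (fun t => A t * cos (ang q t)) = 0 /\ J (fun t => A t * sin (ang q t)) = 0) ->
  forall t, A t = 0.
Proof.
move=> cA bA per mA.
have inner t : 0 < t < 1 -> A t = 0.
  move=> t01; apply/eqP; rewrite eq_le; apply/andP; split.
    exact: powers_detect cA t01 bA (peak_moments t cA mA).
  rewrite -oppr_le0; apply: (powers_detect (A := fun t => - A t) _ t01).
  - by move=> u; apply: cvgN; exact: cA.
  - by have [B hB] := bA; exists B => u; rewrite normrN.
  move=> N; have := peak_moments t cA mA N => h.
  have cAN : continuous (fun u => A u * peak t u ^+ N).
    have cb : continuous (fun u => peak t u ^+ N).
      move=> u; apply: (@continuous_comp _ _ _ (peak t) (fun x => x ^+ N)); first exact: peak_continuous.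
      exact: exprn_continuous.
    by move=> u; apply: cvgM; [exact: cA|exact: cb].
  transitivity (J (fun u => (-1) * (A u * peak t u ^+ N))).
    by congr Rintegral; apply/funext => u; rewrite mulN1r mulNr.
  by rewrite unit_integralZ // h mulr0.
have perN k t : A (t + k%:R) = A t.
  elim: k => [|k IH]; first by rewrite addr0.
  by rewrite -natr1 addrA per.
have perZ z t : A (t + z%:~R) = A t.
  case: z => k; first by rewrite -pmulrn perN.
  by rewrite NegzE mulrNz -pmulrn -[LHS](perN k.+1) subrK.
have zero0 : A 0 = 0.
  apply/eqP; rewrite -normr_le0 leNgt; apply/negP => A0.
  have : \forall x \near (0 : R), 0 < `|A x|.
    have cN : {for (0 : R), continuous (fun x => `|A x|)}.
      by apply: cvg_norm; exact: cA.
    by move/cvgr_gt : cN; apply.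
  case/nbhs_ballP => e /= e0 he; pose x := Num.min (e / 2) 2^-1.
  have x0 : 0 < x by rewrite lt_min invr_gt0 ltr0n divr_gt0.
  have xe2 : x <= e / 2 by rewrite ge_min lexx.
  have x2 : x <= 2^-1 by rewrite ge_min lexx orbT.
  have xe : x < e by lra.
  have x1 : x < 1 by lra.
  have := he x; rewrite /ball /= sub0r normrN gtr0_norm // => /(_ xe).
  by rewrite inner ?x0 // normr0 ltxx.
move=> t; rewrite -(subrK (Num.floor t)%:~R t) perZ.
have /andP[h1 h2] := floor_itv t.
have [->//|n0] := eqVneq (t - (Num.floor t)%:~R) 0.
apply: inner; rewrite lt_neqAle eq_sym n0 subr_ge0 h1 /=.
by rewrite ltrBlDr addrC -intrD1.
Qed.

End TrigMoments.

(** * Characters of the torus *)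

Section Characters.
Variables (R : realType) (n : nat).
Implicit Types (p q : 'rV[int]_n) (x : 'rV[R]_n) (j : 'I_n).

Lemma phaseDl p q x : phase (p + q) x = phase p x + phase q x.
Proof.
rewrite /phase -mulrDr -big_split /=; congr (_ * _); apply: eq_bigr => j _.
by rewrite mxE rmorphD mulrDl.
Qed.

Lemma phaseNl p x : phase (- p) x = - phase p x.
Proof.
rewrite /phase -mulrN -sumrN; congr (_ * _); apply: eq_bigr => j _.
by rewrite mxE rmorphN mulNr.
Qed.

Lemma phase0l x : phase 0 x = 0.
Proof. by rewrite /phase big1 ?mulr0 // => j _; rewrite mxE mul0r. Qed.

Lemma phaseDr p x y : phase p (x + y) = phase p x + phase p y.
Proof.
rewrite /phase -mulrDr -big_split /=; congr (_ * _); apply: eq_bigr => j _.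
by rewrite mxE mulrDr.
Qed.

Lemma phase_delta p j (h : R) :
  phase p (h *: delta_mx ord0 j) = h * (2 * pi * (p ord0 j)%:~R).
Proof.
rewrite /phase (bigD1 j) //= !mxE !eqxx mulr1 big1 ?addr0; first by ring.
by move=> i ij; rewrite !mxE (negbTE ij) andbF !mulr0.
Qed.

Lemma phase_lattice p (l : 'rV[int]_n) : exists z : int, phase p (map_mx intr l : 'rV[R]_n) = 2 * pi * z%:~R.
Proof.
exists (\sum_j p ord0 j * l ord0 j); rewrite /phase rmorph_sum /=; congr (_ * _).
by apply: eq_bigr => j _; rewrite mxE rmorphM.
Qed.

Lemma cont_sum (I : Type) (r : seq I) (f : I -> 'rV[R]_n -> R) :
  (forall i, continuous (f i)) -> continuous (fun x => \sum_(i <- r) f i x).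
Proof.
move=> cf; elim: r => [|i r IH].
  by under eq_fun do rewrite big_nil; exact: cont_cst.
by under eq_fun do rewrite big_cons; exact: contD.
Qed.

Lemma phase_continuous p : continuous (@phase R n p).
Proof.
apply: contM; first exact: cont_cst.
apply: cont_sum => j; apply: contM; first exact: cont_cst.
exact: coord_continuous.
Qed.

Lemma cos_phase_bcont p : bcont (fun x => cos (phase p x)).
Proof.
split; last by exists 1 => x; rewrite ler_norml cos_geN1 cos_le1.
move=> x; apply: (@continuous_comp _ _ _ (phase p) (@cos R)); first exact: phase_continuous.
exact: continuous_cos.
Qed.

Lemma sin_phase_bcont p : bcont (fun x => sin (phase p x)).
Proof.
split; last by exists 1 => x; rewrite ler_norml sin_geN1 sin_le1.
move=> x; apply: (@continuous_comp _ _ _ (phase p) (@sin R)); first exact: phase_continuous.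
exact: continuous_sin.
Qed.

End Characters.

Section UniquenessTorus.
Variable R : realType.

Local Notation J G := (\int[@lebesgue_measure R]_(t in `[0%R, 1%R]) (G t))%R.
Local Notation ang q t := (2 * pi * (q%:~R * t) : R).

Definition icons n (q : int) (p : 'rV[int]_n) : 'rV[int]_n.+1 :=
  \row_j (if unlift ord0 j is Some i then p ord0 i else q).

Lemma phase_cons n (q : int) (p : 'rV[int]_n) (t : R) y :
  phase (icons q p) (tcons t y) = 2 * pi * (q%:~R * t) + phase p y.
Proof.
rewrite /phase big_ord_recl mulrDr tcons0 mxE unlift_none; congr (_ + _ * _).
by apply: eq_bigr => j _; rewrite tconsS mxE liftK.
Qed.

(** Freezing the first coordinate and integrating out the others against a
    character reduces the statement to one dimension: the resulting functions
    [G] and [H] of the first coordinate vanish, and induction applies to each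
    slice of [A]. *)
Theorem trig_unique n (A : 'rV[R]_n -> R) : bcont A ->
  (forall j x, A (delta_mx ord0 j + x) = A x) ->
  (forall p, rtorus_int (fun x => A x * cos (phase p x)) = 0 /\
             rtorus_int (fun x => A x * sin (phase p x)) = 0) ->
  forall x, A x = 0.
Proof.
elim: n A => [|n IH] A bA per mA x.
  have [+ _] := mA 0; rewrite /= phase0l cos0 mulr1 => <-.
  by congr A; apply/rowP => -[].
have [t [y ->]] := tcons_surj x.
pose G p t := rtorus_int (fun y => A (tcons t y) * cos (phase p y)).
pose H p t := rtorus_int (fun y => A (tcons t y) * sin (phase p y)).
have bAC p : bcont (fun x => A x * cos (phase p x)) by apply: bcontM => //; exact: cos_phase_bcont.
have bAS p : bcont (fun x => A x * sin (phase p x)) by apply: bcontM => //; exact: sin_phase_bcont.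
have E p (s : R) (z : 'rV[R]_n) : phase (icons 0 p) (tcons s z) = phase p z.
  by rewrite phase_cons mul0r mulr0 add0r.
have bGs p s : bcont (fun y => A (tcons s y) * cos (phase p y)).
  by apply: bcontM; [exact: bcont_slice|exact: cos_phase_bcont].
have bHs p s : bcont (fun y => A (tcons s y) * sin (phase p y)).
  by apply: bcontM; [exact: bcont_slice|exact: sin_phase_bcont].
have cG p : continuous (G p).
  have -> : G p = (fun s => rtorus_int (fun z => A (tcons s z) * cos (phase (icons 0 p) (tcons s z)))).
    by apply/funext => s; congr rtorus_int; apply/funext => z; rewrite E.
  exact: rtorus_slice_continuous (bAC (icons 0 p)).
have cH p : continuous (H p).
  have -> : H p = (fun s => rtorus_int (fun z => A (tcons s z) * sin (phase (icons 0 p) (tcons s z)))).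
    by apply/funext => s; congr rtorus_int; apply/funext => z; rewrite E.
  exact: rtorus_slice_continuous (bAS (icons 0 p)).
have [cA [B AB]] := bA.
have GB p s : `|G p s| <= B * 1.
  apply: rtorus_int_norm; first by have [] := bGs p s.
  by move=> z; rewrite normrM ler_pM // ler_norml cos_geN1 cos_le1.
have HB p s : `|H p s| <= B * 1.
  apply: rtorus_int_norm; first by have [] := bHs p s.
  by move=> z; rewrite normrM ler_pM // ler_norml sin_geN1 sin_le1.
have Aper s z : A (tcons (s + 1) z) = A (tcons s z).
  by rewrite addrC -tcons_shift0 scale1r per.
have Gper p s : G p (s + 1) = G p s.
  by congr rtorus_int; apply/funext => z; rewrite Aper.
have Hper p s : H p (s + 1) = H p s.
  by congr rtorus_int; apply/funext => z; rewrite Aper.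
pose Jcg p q := J (fun s => cos (ang q s) * G p s).
pose Jsg p q := J (fun s => sin (ang q s) * G p s).
pose Jch p q := J (fun s => cos (ang q s) * H p s).
pose Jsh p q := J (fun s => sin (ang q s) * H p s).
have cM (f g : R -> R) : continuous f -> continuous g -> continuous (fun s => f s * g s).
  by move=> cf cg s; apply: cvgM; [exact: cf|exact: cg].
have ccg p q := cM _ _ (@continuous_cos_ang R q) (cG p).
have csg p q := cM _ _ (@continuous_sin_ang R q) (cG p).
have cch p q := cM _ _ (@continuous_cos_ang R q) (cH p).
have csh p q := cM _ _ (@continuous_sin_ang R q) (cH p).
have cZ (f : R -> R) c : continuous f -> continuous (fun s => c * f s).
  by move=> cf s; apply: cvgM; [exact: cvg_cst|exact: cf].
(* the moments of A at (q, p) and (- q, p); the four terms are separated by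
     their parity in q *)
have e1 p q : Jcg p q + (-1) * Jsh p q = 0.
  have [<- _] := mA (icons q p); rewrite /Jsh -unit_integralZ // -unit_integralD //; last exact: cZ.
  congr Rintegral; apply/funext => s.
  apply/esym; transitivity (rtorus_int (fun z => cos (ang q s) * (A (tcons s z) * cos (phase p z)) +
     (- sin (ang q s)) * (A (tcons s z) * sin (phase p z)))).
    by congr rtorus_int; apply/funext => z; rewrite -/(tcons s z) phase_cons cosD; ring.
  rewrite rtorus_intD; try by apply: bcontM => //; exact: bcont_cst.
  by rewrite !rtorus_intZ // -/(G p s) -/(H p s) mulN1r mulNr.
have e2 p q : Jsg p q + Jch p q = 0.
  have [_ <-] := mA (icons q p); rewrite -unit_integralD //.
  congr Rintegral; apply/funext => s.
  apply/esym; transitivity (rtorus_int (fun z => sin (ang q s) * (A (tcons s z) * cos (phase p z)) +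
     cos (ang q s) * (A (tcons s z) * sin (phase p z)))).
    by congr rtorus_int; apply/funext => z; rewrite -/(tcons s z) phase_cons sinD; ring.
  rewrite rtorus_intD; try by apply: bcontM => //; exact: bcont_cst.
  by rewrite !rtorus_intZ.
have angN q s : ang (- q) s = - ang q s by rewrite rmorphN /=; ring.
have JcgN p q : Jcg p (- q) = Jcg p q.
  by congr Rintegral; apply/funext => s; rewrite angN cosN.
have JchN p q : Jch p (- q) = Jch p q.
  by congr Rintegral; apply/funext => s; rewrite angN cosN.
have JsgN p q : Jsg p (- q) = (-1) * Jsg p q.
  by rewrite /Jsg -unit_integralZ //; congr Rintegral; apply/funext => s; rewrite angN sinN mulNr mulN1r.
have JshN p q : Jsh p (- q) = (-1) * Jsh p q.
  by rewrite /Jsh -unit_integralZ //; congr Rintegral; apply/funext => s; rewrite angN sinN mulNr mulN1r.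
have G0 p s : G p s = 0.
  apply: (trig_unique1 (cG p)) => [|//|q]; first by exists (B * 1).
  have := e1 p q; have := e1 p (- q); have := e2 p q; have := e2 p (- q).
  rewrite JcgN JchN JsgN JshN => h1 h2 h3 h4; split.
    transitivity (Jcg p q); last by lra.
    by congr Rintegral; apply/funext => u; rewrite mulrC.
  transitivity (Jsg p q); last by lra.
  by congr Rintegral; apply/funext => u; rewrite mulrC.
have H0 p s : H p s = 0.
  apply: (trig_unique1 (cH p)) => [|//|q]; first by exists (B * 1).
  have := e1 p q; have := e1 p (- q); have := e2 p q; have := e2 p (- q).
  rewrite JcgN JchN JsgN JshN => h1 h2 h3 h4; split.
    transitivity (Jch p q); last by lra.
    by congr Rintegral; apply/funext => u; rewrite mulrC.
  transitivity (Jsh p q); last by lra.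
  by congr Rintegral; apply/funext => u; rewrite mulrC.
apply: (IH (fun z => A (tcons t z))); first exact: bcont_slice.
  move=> j z; rewrite -[in RHS](per (lift ord0 j)) -[in RHS](scale1r (delta_mx _ _)) tcons_shiftS.
  by rewrite scale1r.
by move=> p; split; [exact: G0|exact: H0].
Qed.

End UniquenessTorus.

(** * Complex functions on the torus and their Fourier coefficients *)

Section ComplexTorus.
Variables (R : realType) (n : nat).
Implicit Types (x : 'rV[R]_n) (j : 'I_n) (g h : 'rV[R]_n -> R[i]).
Local Notation Re := complex.Re.
Local Notation Im := complex.Im.

Definition cbcont g := bcont (fun x => Re (g x)) /\ bcont (fun x => Im (g x)).

Lemma complex_ext (z w : R[i]) : Re z = Re w -> Im z = Im w -> z = w.
Proof. by case: z w => [a b] [c d] /= -> ->. Qed.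

Lemma cbcont_bound g : cbcont g -> exists2 B : R, 0 < B & forall x, cabs (g x) <= B.
Proof.
move=> [[_ [B hB]] [_ [C hC]]]; exists (B + C + 1).
  by have := le_trans (normr_ge0 _) (hB 0); have := le_trans (normr_ge0 _) (hC 0); lra.
by move=> x; rewrite (le_trans (cabs_le_ReIm _)) // ler_wpDr // lerD.
Qed.

Lemma cbcontP g B : continuous (fun x => Re (g x)) -> continuous (fun x => Im (g x)) ->
  (forall x, cabs (g x) <= B) -> cbcont g.
Proof.
move=> cR cI gB; split; split=> //; exists B => x.
  exact: le_trans (Re_le_cabs _) (gB x).
exact: le_trans (Im_le_cabs _) (gB x).
Qed.

Lemma cbcontD g h : cbcont g -> cbcont h -> cbcont (fun x => g x + h x).
Proof.
move=> [g1 g2] [h1 h2]; split; [have := bcontD g1 h1|have := bcontD g2 h2];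
  by congr bcont; apply/funext => x; rewrite ?cReD ?cImD.
Qed.

Lemma cbcontN g : cbcont g -> cbcont (fun x => - g x).
Proof.
move=> [g1 g2]; split; [have := bcontN g1|have := bcontN g2];
  by congr bcont; apply/funext => x; rewrite ?cReN ?cImN.
Qed.

Lemma cbcontM g h : cbcont g -> cbcont h -> cbcont (fun x => g x * h x).
Proof.
move=> [g1 g2] [h1 h2]; split.
  have := bcontD (bcontM g1 h1) (bcontN (bcontM g2 h2)).
  by congr bcont; apply/funext => x; rewrite cReM.
have := bcontD (bcontM g1 h2) (bcontM g2 h1).
by congr bcont; apply/funext => x; rewrite cImM.
Qed.

Lemma cbcont_cst c : cbcont (fun _ : 'rV[R]_n => c).
Proof. by split; exact: bcont_cst. Qed.

Lemma torus_intD g h : cbcont g -> cbcont h ->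
  torus_int (fun x => g x + h x) = torus_int g + torus_int h.
Proof.
move=> [g1 g2] [h1 h2]; apply: complex_ext; rewrite ?cReD ?cImD /= -rtorus_intD //;
  by congr rtorus_int; apply/funext => x; rewrite ?cReD ?cImD.
Qed.

Lemma torus_intZ c g : cbcont g -> torus_int (fun x => c * g x) = c * torus_int g.
Proof.
move=> [g1 g2]; have bZ (a : R) f : bcont f -> bcont (fun x => a * f x).
  by move=> bf; apply: bcontM => //; exact: bcont_cst.
apply: complex_ext; rewrite ?cReM ?cImM /=.
  rewrite -mulNr -!rtorus_intZ // -rtorus_intD; try exact: bZ.
  by congr rtorus_int; apply/funext => x; rewrite cReM mulNr.
rewrite -!rtorus_intZ // -rtorus_intD; try exact: bZ.
by congr rtorus_int; apply/funext => x; rewrite cImM.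
Qed.

Lemma torus_int_cst c : torus_int (fun _ : 'rV[R]_n => c) = c.
Proof. by apply: complex_ext; rewrite /= rtorus_int_cst. Qed.

Lemma torus_int_norm g B : cbcont g -> (forall x, cabs (g x) <= B) ->
  cabs (torus_int g) <= B *+ 2.
Proof.
move=> [[cR _] [cI _]] gB; rewrite (le_trans (cabs_le_ReIm _)) // mulr2n lerD //=.
  by apply: rtorus_int_norm => // x; exact: le_trans (Re_le_cabs _) (gB x).
by apply: rtorus_int_norm => // x; exact: le_trans (Im_le_cabs _) (gB x).
Qed.

Lemma torus_int_sum (I : Type) (r : seq I) (f : I -> 'rV[R]_n -> R[i]) :
  (forall i, cbcont (f i)) ->
  cbcont (fun x => \sum_(i <- r) f i x) /\
  torus_int (fun x => \sum_(i <- r) f i x) = \sum_(i <- r) torus_int (f i).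
Proof.
move=> cf; elim: r => [|i r [IH1 IH2]].
  rewrite big_nil (_ : (fun x => _) = (fun=> 0)); last by apply/funext => x; rewrite big_nil.
  by split; [exact: cbcont_cst|exact: torus_int_cst].
rewrite big_cons -IH2 -torus_intD //.
rewrite (_ : (fun x => _) = (fun x => f i x + \sum_(i <- r) f i x)); last first.
  by apply/funext => x; rewrite big_cons.
by split => //; exact: cbcontD.
Qed.

(** ** Directional derivatives *)

(** A relation rather than an operator, so that existence of the derivative
    and its value are carried together. *)
Definition cderiv j g dg := forall x,
  is_derive x (delta_mx ord0 j) (fun y => Re (g y)) (Re (dg x)) /\
  is_derive x (delta_mx ord0 j) (fun y => Im (g y)) (Im (dg x)).

Definition lattice_periodic g := forall x (l : 'rV[int]_n), g (x + map_mx intr l) = g x.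

Lemma lattice_periodic_delta g j x : lattice_periodic g -> g (delta_mx ord0 j + x) = g x.
Proof.
move=> /(_ x (delta_mx ord0 j)); rewrite addrC => <-; congr (g (_ + _)).
by apply/matrixP => a b; rewrite !mxE; case: (_ && _).
Qed.

Lemma lattice_periodicM g h : lattice_periodic g -> lattice_periodic h -> lattice_periodic (fun x => g x * h x).
Proof. by move=> pg ph x l; rewrite pg ph. Qed.

Lemma cderivE j g dg : cderiv j g dg -> cpartial j g = dg.
Proof.
move=> d; apply/funext => x; have [d1 d2] := d x.
by apply: complex_ext; rewrite /= /rpartial; exact: derive_val.
Qed.

Lemma cderivD j g dg h dh : cderiv j g dg -> cderiv j h dh ->
  cderiv j (fun x => g x + h x) (fun x => dg x + dh x).
Proof.
move=> Dg Dh x; have [g1 g2] := Dg x; have [h1 h2] := Dh x; split.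
  have -> : (fun y => Re (g y + h y)) = (fun y => Re (g y)) + (fun y => Re (h y)).
    by apply/funext => y; rewrite cReD.
  by rewrite cReD; exact: is_deriveD.
have -> : (fun y => Im (g y + h y)) = (fun y => Im (g y)) + (fun y => Im (h y)).
  by apply/funext => y; rewrite cImD.
by rewrite cImD; exact: is_deriveD.
Qed.

Lemma cderivM j g dg h dh : cderiv j g dg -> cderiv j h dh ->
  cderiv j (fun x => g x * h x) (fun x => dg x * h x + g x * dh x).
Proof.
move=> Dg Dh x; have [g1 g2] := Dg x; have [h1 h2] := Dh x; split.
  have -> : (fun y => Re (g y * h y)) =
      (fun y => Re (g y)) * (fun y => Re (h y)) - (fun y => Im (g y)) * (fun y => Im (h y)).
    by apply/funext => y; rewrite cReM.
  apply: (is_derive_eq (is_deriveB (is_deriveM g1 h1) (is_deriveM g2 h2))).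
  rewrite cReD !cReM -![_ *: _]/(_ * _); ring.
have -> : (fun y => Im (g y * h y)) =
    (fun y => Re (g y)) * (fun y => Im (h y)) + (fun y => Im (g y)) * (fun y => Re (h y)).
  by apply/funext => y; rewrite cImM.
apply: (is_derive_eq (is_deriveD (is_deriveM g1 h2) (is_deriveM g2 h1))).
rewrite cImD !cImM -![_ *: _]/(_ * _); ring.
Qed.

Lemma cderiv_cst j c : cderiv j (fun=> c) (fun=> 0).
Proof. by move=> x; split; exact: is_derive_cst. Qed.

Lemma is_derive_rV_inv (f : 'rV[R]_n -> R) x v d : f x != 0 -> is_derive x v f d ->
  is_derive x v (fun y => (f y)^-1) (- (f x ^- 2) * d).
Proof.
move=> fx df; pose G (s : R) := f (s *: v + x).
have dG : is_derive (0 : R) (1 : R) G d.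
  by apply: is_derive_transport1 df => s; rewrite /G addr0.
have G0 : G 0 = f x by rewrite /G scale0r add0r.
have dV : is_derive (0 : R) (1 : R) (fun s => (G s)^-1) (- (f x) ^- 2 *: d).
  by rewrite -G0; apply: is_deriveV; rewrite G0.
have [dd dE] := dV.
have E : (fun s : R => s^-1 *: (((fun s => (G s)^-1) \o shift 0) (s *: (1 : R)) - (G 0)^-1)) =
         (fun s : R => s^-1 *: (((fun y => (f y)^-1) \o shift x) (s *: v) - (f x)^-1)).
  by apply/funext => s /=; rewrite G0 addr0 -[s *: 1]/(s * 1) mulr1.
split; first by rewrite /derivable -E.
by rewrite /derive -E.
Qed.

Lemma cderivV j g dg : (forall x, g x != 0) -> cderiv j g dg ->
  cderiv j (fun x => (g x)^-1) (fun x => - (g x)^-1 * (g x)^-1 * dg x).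
Proof.
move=> g0 Dg x; have [g1 g2] := Dg x.
pose N y := Re (g y) ^+ 2 + Im (g y) ^+ 2.
have N0 y : N y != 0.
  rewrite /N paddr_eq0 ?sqr_ge0 // !sqrf_eq0; apply: contra (g0 y) => /andP[/eqP a /eqP b].
  by apply/eqP/complex_ext.
have dN : is_derive x (delta_mx ord0 j) N (2 * (Re (g x) * Re (dg x) + Im (g x) * Im (dg x))).
  have -> : N = (fun y => Re (g y)) * (fun y => Re (g y)) + (fun y => Im (g y)) * (fun y => Im (g y)).
    by apply/funext => y; rewrite /N !expr2.
  apply: (is_derive_eq (is_deriveD (is_deriveM g1 g1) (is_deriveM g2 g2))).
  rewrite -![_ *: _]/(_ * _); ring.
have dV := is_derive_rV_inv (N0 x) dN.
have gV y : (g y)^-1 = Complex (Re (g y) * (N y)^-1) (- (Im (g y) * (N y)^-1)).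
  apply: (mulfI (g0 y)); rewrite divff //; apply: complex_ext; rewrite ?cReM ?cImM /=.
    by move: (N0 y); rewrite /N; move: (Re (g y)) (Im (g y)) => a b ab; field.
  ring.
split.
  have -> : (fun y => Re (g y)^-1) = (fun y => Re (g y)) * (fun y => (N y)^-1).
    by apply/funext => y; rewrite gV.
  apply: (is_derive_eq (is_deriveM g1 dV)).
  rewrite gV -![_ *: _]/(_ * _) !(cReM, cImM, cReN, cImN) /=.
  move: (N0 x); rewrite /N; move: (Re (g x)) (Im (g x)) (Re (dg x)) (Im (dg x)) => a b c d ab.
  by field.
have -> : (fun y => Im (g y)^-1) = - ((fun y => Im (g y)) * (fun y => (N y)^-1)).
  by apply/funext => y; rewrite gV.
apply: (is_derive_eq (is_deriveN (is_deriveM g2 dV))).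
rewrite gV -![_ *: _]/(_ * _) !(cReM, cImM, cReN, cImN) /=.
move: (N0 x); rewrite /N; move: (Re (g x)) (Im (g x)) (Re (dg x)) (Im (dg x)) => a b c d ab.
by field.
Qed.

Lemma torus_int_cderiv j g dg : cbcont g -> cbcont dg -> lattice_periodic g -> cderiv j g dg ->
  torus_int dg = 0.
Proof.
move=> [g1 g2] [d1 d2] pg D; apply: complex_ext.
  apply: (rtorus_int_derive (j := j) g1 d1) => [x|x]; first by have [] := D x.
  by rewrite lattice_periodic_delta.
apply: (rtorus_int_derive (j := j) g2 d2) => [x|x]; first by have [] := D x.
by rewrite lattice_periodic_delta.
Qed.

End ComplexTorus.

(** * Fourier series *)

Section FourierSeries.
Variables (R : realType) (n : nat).
Implicit Types (p q : 'rV[int]_n) (x : 'rV[R]_n) (j : 'I_n) (g h : 'rV[R]_n -> R[i]).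
Implicit Types (c : 'rV[int]_n -> R[i]).
Local Notation Re := complex.Re.
Local Notation Im := complex.Im.
Local Notation wt := (@wt R n).
Local Notation jap := (@jap R n).

Lemma cisD (s t : R) : cis (s + t) = cis s * cis t.
Proof. by apply: complex_ext; rewrite ?cReM ?cImM /= ?cosD ?sinD; ring. Qed.

Lemma cis0 : cis (0 : R) = 1.
Proof. by apply: complex_ext; rewrite /= ?cos0 ?sin0. Qed.

Lemma cabs_cis (t : R) : cabs (cis t) = 1.
Proof. by rewrite /cabs /= cos2Dsin2 sqrtr1. Qed.

Definition character p x : R[i] := cis (phase p x).

Lemma characterD p q x : character (p + q) x = character p x * character q x.
Proof. by rewrite /character phaseDl cisD. Qed.

Lemma character0 x : character 0 x = 1.
Proof. by rewrite /character phase0l cis0. Qed.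

Lemma cabs_character p x : cabs (character p x) = 1.
Proof. exact: cabs_cis. Qed.

Lemma character_cbcont p : cbcont (character p).
Proof. by split; [exact: cos_phase_bcont|exact: sin_phase_bcont]. Qed.

Lemma character_periodic p : lattice_periodic (character p).
Proof.
move=> x l; rewrite /character phaseDr; have [z ->] := phase_lattice R p l.
by apply: complex_ext; rewrite /= ?cos_periodicz ?sin_periodicz.
Qed.

Lemma sin_bound (a : R) : `|sin a| <= `|a|.
Proof.
have := @lipschitz_of_derive R (@sin R) (@cos R) 1 (fun t => is_derive_sin t) _ 0 a.
rewrite sin0 !subr0 mul1r; apply => t; by rewrite ler_norml cos_geN1 cos_le1.
Qed.

Lemma lipschitz_segment (F dF : R -> R) (B a : R) : (forall t : R, is_derive t (1 : R) F (dF t)) ->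
  (forall t, `|t| <= `|a| -> `|dF t| <= B) -> `|F a - F 0| <= B * `|a|.
Proof.
move=> dFF dB.
have cF : continuous F.
  move=> t; apply: differentiable_continuous; apply/derivable1_diffP; exact: ex_derive.
have [a0|a0|->] := ltgtP a 0; last by rewrite subrr !normr0 mulr0.
  have [t] := MVT a0 (fun u _ => dFF u) (continuous_subspaceT cF).
  rewrite in_itv /= => /andP[h1 h2] E.
  rewrite distrC E normrM sub0r normrN ler_wpM2r // dB //.
  by rewrite ltr0_norm // ltr0_norm // lerN2 ltW.
have [t] := MVT a0 (fun u _ => dFF u) (continuous_subspaceT cF).
rewrite in_itv /= => /andP[h1 h2] E.
rewrite E normrM subr0 ler_wpM2r // dB //.
by rewrite gtr0_norm // gtr0_norm // ltW.
Qed.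

Lemma cos_bound (a : R) : `|cos a - 1| <= a ^+ 2.
Proof.
rewrite -[X in _ - X]cos0 -real_normK ?num_real // expr2.
apply: (@lipschitz_segment (@cos R) (fun t => - sin t)) => t ta.
by rewrite normrN (le_trans (sin_bound t)).
Qed.

Lemma sin_bound2 (a : R) : `|sin a - a| <= 2 * a ^+ 2.
Proof.
have [a1|a1] := leP `|a| 1.
  have h : `|(sin a - a) - (sin 0 - 0)| <= a ^+ 2 * `|a|.
    apply: (@lipschitz_segment (fun t => sin t - t) (fun t => cos t - 1)) => t ta.
    apply: (le_trans (cos_bound t)); rewrite -[t ^+ 2]real_normK ?num_real //.
    by rewrite -[a ^+ 2]real_normK ?num_real // lerXn2r ?nnegrE.
  rewrite sin0 !subr0 in h; apply: (le_trans h).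
  have a2 : 0 <= a ^+ 2 by rewrite sqr_ge0.
  by apply: (@le_trans _ _ (a ^+ 2)); [rewrite ler_piMr|lra].
apply: (le_trans (ler_normB _ _)); have h := sin_bound a.
rewrite -[a ^+ 2]real_normK ?num_real //; nra.
Qed.

(** A bound quadratic in the step and uniform in the base point survives
    summation against rapidly decreasing coefficients; this is what makes
    termwise differentiation of Fourier series possible. *)
Lemma cis_taylor (t a : R) : cabs (cis (a + t) - cis t - Complex a 0 * (Complex 0 1 * cis t)) <= 3 * a ^+ 2.
Proof.
have -> : cis (a + t) - cis t - Complex a 0 * (Complex 0 1 * cis t) =
    (cis a - 1 - Complex 0 a) * cis t.
  rewrite cisD; have -> : Complex 0 a = Complex a 0 * Complex 0 1 :> R[i].
    by apply: complex_ext; rewrite ?cReM ?cImM /=; ring.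
  ring.
rewrite cabsM cabs_cis mulr1 (le_trans (cabs_le_ReIm _)) //.
rewrite !(cReD, cImD, cReN, cImN) /= subr0 oppr0 addr0.
by have := cos_bound a; have := sin_bound2 a; lra.
Qed.

Lemma is_derive_of_bound (f : 'rV[R]_n -> R) x v (d K : R) :
  (forall s : R, `|f (s *: v + x) - f x - s * d| <= K * s ^+ 2) -> is_derive x v f d.
Proof.
move=> fK; have K0 : 0 <= K by have := fK 1; rewrite expr1n mulr1; exact: le_trans.
have cv : (fun s : R => s^-1 *: ((f \o shift x) (s *: v) - f x)) @ 0^' --> d.
  apply/cvgrPdist_le => e e0; near=> s.
  have s0 : s != 0 by near: s; exact: nbhs_dnbhs_neq.
  have se : `|s| <= e / (K + 1).
    near: s; apply: dnbhs0_le; by rewrite divr_gt0 // ltr_wpDl.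
  rewrite /= -[s^-1 *: _]/(s^-1 * _) distrC.
  have -> : s^-1 * (f (s *: v + x) - f x) - d = s^-1 * (f (s *: v + x) - f x - s * d) by field.
  rewrite normrM normfV ler_pdivrMl ?normr_gt0 // (le_trans (fK s)) //.
  rewrite -[s ^+ 2]real_normK ?num_real // expr2 mulrA mulrC ler_wpM2l //.
  have K1 : 0 < K + 1 by rewrite ltr_wpDl.
  apply: (@le_trans _ _ (K * (e / (K + 1)))); first by rewrite ler_wpM2l.
  by rewrite mulrCA ler_piMr ?(ltW e0) // ler_pdivrMr // mul1r lerDl.
split; first by apply/cvg_ex; exists d.
exact: cvg_lim cv.
Unshelve. all: by end_near. Qed.

Lemma cderiv_of_bound j g dg (K : R) :
  (forall x (s : R), cabs (g (s *: delta_mx ord0 j + x) - g x - Complex s 0 * dg x) <= K * s ^+ 2) ->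
  cderiv j g dg.
Proof.
move=> gK x; split; apply: (@is_derive_of_bound _ _ _ _ K) => s.
  apply: le_trans (gK x s); apply: le_trans (Re_le_cabs _).
  by rewrite !(cReD, cReN, cReM) /= mul0r subr0.
apply: le_trans (gK x s); apply: le_trans (Im_le_cabs _).
by rewrite !(cImD, cImN, cImM) /= mul0r addr0.
Qed.

(** The Fourier multiplier of [d / dx_j]. *)
Definition dsymb j p : R[i] := Complex 0 (2 * pi) * (p ord0 j)%:~R.

Lemma character_taylor j p x (s : R) :
  cabs (character p (s *: delta_mx ord0 j + x) - character p x - Complex s 0 * (dsymb j p * character p x))
    <= 3 * (2 * pi * jap p) ^+ 2 * s ^+ 2.
Proof.
rewrite /character phaseDr phase_delta; set a := s * _.
have -> : Complex s 0 * (dsymb j p * cis (phase p x)) = Complex a 0 * (Complex 0 1 * cis (phase p x)).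
  rewrite [LHS]mulrA [RHS]mulrA; congr (_ * _).
  rewrite /dsymb -(rmorph_int (real_complex R)); apply: complex_ext; rewrite !(cReM, cImM) /= /a; ring.
apply: (le_trans (cis_taylor _ _)); rewrite -mulrA -exprMn ler_wpM2l //.
rewrite -[leLHS]real_normK ?num_real // -[leRHS]real_normK ?num_real //.
rewrite lerXn2r ?nnegrE // /a !normrM mulrC ler_wpM2r // ler_wpM2l //.
by rewrite (le_trans (jap_coord R p j)) // ler_norm.
Qed.

Lemma cderiv_character j p : cderiv j (character p) (fun x => dsymb j p * character p x).
Proof. exact: cderiv_of_bound (character_taylor j p). Qed.

(** For [p != 0] the character is a derivative, up to a nonzero factor. *)
Lemma torus_int_character p : torus_int (character p) = (if p == 0 then 1 else 0 : R[i]).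
Proof.
case: eqP => [->|/eqP p0].
  have -> : character 0 = fun=> 1 by apply/funext => x; rewrite character0.
  exact: torus_int_cst.
have [j pj] : exists j, p ord0 j != 0.
  apply/existsP; rewrite -negb_forall; apply: contra p0 => /forallP h.
  by apply/eqP/rowP => j; rewrite mxE; move/eqP: (h j).
have cc := character_cbcont p.
have := torus_int_cderiv cc (cbcontM (cbcont_cst _ (dsymb j p)) cc) (character_periodic p) (cderiv_character j p).
rewrite torus_intZ // => /eqP; rewrite mulf_eq0 => /orP[|/eqP//].
rewrite /dsymb mulf_eq0 intr_eq0 (negbTE pj) orbF => /eqP [] /eqP.
by rewrite mulf_eq0 pnatr_eq0 /= gt_eqF ?pi_gt0.
Qed.

Definition rapid c := forall M, exists2 C : R, 0 < C & forall p, cabs (c p) <= C * jap p ^- M.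

Lemma rapid_dominated c : rapid c -> exists2 C : R, 0 < C & forall p, cabs (c p) <= C * wt p.
Proof. by move=> rc; have [C C0 hC] := rc n.*2; exists C. Qed.

Lemma rapid_dsymb j c : rapid c -> rapid (fun p => dsymb j p * c p).
Proof.
move=> rc M; have [C C0 hC] := rc M.+1; exists (2 * pi * C) => [|p].
  by rewrite !mulr_gt0 // pi_gt0.
have j0 := jap_gt0 R p; have jM := japX_gt0 R p M.
rewrite cabsM /dsymb cabsM cabs_imag cabs_intr.
have -> : 2 * pi * C * jap p ^- M = (2 * pi * jap p) * (C * jap p ^- M.+1).
  by rewrite exprSr; field; rewrite !gt_eqF.
rewrite ler_pM ?mulr_ge0 ?cabs_ge0 ?hC // ger0_norm ?mulr_ge0 ?(ltW (pi_gt0 R)) //.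
by rewrite ler_wpM2l ?mulr_ge0 ?(ltW (pi_gt0 R)) // jap_coord.
Qed.

Definition fser c x : R[i] := csum (fun p => c p * character p x).

Lemma fser_dominated c C : (forall p, cabs (c p) <= C * wt p) ->
  forall x p, cabs (c p * character p x) <= C * wt p.
Proof. by move=> cC x p; rewrite cabsM cabs_character mulr1. Qed.

Lemma fser_summable c x : rapid c -> abs_summable (fun p => c p * character p x).
Proof.
move=> /rapid_dominated[C _ hC].
exact: dominated_summable (fser_dominated hC x).
Qed.

Lemma uniform_continuous_limit (f : 'rV[R]_n -> R) :
  (forall e : R, 0 < e -> exists2 s : 'rV[R]_n -> R, continuous s & forall x, `|f x - s x| <= e) ->
  continuous f.
Proof.
move=> app x; apply/(@cvgrPdist_le _ _ _ (nbhs x) (nbhs_filter x)) => e e0.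
have e3 : 0 < e / 3 by rewrite divr_gt0.
have [s cs hs] := app _ e3.
have : \forall y \near x, `|s x - s y| <= e / 3.
  by move/(@cvgrPdist_le _ _ _ (nbhs x) (nbhs_filter x)): (cs x); apply.
apply: filterS => y sxy.
have -> : f x - f y = (f x - s x) + (s x - s y) - (f y - s y) by ring.
apply: (le_trans (ler_normB _ _)); apply: (le_trans (lerD (ler_normD _ _) (hs y))).
by have := hs x; lra.
Qed.

(** A uniform limit of trigonometric polynomials. *)
Lemma fser_cbcont c : rapid c -> cbcont (fser c).
Proof.
move=> rc; have [C C0 hC] := rapid_dominated rc.
have app (e : R) : 0 < e -> exists2 s, cbcont s & forall x, cabs (fser c x - s x) <= e.
  move=> e0; have [F uF hF] := @dominated_csum_approx R n _ (divr_gt0 e0 C0).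
  exists (fun x => \sum_(p <- F) c p * character p x).
    have [|//] := @torus_int_sum R n _ F (fun p x => c p * character p x).
    by move=> p; apply: cbcontM; [exact: cbcont_cst|exact: character_cbcont].
  move=> x; have := hF _ _ (fser_dominated hC x).
  by rewrite mulrCA divff ?mulr1 ?gt_eqF.
apply: (@cbcontP _ _ _ (C * wmass R n)).
- apply: uniform_continuous_limit => e /app[s [[cR _] _] hs]; exists (fun x => Re (s x)) => // x.
  by apply: le_trans (hs x); apply: le_trans (Re_le_cabs _); rewrite cReD cReN.
- apply: uniform_continuous_limit => e /app[s [_ [cI _]] hs]; exists (fun x => Im (s x)) => // x.
  by apply: le_trans (hs x); apply: le_trans (Im_le_cabs _); rewrite cImD cImN.
by move=> x; exact: dominated_csum_le (fser_dominated hC x).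
Qed.

Lemma fser_periodic c : lattice_periodic (fser c).
Proof.
move=> x l; congr csum; apply/funext => p; congr (_ * _); exact: character_periodic.
Qed.

Lemma fser_norm c C : (forall p, cabs (c p) <= C * wt p) -> forall x, cabs (fser c x) <= C * wmass R n.
Proof. by move=> hC x; exact: dominated_csum_le (fser_dominated hC x). Qed.

(** The quadratic Taylor bounds of the terms add up to a quadratic Taylor
    bound of the sum. *)
Lemma cderiv_fser j c : rapid c -> cderiv j (fser c) (fser (fun p => dsymb j p * c p)).
Proof.
move=> rc; have [C C0 hC] := rc (n.*2 + 2)%N.
have pp : 0 < (2 * pi) ^+ 2 :> R by rewrite exprn_gt0 // mulr_gt0 // pi_gt0.
apply: (@cderiv_of_bound _ _ _ (3 * (2 * pi) ^+ 2 * C * wmass R n)) => x s.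
have sc y := fser_summable y rc; have sd := fser_summable x (rapid_dsymb j rc).
have sN (u : 'rV[int]_n -> R[i]) : abs_summable u -> abs_summable (fun p => - u p).
  by move=> /(abs_summableZ (-1)); congr abs_summable; apply/funext => p; rewrite mulN1r.
rewrite /fser -[Complex s 0 * _]csumZ // -csumN // -csumN; last exact: abs_summableZ.
rewrite -csumD //; last exact: sN.
rewrite -csumD; last 2 first.
- by apply: abs_summableD => //; exact: sN.
- by apply: sN; exact: abs_summableZ.
rewrite mulrAC; apply: dominated_csum_le => p.
have -> : c p * character p (s *: delta_mx ord0 j + x) - c p * character p x -
    Complex s 0 * (dsymb j p * c p * character p x) =
  c p * (character p (s *: delta_mx ord0 j + x) - character p x - Complex s 0 * (dsymb j p * character p x)).
  ring.
rewrite cabsM; apply: (le_trans (ler_pM (cabs_ge0 _) (cabs_ge0 _) (hC p) (character_taylor j p x s))).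
have jw := japX_gt0 R p n.*2; have j0 := jap_gt0 R p.
rewrite le_eqVlt; apply/orP; left; apply/eqP; rewrite /wt exprD.
by field; rewrite !gt_eqF.
Qed.

(** Integration against [g] is a functional as in [csum_functional]. *)
Lemma torus_int_fser g c : cbcont g -> rapid c ->
  torus_int (fun x => g x * fser c x) = csum (fun q => c q * torus_int (fun x => g x * character q x)).
Proof.
move=> cg rc; have [B B0 gB] := cbcont_bound cg; have [C C0 hC] := rapid_dominated rc.
pose u x q := c q * (g x * character q x).
have cu q : cbcont (u ^~ q).
  by apply: cbcontM; [exact: cbcont_cst|apply: cbcontM => //; exact: character_cbcont].
have uB x q : cabs (u x q) <= C * B * wt q.
  rewrite /u !cabsM cabs_character mulr1 mulrAC.
  by rewrite ler_pM ?cabs_ge0.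
have E x : csum (u x) = g x * fser c x.
  rewrite /fser -csumZ; last exact: fser_summable.
  by congr csum; apply/funext => q; rewrite /u mulrCA.
transitivity (torus_int (fun x => csum (u x))).
  by congr torus_int; apply/funext => x; rewrite E.
rewrite (@csum_functional R n _ (@torus_int R n) u (C * B *+ 2 + 2)).
- by congr csum; apply/funext => q; rewrite /u torus_intZ //; apply: cbcontM => //; exact: character_cbcont.
- move=> q; apply: (@le_trans _ _ (C * B * wt q *+ 2)); first exact: torus_int_norm.
  by rewrite -mulrnAl ler_wpM2r ?wt_ge0 // lerDl.
- move=> F e he; have [cs <-] := torus_int_sum F cu.
  have cf : cbcont (fun x => csum (u x)).
    have := cbcontM cg (fser_cbcont rc); congr cbcont; by apply/funext => x; rewrite E.
  have cN : cbcont (fun x => -1 * (\sum_(q <- F) u x q)) by apply: cbcontM => //; exact: cbcont_cst.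
  rewrite -mulN1r -torus_intZ // -torus_intD //.
  have e0 : 0 <= e := le_trans (cabs_ge0 _) (he 0).
  apply: (@le_trans _ _ (e *+ 2)).
    by apply: torus_int_norm => [|x]; [exact: cbcontD|rewrite mulN1r].
  have CB : 0 <= C * B * e by rewrite !mulr_ge0 // ltW.
  by rewrite !mulr2n; lra.
by exists (C * B) => //; exact: mulr_gt0.
Qed.

Definition fcoef g p : R[i] := torus_int (fun x => character (- p) x * g x).

Lemma fcoef_fser c p : rapid c -> fcoef (fser c) p = c p.
Proof.
move=> rc; rewrite /fcoef torus_int_fser //; last exact: character_cbcont.
rewrite -[RHS](csum_delta p); congr csum; apply/funext => q.
have -> : (fun x => character (- p) x * character q x) = character (q - p).
  by apply/funext => x; rewrite addrC characterD.
by rewrite torus_int_character subr_eq0; case: eqP => [->|]; rewrite ?mulr1 ?mulr0.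
Qed.

(** Integrate the Fourier series termwise. *)
Lemma fcoef_mul_fser g c p : cbcont g -> rapid c ->
  fcoef (fun x => g x * fser c x) p = csum (fun q => c q * fcoef g (p - q)).
Proof.
move=> cg rc; rewrite /fcoef.
transitivity (torus_int (fun x => (character (- p) x * g x) * fser c x)).
  by congr torus_int; apply/funext => x; rewrite mulrA.
rewrite torus_int_fser //; last by apply: cbcontM => //; exact: character_cbcont.
congr csum; apply/funext => q; congr (_ * torus_int _); apply/funext => x.
by rewrite opprB addrC characterD mulrAC.
Qed.

Lemma fcoef_norm g B p : cbcont g -> (forall x, cabs (g x) <= B) -> cabs (fcoef g p) <= B *+ 2.
Proof.
move=> cg gB; apply: torus_int_norm => [|x]; last by rewrite cabsM cabs_character mul1r.
by apply: cbcontM => //; exact: character_cbcont.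
Qed.

(** The integral of the derivative of [character (- p) * g] vanishes. *)
Lemma fcoef_cderiv j g dg p : cbcont g -> cbcont dg -> lattice_periodic g -> cderiv j g dg ->
  fcoef dg p = dsymb j p * fcoef g p.
Proof.
move=> cg cdg pg D; have cc := character_cbcont (- p).
have cgg := cbcontM cc cg; have cdd := cbcontM cc cdg.
have := torus_int_cderiv (cbcontM cc cg) _ (lattice_periodicM (character_periodic (- p)) pg)
  (cderivM (cderiv_character j (- p)) D).
have E : (fun x => dsymb j (- p) * character (- p) x * g x + character (- p) x * dg x) =
    (fun x => (- dsymb j p) * (character (- p) x * g x) + character (- p) x * dg x).
  by apply/funext => x; rewrite {1}/dsymb mxE rmorphN mulrN /dsymb; ring.
rewrite E => /(_ _)/eqP; rewrite torus_intD ?torus_intZ //; last by apply: cbcontM => //; exact: cbcont_cst.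
rewrite mulNr addrC subr_eq0 => h; apply/eqP/h.
by apply: cbcontD => //; apply: cbcontM => //; exact: cbcont_cst.
Qed.

(** Both sides have the same Fourier coefficients. *)
Lemma fourier_inversion g : cbcont g -> lattice_periodic g -> rapid (fcoef g) -> fser (fcoef g) = g.
Proof.
move=> cg pg rg; have cf := fser_cbcont rg.
pose d x := g x + (-1) * fser (fcoef g) x.
have c1 : cbcont (fun x => -1 * fser (fcoef g) x) by apply: cbcontM => //; exact: cbcont_cst.
have cd : cbcont d by exact: cbcontD.
have pd : lattice_periodic d by move=> x l; rewrite /d pg fser_periodic.
have d0 p : torus_int (fun x => d x * character p x) = 0.
  have -> : (fun x => d x * character p x) = (fun x => character (- (- p)) x * g x +
      (-1) * (character (- (- p)) x * fser (fcoef g) x)).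
    by apply/funext => x; rewrite /d opprK; ring.
  have cc := character_cbcont (- (- p)); have ccf := cbcontM cc cf.
  rewrite torus_intD ?torus_intZ //; last 2 first.
  - exact: cbcontM.
  - by apply: cbcontM => //; exact: cbcont_cst.
  by rewrite -/(fcoef g (- p)) -/(fcoef (fser (fcoef g)) (- p)) fcoef_fser // mulN1r subrr.
have [[cR bR] [cI bI]] := cd.
(* d0 at p and at - p separates real and imaginary parts *)
have key p : rtorus_int (fun x => Re (d x) * cos (phase p x)) = 0 /\
    rtorus_int (fun x => Re (d x) * sin (phase p x)) = 0 /\
    rtorus_int (fun x => Im (d x) * cos (phase p x)) = 0 /\
    rtorus_int (fun x => Im (d x) * sin (phase p x)) = 0.
  have b1 : bcont (fun x => Re (d x) * cos (phase p x)) by apply: bcontM => //; exact: cos_phase_bcont.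
  have b2 : bcont (fun x => Re (d x) * sin (phase p x)) by apply: bcontM => //; exact: sin_phase_bcont.
  have b3 : bcont (fun x => Im (d x) * cos (phase p x)) by apply: bcontM => //; exact: cos_phase_bcont.
  have b4 : bcont (fun x => Im (d x) * sin (phase p x)) by apply: bcontM => //; exact: sin_phase_bcont.
  have bN f : bcont f -> bcont (fun x : 'rV[R]_n => (-1) * f x).
    by move=> bf; apply: bcontM => //; exact: bcont_cst.
  have e1 : rtorus_int (fun x => Re (d x) * cos (phase p x)) -
            rtorus_int (fun x => Im (d x) * sin (phase p x)) = 0.
    have := congr1 (@complex.Re R) (d0 p); rewrite /= => <-; rewrite -mulN1r -rtorus_intZ // -rtorus_intD //; last exact: bN.
    by congr rtorus_int; apply/funext => x; rewrite cReM mulN1r.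
  have e2 : rtorus_int (fun x => Re (d x) * sin (phase p x)) +
            rtorus_int (fun x => Im (d x) * cos (phase p x)) = 0.
    have := congr1 (@complex.Im R) (d0 p); rewrite /= => <-; rewrite -rtorus_intD //.
    by congr rtorus_int; apply/funext => x; rewrite cImM.
  have e3 : rtorus_int (fun x => Re (d x) * cos (phase p x)) +
            rtorus_int (fun x => Im (d x) * sin (phase p x)) = 0.
    have := congr1 (@complex.Re R) (d0 (- p)); rewrite /= => <-; rewrite -rtorus_intD //.
    by congr rtorus_int; apply/funext => x; rewrite cReM /= phaseNl cosN sinN mulrN opprK.
  have e4 : rtorus_int (fun x => Im (d x) * cos (phase p x)) -
            rtorus_int (fun x => Re (d x) * sin (phase p x)) = 0.
    have := congr1 (@complex.Im R) (d0 (- p)); rewrite /= => <-; rewrite -mulN1r -rtorus_intZ // -rtorus_intD //; last exact: bN.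
    by congr rtorus_int; apply/funext => x; rewrite cImM /= phaseNl cosN sinN; ring.
  by do ! split; lra.
have zR x : Re (d x) = 0.
  apply: (trig_unique (A := fun x => Re (d x))) => // [j y|p]; first by rewrite lattice_periodic_delta.
  by have [h1 [h2 _]] := key p.
have zI x : Im (d x) = 0.
  apply: (trig_unique (A := fun x => Im (d x))) => // [j y|p]; first by rewrite lattice_periodic_delta.
  by have [_ [_ [h1 h2]]] := key p.
apply/funext => x; apply/eqP; rewrite -subr_eq0 -oppr_eq0 opprB -mulN1r.
by apply/eqP/complex_ext; rewrite ?zR ?zI.
Qed.

End FourierSeries.

(** * Smooth functions on the torus *)

Section Smooth.
Variables (R : realType) (n : nat).
Implicit Types (x : 'rV[R]_n) (j i : 'I_n) (f : 'rV[R]_n -> R) (g h : 'rV[R]_n -> R[i]).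
Local Notation Re := complex.Re.
Local Notation Im := complex.Im.
Local Notation e_ j := (delta_mx ord0 j : 'rV[R]_n).

Lemma rsmooth_continuous f : rsmooth f -> continuous f.
Proof. by move=> /(_ [::])[]. Qed.

Lemma rsmooth_derivable f j x : rsmooth f -> derivable f x (e_ j).
Proof. by move=> /(_ [::])[_]; exact. Qed.

Lemma rsmooth_rpartial f j : rsmooth f -> rsmooth (rpartial j f).
Proof. by move=> sf s; have := sf (rcons s j); rewrite foldr_rcons. Qed.

Lemma rpartialD f1 f2 j : (forall x, derivable f1 x (e_ j)) -> (forall x, derivable f2 x (e_ j)) ->
  rpartial j (fun x => f1 x + f2 x) = (fun x => rpartial j f1 x + rpartial j f2 x).
Proof. by move=> d1 d2; apply/funext => x; exact: (deriveD (d1 x) (d2 x)). Qed.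

Lemma rpartialZ c f j : (forall x, derivable f x (e_ j)) ->
  rpartial j (fun x => c * f x) = (fun x => c * rpartial j f x).
Proof. by move=> d; apply/funext => x; exact: (deriveZ c (d x)). Qed.

Lemma rsmoothD f1 f2 : rsmooth f1 -> rsmooth f2 -> rsmooth (fun x => f1 x + f2 x).
Proof.
move=> s1 s2 s /=.
have -> : foldr rpartial (fun x => f1 x + f2 x) s = (fun x => foldr rpartial f1 s x + foldr rpartial f2 s x).
  elim: s => [//|j s IH] /=; rewrite IH rpartialD //.
    by move=> x; have [_] := s1 s; exact.
  by move=> x; have [_] := s2 s; exact.
have [c1 d1] := s1 s; have [c2 d2] := s2 s; split; first exact: contD.
by move=> j x; exact: (derivableD (d1 j x) (d2 j x)).
Qed.

Lemma rsmoothZ c f : rsmooth f -> rsmooth (fun x => c * f x).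
Proof.
move=> sf s /=.
have -> : foldr rpartial (fun x => c * f x) s = (fun x => c * foldr rpartial f s x).
  elim: s => [//|j s IH] /=; rewrite IH rpartialZ //.
  by move=> x; have [_] := sf s; exact.
have [c1 d1] := sf s; split; first by apply: contM => //; exact: cont_cst.
by move=> j x; exact: (derivableM (derivable_cst c x _) (d1 j x)).
Qed.

Lemma torus_smooth_periodic g : torus_smooth g -> lattice_periodic g.
Proof. by case. Qed.

Lemma torus_smooth_cderiv g j : torus_smooth g -> cderiv j g (cpartial j g).
Proof.
move=> [_ sR sI] x; split.
  exact: (derivableP (rsmooth_derivable sR)).
exact: (derivableP (rsmooth_derivable sI)).
Qed.

Lemma torus_smoothD g h : torus_smooth g -> torus_smooth h -> torus_smooth (fun x => g x + h x).
Proof.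
move=> [pg g1 g2] [ph h1 h2]; split; first by move=> x l; rewrite pg ph.
- have -> : (fun x => Re (g x + h x)) = (fun x => Re (g x) + Re (h x)).
    by apply/funext => x; rewrite cReD.
  exact: (rsmoothD g1 h1).
have -> : (fun x => Im (g x + h x)) = (fun x => Im (g x) + Im (h x)).
  by apply/funext => x; rewrite cImD.
exact: (rsmoothD g2 h2).
Qed.

Lemma torus_smoothZ c g : torus_smooth g -> torus_smooth (fun x => c * g x).
Proof.
move=> [pg g1 g2]; split; first by move=> x l; rewrite pg.
- have -> : (fun x => Re (c * g x)) = (fun x => Re c * Re (g x) + (- Im c) * Im (g x)).
    by apply/funext => x; rewrite cReM mulNr.
  exact: (rsmoothD (rsmoothZ _ g1) (rsmoothZ _ g2)).
have -> : (fun x => Im (c * g x)) = (fun x => Re c * Im (g x) + Im c * Re (g x)).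
  by apply/funext => x; rewrite cImM.
exact: (rsmoothD (rsmoothZ _ g2) (rsmoothZ _ g1)).
Qed.

Lemma rpartial_periodic f j : (forall x (l : 'rV[int]_n), f (x + map_mx intr l) = f x) ->
  forall x (l : 'rV[int]_n), rpartial j f (x + map_mx intr l) = rpartial j f x.
Proof.
move=> pf x l; rewrite /rpartial /derive.
have -> // : (fun s : R => s^-1 *: ((f \o shift (x + map_mx intr l)) (s *: e_ j) - f (x + map_mx intr l))) =
  (fun s : R => s^-1 *: ((f \o shift x) (s *: e_ j) - f x)).
by apply/funext => s /=; rewrite pf addrA pf.
Qed.

Lemma torus_smooth_cpartial g j : torus_smooth g -> torus_smooth (cpartial j g).
Proof.
move=> [pg g1 g2]; split.
- move=> x l; rewrite /cpartial; congr Complex; apply: rpartial_periodic => y l'; by rewrite pg.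
- exact: rsmooth_rpartial.
exact: rsmooth_rpartial.
Qed.

Lemma torus_smooth_Dfact1 g j l : torus_smooth g -> torus_smooth (Dfact1 j l g).
Proof.
move=> sg; elim: l => [//|l IH] /=.
have := torus_smoothD (torus_smoothZ (Complex 0 (2 * pi))^-1 (torus_smooth_cpartial j IH))
  (torus_smoothZ (- l%:R) IH).
by congr torus_smooth; apply/funext => x; rewrite mulNr.
Qed.

Lemma torus_smooth_cbcont g B : torus_smooth g -> (forall x, cabs (g x) <= B) -> cbcont g.
Proof.
by move=> [_ sR sI] gB; apply: cbcontP gB; exact: rsmooth_continuous.
Qed.

Lemma two_pi_i_neq0 : Complex 0 (2 * pi) != 0 :> R[i].
Proof.
apply/eqP => -[] /eqP; rewrite mulf_eq0 pnatr_eq0 /=.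
by rewrite gt_eqF ?pi_gt0.
Qed.

Lemma cpartial_Dfact1 g j l : cpartial j (Dfact1 j l g) =
  (fun x => Complex 0 (2 * pi) * (Dfact1 j l.+1 g x + l%:R * Dfact1 j l g x)).
Proof.
apply/funext => x /=; rewrite subrK mulrA divff ?mul1r //.
exact: two_pi_i_neq0.
Qed.

End Smooth.

Section FourierSeriesSmooth.
Variables (R : realType) (n : nat).
Implicit Types (p : 'rV[int]_n) (x : 'rV[R]_n) (j : 'I_n) (c : 'rV[int]_n -> R[i]).
Local Notation Re := complex.Re.
Local Notation Im := complex.Im.

Lemma torus_smooth_fser c : rapid c -> torus_smooth (fser c : 'rV[R]_n -> R[i]).
Proof.
move=> rc.
pose m (s : seq 'I_n) p := foldr (fun j z => dsymb R j p * z) (c p) s.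
have rm s : rapid (m s) by elim: s => [//|j s IH]; exact: rapid_dsymb.
have derE s j : cderiv j (fser (m s)) (fser (m (j :: s))) by exact: cderiv_fser.
have sR s : foldr rpartial (fun x => Re (fser c x)) s = (fun x => Re (fser (m s) x)).
  elim: s => [//|j s IH] /=; rewrite IH; apply/funext => x.
  by have [d _] := derE s j x; exact: derive_val.
have sI s : foldr rpartial (fun x => Im (fser c x)) s = (fun x => Im (fser (m s) x)).
  elim: s => [//|j s IH] /=; rewrite IH; apply/funext => x.
  by have [_ d] := derE s j x; exact: derive_val.
split; first exact: fser_periodic.
- move=> s; rewrite /= sR; split; first by have [[]] := fser_cbcont (rm s).
  by move=> j x; have [d _] := derE s j x; exact: ex_derive.
move=> s; rewrite /= sI; split; first by have [_ []] := fser_cbcont (rm s).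
by move=> j x; have [_ d] := derE s j x; exact: ex_derive.
Qed.

(** The Fourier multiplier of the falling-factorial derivative [Dfact1 j l]. *)
Definition ffsymb j l p : R[i] := \prod_(0 <= i < l) ((p ord0 j)%:~R - i%:R).

Lemma rapid_ffsymb j l c : rapid c -> rapid (fun p => ffsymb j l p * c p).
Proof.
move=> rc; elim: l => [|l IH] M.
  have [C C0 hC] := rc M; exists C => // p; by rewrite /ffsymb big_geq // mul1r.
have [C C0 hC] := IH M.+1; exists (l.+1%:R * C) => [|p]; first exact: mulr_gt0.
have j0 := jap_gt0 R p; have jM := japX_gt0 R p M.
have -> : l.+1%:R * C * jap R p ^- M = (l.+1%:R * jap R p) * (C * jap R p ^- M.+1).
  by rewrite exprSr; field; rewrite !gt_eqF.
rewrite /ffsymb big_nat_recr //= -/(ffsymb j l p) mulrAC mulrC cabsM.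
rewrite ler_pM ?cabs_ge0 ?hC // (le_trans (cabsB _ _)) // cabs_intr cabs_natr.
have := jap_coord R p j; have := jap_ge1 R p; have : (0 : R) <= l%:R by [].
rewrite -natr1; nra.
Qed.

Lemma Dfact1_fser j l c : rapid c -> Dfact1 j l (fser c : 'rV[R]_n -> R[i]) = fser (fun p => ffsymb j l p * c p).
Proof.
move=> rc; elim: l => [|l IH].
  by congr fser; apply/funext => p; rewrite /ffsymb big_geq // mul1r.
apply/funext => x; rewrite /= IH (cderivE (cderiv_fser j (rapid_ffsymb j l rc))).
have rf := rapid_ffsymb j l rc; have rd := rapid_dsymb j rf.
have s1 := fser_summable x rd; have s2 := fser_summable x rf.
rewrite /fser -!csumZ // -csumN; last exact: abs_summableZ.
rewrite -csumD; last 2 first.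
- exact: abs_summableZ.
- have := abs_summableZ (-1) (abs_summableZ l%:R s2); congr abs_summable.
  by apply/funext => p; rewrite mulN1r.
congr csum; apply/funext => p; rewrite /ffsymb big_nat_recr //= /dsymb -!mulrA.
by rewrite mulrA mulVf ?two_pi_i_neq0 // mul1r; ring.
Qed.

Lemma Dfact_fser (b : 'I_n -> nat) c : rapid c ->
  exists c' : 'rV[int]_n -> R[i], [/\ rapid c', Dfact b (fser c : 'rV[R]_n -> R[i]) = fser c' &
    c' = (fun p => (\prod_j ffsymb j (b j) p) * c p)].
Proof.
rewrite /Dfact => rc; elim: (index_enum 'I_n) => [|j r [c' [rc' IH E]]].
  by exists c; rewrite big_nil; split => //; apply/funext => p; rewrite big_nil mul1r.
exists (fun p => ffsymb j (b j) p * c' p); split; first exact: rapid_ffsymb.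
  by rewrite comp_big_cons IH Dfact1_fser.
by apply/funext => p; rewrite E big_cons mulrA.
Qed.

End FourierSeriesSmooth.

(** * From bounds on derivatives to decay of coefficients *)

Section SymbolDerivatives.
Variables (R : realType) (n : nat) (Lam : 'rV[int]_n -> R).
Hypothesis Lam_mod : moderate Lam.
Implicit Types (p k : 'rV[int]_n) (x : 'rV[R]_n) (j : 'I_n) (m : R) (s : symbol R n).
Local Notation jap := (@jap R n).

Definition sbounded m s := (forall k, cbcont (s k) /\ lattice_periodic (s k)) /\
  exists2 C : R, 0 < C & forall k x, cabs (s k x) <= C * Lam k `^ m.

(** Derivatives in a single direction [j] are what decay in [p_j] requires. *)
Fixpoint derivs_upto j l m s : Prop := sbounded m s /\
  if l is l'.+1 then exists ds : symbol R n,
    (forall k, cderiv j (s k) (ds k)) /\ derivs_upto j l' m ds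
  else True.

Lemma derivs_upto_bounded j l m s : derivs_upto j l m s -> sbounded m s.
Proof. by case: l => [|l] []. Qed.

Lemma derivs_upto_pred j l m s : derivs_upto j l.+1 m s -> derivs_upto j l m s.
Proof.
elim: l s => [|l IH] s [sb [ds [D dds]]]; split => //.
by exists ds; split => //; exact: IH.
Qed.

Lemma sboundedM m m' s t : sbounded m s -> sbounded m' t ->
  sbounded (m + m') (fun k x => s k x * t k x).
Proof.
move=> [s1 [C C0 hC]] [t1 [D D0 hD]]; split.
  move=> k; have [cs ps] := s1 k; have [ct pt] := t1 k.
  by split; [exact: cbcontM|exact: lattice_periodicM].
exists (C * D) => [|k x]; first exact: mulr_gt0.
rewrite cabsM (LamXD Lam_mod) mulrACA; apply: ler_pM; rewrite ?cabs_ge0 //.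
Qed.

Lemma sboundedD m s t : sbounded m s -> sbounded m t ->
  sbounded m (fun k x => s k x + t k x).
Proof.
move=> [s1 [C C0 hC]] [t1 [D D0 hD]]; split.
  move=> k; have [cs ps] := s1 k; have [ct pt] := t1 k.
  by split; [exact: cbcontD|move=> x l; rewrite ps pt].
exists (C + D) => [|k x]; first exact: addr_gt0.
by rewrite (le_trans (cabsD _ _)) // mulrDl lerD.
Qed.

Lemma sbounded_cst c : sbounded 0 (fun _ _ => c).
Proof.
split; first by move=> k; split; [exact: cbcont_cst|].
exists (cabs c + 1) => [|k x]; first by rewrite ltr_wpDl ?cabs_ge0.
by rewrite powRr0 mulr1 lerDl.
Qed.

Lemma derivs_uptoD j l m s t : derivs_upto j l m s -> derivs_upto j l m t ->
  derivs_upto j l m (fun k x => s k x + t k x).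
Proof.
elim: l s t => [|l IH] s t [s1 s2] [t1 t2]; split => //; try exact: sboundedD.
have [ds [Ds hs]] := s2; have [dt [Dt ht]] := t2.
exists (fun k x => ds k x + dt k x); split; last exact: IH.
by move=> k; exact: cderivD.
Qed.

Lemma derivs_upto_cst j l c : derivs_upto j l 0 (fun _ _ => c).
Proof.
elim: l c => [|l IH] c; split => //; try exact: sbounded_cst.
exists (fun _ _ => 0); split => // k; exact: cderiv_cst.
Qed.

Lemma derivs_uptoM j l m m' s t : derivs_upto j l m s -> derivs_upto j l m' t ->
  derivs_upto j l (m + m') (fun k x => s k x * t k x).
Proof.
elim: l m m' s t => [|l IH] m m' s t hs ht; split; try exact: sboundedM (derivs_upto_bounded hs) (derivs_upto_bounded ht).
  by [].
have [_ [ds [Ds hds]]] := hs; have [_ [dt [Dt hdt]]] := ht.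
exists (fun k x => ds k x * t k x + s k x * dt k x); split.
  by move=> k; exact: cderivM.
by apply: derivs_uptoD; apply: IH => //; exact: derivs_upto_pred.
Qed.

(** By induction from [(1 / s)' = - s' / s ^ 2], where [s'] is bounded like
    [s] and the lower bound on [s] controls the inverse. *)
Lemma derivs_upto_reciprocal j l m s c : 0 < c -> (forall k x, c * Lam k `^ m <= cabs (s k x)) ->
  (forall l, derivs_upto j l m s) -> derivs_upto j l (- m) (fun k x => (s k x)^-1).
Proof.
move=> c0 low hs; have s0 k x : s k x != 0.
  by rewrite -cabs_gt0; apply: lt_le_trans (low k x); rewrite mulr_gt0 // (LamX_gt0 Lam_mod).
have bV : sbounded (- m) (fun k x => (s k x)^-1).
  have B k x : cabs (s k x)^-1 <= c^-1 * Lam k `^ (- m).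
    rewrite cabsV powRN -invfM lef_pV2 ?posrE ?cabs_gt0 ?s0 ?mulr_gt0 ?(LamX_gt0 Lam_mod) //.
  split=> [k|]; last by exists c^-1; rewrite ?invr_gt0.
  have [/(_ k)[cs ps] _] := derivs_upto_bounded (hs 0%N).
  split; last by move=> x y; rewrite ps.
  have [[cR bR] [cI bI]] := cs.
  have cN : continuous (fun x => (complex.Re (s k x) ^+ 2 + complex.Im (s k x) ^+ 2)^-1).
    have N0 x : complex.Re (s k x) ^+ 2 + complex.Im (s k x) ^+ 2 != 0.
      rewrite paddr_eq0 ?sqr_ge0 // !sqrf_eq0; apply: contra (s0 k x) => /andP[/eqP a /eqP b].
      by apply/eqP/complex_ext.
    move=> x; apply: (@cvgV _ _ (nbhs x) (nbhs_filter x)) => //.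
    exact: (contD (contM cR cR) (contM cI cI)).
  have E x : (s k x)^-1 = Complex (complex.Re (s k x) * (complex.Re (s k x) ^+ 2 + complex.Im (s k x) ^+ 2)^-1)
      (- (complex.Im (s k x) * (complex.Re (s k x) ^+ 2 + complex.Im (s k x) ^+ 2)^-1)).
    by case: (s k x).
  apply: cbcontP (B k).
    have -> : (fun x => complex.Re (s k x)^-1) = (fun x => complex.Re (s k x) *
       (complex.Re (s k x) ^+ 2 + complex.Im (s k x) ^+ 2)^-1).
      by apply/funext => x; rewrite E.
    exact: contM.
  have -> : (fun x => complex.Im (s k x)^-1) = (fun x => - (complex.Im (s k x) *
       (complex.Re (s k x) ^+ 2 + complex.Im (s k x) ^+ 2)^-1)).
    by apply/funext => x; rewrite E.
  by apply: contN; exact: contM.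
elim: l => [|l IH]; split => //.
have [_ [ds [Ds hds]]] := hs l.+1.
exists (fun k x => (-1) * ((s k x)^-1 * (s k x)^-1) * ds k x); split.
  move=> k; have := cderivV (s0 k) (Ds k); congr (cderiv j _ _).
  by apply/funext => x; ring.
have -> : - m = (0 + (- m + - m)) + m by ring.
apply: derivs_uptoM => //; apply: derivs_uptoM; first exact: derivs_upto_cst.
exact: derivs_uptoM.
Qed.

Definition fcoefs s : 'rV[int]_n -> 'rV[int]_n -> R[i] := fun k p => fcoef (s k) p.

Lemma derivs_upto_fcoefs j l m s : derivs_upto j l m s -> exists2 C : R, 0 < C &
  forall k p, `|(p ord0 j)%:~R : R| ^+ l * cabs (fcoefs s k p) <= C * Lam k `^ m.
Proof.
elim: l s => [|l IH] s hs.
  have [[cs [C C0 hC]] _] := hs; exists (C *+ 2) => [|k p]; first by rewrite pmulrn_lgt0.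
  rewrite expr0 mul1r mulrnAl; apply: fcoef_norm => //; exact: (proj1 (cs k)).
have [[cs _] [ds [Ds hds]]] := hs; have [C C0 hC] := IH ds hds.
have pi0 := pi_gt0 R; exists (C / (2 * pi)) => [|k p].
  by rewrite divr_gt0 // mulr_gt0.
have [ck pk] := cs k; have [/(_ k)[cdk _] _] := derivs_upto_bounded hds.
have := hC k p; rewrite /fcoefs (fcoef_cderiv p ck cdk pk (Ds k)) cabsM /dsymb cabsM.
rewrite cabs_imag cabs_intr (@ger0_norm _ (2 * pi)) ?mulr_ge0 ?(ltW pi0) // => h.
rewrite mulrAC ler_pdivlMr ?mulr_gt0 //; apply: le_trans h.
by rewrite exprSr le_eqVlt; apply/orP; left; apply/eqP; ring.
Qed.

(** The largest coordinate dominates [jap p] up to a factor, so decay in each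
    [p_j] separately gives decay in [jap p]. *)
Lemma jap_le_coord p : jap p <= n.+1%:R \/ exists j, jap p <= n.+1%:R * `|(p ord0 j)%:~R : R|.
Proof.
apply: contrapT => /not_orP[/negP h1 /forallNP h2]; rewrite -ltNge in h1.
have h3 j : `|(p ord0 j)%:~R : R| <= jap p / n.+1%:R.
  by rewrite ler_pdivlMr ?ltr0n // mulrC; apply/ltW; rewrite ltNge; apply/negP; exact: h2.
have : jap p < jap p / n.+1%:R + \sum_(j < n) jap p / n.+1%:R.
  rewrite {1}/jap -natr1 addrC; apply: ltr_leD.
    by rewrite ltr_pdivlMr ?ltr0n // mul1r.
  rewrite /len1 natr_sum; apply: ler_sum => j _.
  by rewrite pmulrn abszE intr_norm.
rewrite sumr_const card_ord -mulrS -[_ *+ n.+1]mulr_natr divfK ?ltxx //.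
Qed.

(** [M] integrations by parts in the direction of the largest coordinate of
    [p]. *)
Lemma has_order_fcoefs m s : sbounded m s -> (forall j l, derivs_upto j l m s) ->
  has_order Lam m (fcoefs s).
Proof.
move=> sb hs M.
have [cs [B B0 hB]] := sb.
have /choice [C hC] : forall j, exists C : R, 0 < C /\ forall k p,
    `|(p ord0 j)%:~R : R| ^+ M * cabs (fcoefs s k p) <= C * Lam k `^ m.
  by move=> j; have [C C0 h] := derivs_upto_fcoefs (hs j M); exists C.
have S0 : 0 <= \sum_j C j by apply: sumr_ge0 => j _; have [/ltW] := hC j.
have N0 : (0 : R) < n.+1%:R ^+ M by rewrite exprn_gt0.
exists (n.+1%:R ^+ M * (B *+ 2 + \sum_j C j)) => [|k p].
  by rewrite mulr_gt0 // ltr_pwDl // pmulrn_lgt0.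
have L0 := LamX_gt0 Lam_mod m k.
have f0 : cabs (fcoefs s k p) <= B *+ 2 * Lam k `^ m.
  rewrite mulrnAl; apply: fcoef_norm => //; exact: (proj1 (cs k)).
rewrite ler_pdivlMr ?japX_gt0 // mulrC.
have [h|[j h]] := jap_le_coord p.
  apply: (@le_trans _ _ (n.+1%:R ^+ M * (B *+ 2 * Lam k `^ m))).
    apply: ler_pM; rewrite ?cabs_ge0 ?exprn_ge0 ?jap_ge0 //.
    by rewrite lerXn2r ?nnegrE ?jap_ge0.
  rewrite -mulrA ler_pM2l // ler_pM2r // lerDl //.
apply: (@le_trans _ _ (n.+1%:R ^+ M * (C j * Lam k `^ m))).
  have [_ /(_ k p) hj] := hC j.
  apply: (@le_trans _ _ (n.+1%:R ^+ M * (`|(p ord0 j)%:~R : R| ^+ M * cabs (fcoefs s k p)))).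
    rewrite mulrA -exprMn; apply: ler_pM; rewrite ?cabs_ge0 ?exprn_ge0 ?jap_ge0 //.
    by rewrite lerXn2r ?nnegrE ?jap_ge0 ?mulr_ge0.
  by rewrite ler_pM2l.
rewrite -[leRHS]mulrA ler_pM2l // ler_pM2r // (bigD1 j) //= addrCA lerDl addr_ge0 //.
  by rewrite mulrn_wge0 // ltW.
by apply: sumr_ge0 => i _; have [/ltW] := hC i.
Qed.

(** The falling-factorial derivatives [Dfact1] and the ordinary ones generate
    each other ([cpartial_Dfact1]). *)
Lemma Dfact1_derivs_upto j m s : (forall k, torus_smooth (s k)) ->
  (forall l, exists2 C : R, 0 < C & forall k x, cabs (Dfact1 j l (s k) x) <= C * Lam k `^ m) ->
  forall l, derivs_upto j l m s.
Proof.
move=> sm hs.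
have sb l0 : sbounded m (fun k => Dfact1 j l0 (s k)).
  have [C C0 hC] := hs l0; split; last by exists C.
  move=> k; have t := torus_smooth_Dfact1 j l0 (sm k); split.
    exact: torus_smooth_cbcont t (hC k).
  exact: torus_smooth_periodic.
suff h l l0 : derivs_upto j l m (fun k => Dfact1 j l0 (s k)) by move=> l; exact: (h l 0%N).
elim: l l0 => [|l IH] l0; split => //.
exists (fun k => cpartial j (Dfact1 j l0 (s k))); split.
  by move=> k; apply: torus_smooth_cderiv; exact: torus_smooth_Dfact1.
have -> : (fun k => cpartial j (Dfact1 j l0 (s k))) =
   (fun k x => Complex 0 (2 * pi) * (Dfact1 j l0.+1 (s k) x + l0%:R * Dfact1 j l0 (s k) x)).
  by apply/funext => k; rewrite cpartial_Dfact1.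
have Z c t : derivs_upto j l m t -> derivs_upto j l m (fun k x => c * t k x).
  by move=> ht; rewrite -(add0r m); apply: derivs_uptoM => //; exact: derivs_upto_cst.
exact: (Z _ _ (derivs_uptoD (IH l0.+1) (Z _ _ (IH l0)))).
Qed.

End SymbolDerivatives.

(** * Symbols of class M and their coefficient arrays *)

Lemma comp_big_morph_in (T U : Type) (I : eqType) (P : T -> Prop) (F : I -> T -> T)
    (G : I -> U -> U) (h : T -> U) (r : seq I) :
  (forall i x, P x -> P (F i x) /\ h (F i x) = G i (h x)) ->
  forall x, P x -> P ((\big[comp/idfun]_(j <- r) F j) x) /\
    h ((\big[comp/idfun]_(j <- r) F j) x) = (\big[comp/idfun]_(j <- r) G j) (h x).
Proof.
move=> FG x Px; elim: r => [|i r [IH1 IH2]]; first by rewrite !big_nil.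
rewrite !comp_big_cons; have [h1 h2] := FG i _ IH1.
by rewrite h2 IH2.
Qed.

Lemma iter_morph_in (T U : Type) (P : T -> Prop) (F : T -> T) (G : U -> U) (h : T -> U) l :
  (forall x, P x -> P (F x) /\ h (F x) = G (h x)) ->
  forall x, P x -> P (iter l F x) /\ h (iter l F x) = iter l G (h x).
Proof.
move=> FG x Px; elim: l => [//|l [IH1 IH2]] /=.
by have [h1 h2] := FG _ IH1; rewrite h2 IH2.
Qed.

Section Differences.
Variables (V : zmodType) (n : nat).
Implicit Types (f : 'rV[int]_n -> V) (j i : 'I_n) (a : 'I_n -> nat).

Lemma diff1C i j f : diff1 i (diff1 j f) = diff1 j (diff1 i f).
Proof.
apply/funext => k; rewrite /diff1 !opprB [k + _ + _]addrAC.
by rewrite addrACA [RHS]addrACA; congr (_ + _); rewrite addrC.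
Qed.

Lemma diff1_iter i j l f : diff1 j (iter l (diff1 i) f) = iter l (diff1 i) (diff1 j f).
Proof. by elim: l => [//|l IH] /=; rewrite diff1C IH. Qed.

Lemma diffm_step j a f : diff1 j (diffm a f) = diffm (fun i => a i + (i == j))%N f.
Proof.
rewrite /diffm; have jI : j \in index_enum 'I_n by exact: mem_index_enum.
elim: (index_enum _) (index_enum_uniq 'I_n) jI => [//|i r IH] /= /andP[ir ur].
rewrite inE !comp_big_cons; have [->|ij /= jr] := eqVneq j i.
  move=> _; rewrite addn1 iterS; congr (diff1 _ (iter _ _ _)).
  have : {subset r <= predC1 i} by move=> l lr; apply: contraNneq ir => <-.
  elim: r {IH ir ur} => [|l r IH] sub; first by rewrite !big_nil.
  rewrite !comp_big_cons IH; last by move=> u ur; apply: sub; rewrite inE ur orbT.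
  by have := sub l; rewrite inE eqxx => /(_ isT); rewrite /= inE => /negbTE ->; rewrite addn0.
by rewrite addn0 diff1_iter IH.
Qed.

Lemma diffm0 f : diffm (fun=> 0%N) f = f.
Proof.
rewrite /diffm; elim: (index_enum _) => [|i r IH]; first by rewrite big_nil.
by rewrite comp_big_cons IH.
Qed.

End Differences.

Section MonomialDifferences.
Variables (R : realType) (n : nat).
Implicit Types (f : 'rV[int]_n -> R[i]) (j i : 'I_n) (g : 'I_n -> bool).

Definition kdiff1 j f : 'rV[int]_n -> R[i] := fun k => (k ord0 j)%:~R * diff1 j f k.

(** The monomial [k^g] may be distributed over the differences, one factor
    [k_j] in front of each [Delta_j], as [g] takes values in {0,1}. *)
Lemma monomial_diffm g f k : monomial k g * diffm g f k =
  (\big[comp/idfun]_(j < n) (if g j then kdiff1 j else idfun)) f k.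
Proof.
rewrite /monomial /diffm; elim: (index_enum _) (index_enum_uniq 'I_n) k => [|j r IH] /=.
  by move=> _ k; rewrite !big_nil mul1r.
case/andP => jr ur k; rewrite !comp_big_cons big_cons.
case: (g j) => /=; last by rewrite mul1r IH.
rewrite /kdiff1 /diff1 -!(IH ur) expr1 -mulrA; congr (_ * _).
rewrite mulrBr; congr (_ * _ - _); rewrite [LHS]big_seq [RHS]big_seq.
apply: eq_bigr => i ir; rewrite !mxE eqxx /=.
have -> : (i == j) = false by apply: contraNF jr => /eqP <-.
by rewrite addr0.
Qed.

End MonomialDifferences.

Section ClassM.
Variables (R : realType) (n : nat) (Lam : 'rV[int]_n -> R) (rho : R).
Hypothesis Lam_mod : moderate Lam.
Implicit Types (p k : 'rV[int]_n) (x : 'rV[R]_n) (j i : 'I_n) (m : R) (s : symbol R n).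
Implicit Types (a b : 'I_n -> nat) (g : 'I_n -> bool).
Local Notation coef := ('rV[int]_n -> 'rV[int]_n -> R[i]).
Implicit Types (t : coef).
Local Notation jap := (@jap R n).

Definition sdiff j s : symbol R n := fun k x => s (k + delta_mx ord0 j) x - s k x.

Lemma symbol_diffE a s : symbol_diff a s = (\big[comp/idfun]_(j < n) iter (a j) (sdiff j)) s.
Proof.
apply/funext => k; apply/funext => x; rewrite /symbol_diff /diffm.
have := @comp_big_morph (symbol R n) ('rV[int]_n -> R[i]) 'I_n (fun j => iter (a j) (sdiff j))
  (fun j => iter (a j) (diff1 j)) (fun s l => s l x) (index_enum 'I_n).
move=> <- // i u; by elim: (a i) => [//|l /= <-].
Qed.

Lemma sdiff_symbol_diff j a s : sdiff j (symbol_diff a s) = symbol_diff (fun i => a i + (i == j))%N s.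
Proof.
apply/funext => k; apply/funext => x; rewrite [RHS]/symbol_diff -diffm_step.
by [].
Qed.

Lemma symbol_diff0 s : symbol_diff (fun=> 0%N) s = s.
Proof. by apply/funext => k; apply/funext => x; rewrite /symbol_diff diffm0. Qed.

Lemma symbol_diff_torus_smooth a s : (forall k, torus_smooth (s k)) ->
  forall k, torus_smooth (symbol_diff a s k).
Proof.
move=> sm; rewrite symbol_diffE; apply: (proj1 (@comp_big_morph_in (symbol R n) unit 'I_n
  (fun s => forall k, torus_smooth (s k)) (fun j => iter (a j) (sdiff j)) (fun _ _ => tt) (fun=> tt)
  (index_enum 'I_n) _ s sm)) => j u su; split; last by [].
apply: (proj1 (@iter_morph_in (symbol R n) unit (fun s => forall k, torus_smooth (s k)) (sdiff j)
  (fun=> tt) (fun=> tt) (a j) _ u su)) => v sv; split; last by [].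
move=> k; have := torus_smoothD (sv (k + delta_mx ord0 j)) (torus_smoothZ (-1) (sv k)).
by congr torus_smooth; apply/funext => x; rewrite mulN1r.
Qed.

Lemma fcoefB (h1 h2 : 'rV[R]_n -> R[i]) p : cbcont h1 -> cbcont h2 ->
  fcoef (fun x => h1 x - h2 x) p = fcoef h1 p - fcoef h2 p.
Proof.
move=> c1 c2; have cc := character_cbcont R (- p).
rewrite /fcoef -mulN1r -torus_intZ; last exact: cbcontM.
rewrite -torus_intD; last 2 first.
- exact: cbcontM.
- by apply: cbcontM; [exact: cbcont_cst|exact: cbcontM].
by congr torus_int; apply/funext => x; ring.
Qed.

Lemma sdiff_cbcont j s : (forall k, cbcont (s k)) -> forall k, cbcont (sdiff j s k).
Proof. by move=> cs k; apply: cbcontD => //; exact: cbcontN. Qed.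

Lemma fcoefs_sdiff j s : (forall k, cbcont (s k)) -> fcoefs (sdiff j s) = diffk j (fcoefs s).
Proof.
by move=> cs; apply/funext => k; apply/funext => p; rewrite /fcoefs fcoefB.
Qed.

(** Differences in [k] commute with taking Fourier coefficients in [x]. *)
Lemma symbol_diff_fcoefs a s : (forall k, cbcont (s k)) ->
  (forall k, cbcont (symbol_diff a s k)) /\
  forall k p, fcoef (symbol_diff a s k) p = diffm a (fun l => fcoef (s l) p) k.
Proof.
move=> cs; have key p : (forall k, cbcont (symbol_diff a s k)) /\
    (fun k => fcoef (symbol_diff a s k) p) = diffm a (fun l => fcoef (s l) p).
  rewrite symbol_diffE.
  apply: (@comp_big_morph_in (symbol R n) ('rV[int]_n -> R[i]) 'I_n (fun s => forall k, cbcont (s k))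
    (fun j => iter (a j) (sdiff j)) (fun j => iter (a j) (diff1 j)) (fun s k => fcoef (s k) p)) => // j u cu.
  apply: (@iter_morph_in (symbol R n) ('rV[int]_n -> R[i]) (fun s => forall k, cbcont (s k))
    (sdiff j) (diff1 j) (fun s k => fcoef (s k) p)) => // v cv; split; first exact: sdiff_cbcont.
  by apply/funext => k; rewrite fcoefB.
split; first by have [] := key 0.
by move=> k p; have [_ /(congr1 (@^~ k))] := key p.
Qed.

Lemma mlength_step a j : mlength (fun i => a i + (i == j))%N = (mlength a).+1.
Proof.
have one : (\sum_(i < n) (i == j) = 1)%N by rewrite (bigD1 j) //= eqxx big1 // => i /negbTE ->.
by rewrite /mlength big_split /= one addn1.
Qed.

Lemma Dfact_single j l (h : 'rV[R]_n -> R[i]) :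
  Dfact (fun i => if i == j then l else 0%N) h = Dfact1 j l h.
Proof.
rewrite /Dfact (@comp_big_single _ _ _ _ j) ?index_enum_uniq // => [|i ij].
  by rewrite mem_index_enum eqxx.
by rewrite (negbTE ij); apply/funext.
Qed.

Lemma Dfact0 (h : 'rV[R]_n -> R[i]) : Dfact (fun=> 0%N) h = h.
Proof.
rewrite /Dfact; elim: (index_enum _) => [|i r IH]; first by rewrite big_nil.
by rewrite comp_big_cons IH.
Qed.

Lemma S_class_sbounded m s : S_class Lam rho m s -> sbounded Lam m s.
Proof.
move=> [sm sS]; have [C C0] := sS (fun=> 0%N) (fun=> 0%N).
have -> : mlength (fun _ : 'I_n => 0%N) = 0%N by rewrite /mlength big1.
rewrite symbol_diff0 mulr0 subr0 => hC.
have {}hC k x : cabs (s k x) <= C * Lam k `^ m by have := hC k x; rewrite Dfact0.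
split; last by exists C.
move=> k; split; last exact: torus_smooth_periodic.
exact: torus_smooth_cbcont (sm k) (hC k).
Qed.

Lemma S_class_derivs_upto m s a : S_class Lam rho m s ->
  [/\ forall k, torus_smooth (symbol_diff a s k),
      sbounded Lam (m - rho * (mlength a)%:R) (symbol_diff a s) &
      forall j l, derivs_upto Lam j l (m - rho * (mlength a)%:R) (symbol_diff a s)].
Proof.
move=> sS; have [sm bS] := sS; have sma := symbol_diff_torus_smooth a sm.
have csm := fun k => proj1 (proj1 (S_class_sbounded sS) k).
split=> //.
  have [C C0 hC] := bS a (fun=> 0%N); split.
    by move=> k; split; [have [] := symbol_diff_fcoefs a csm|exact/torus_smooth_periodic].
  by exists C => // k x; have := hC k x; rewrite Dfact0.
move=> j; apply: (Dfact1_derivs_upto Lam_mod sma) => l.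
have [C C0 hC] := bS a (fun i => if i == j then l else 0%N).
by exists C => // k x; have := hC k x; rewrite Dfact_single.
Qed.

Lemma mlength0 : mlength (fun _ : 'I_n => 0%N) = 0%N.
Proof. by rewrite /mlength big1. Qed.

Lemma S_class_symb m s N : S_class Lam rho m s -> symb_upto Lam rho N m (fcoefs s).
Proof.
move=> sS; have csm := fun k => proj1 (proj1 (S_class_sbounded sS) k).
suff h : forall a, symb_upto Lam rho N (m - rho * (mlength a)%:R) (fcoefs (symbol_diff a s)).
  by have := h (fun=> 0%N); rewrite symbol_diff0 mlength0 mulr0 subr0.
have base a : has_order Lam (m - rho * (mlength a)%:R) (fcoefs (symbol_diff a s)).
  by have [_ hs hd] := S_class_derivs_upto a sS; exact: has_order_fcoefs hs hd.
elim: N => [|N IH] a; split; [exact: base|by []|exact: base|move=> j].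
rewrite -fcoefs_sdiff; last by have [] := symbol_diff_fcoefs a csm.
rewrite sdiff_symbol_diff; have := IH (fun i => a i + (i == j))%N.
by rewrite mlength_step -natr1 mulrDr mulr1 opprD addrA.
Qed.

Definition kdiff j t : coef := mulk j (diffk j t).

Lemma kdiffC i j t : kdiff i (kdiff j t) = kdiff j (kdiff i t).
Proof.
have [->//|ij] := eqVneq i j; rewrite /kdiff !diffk_mulk (negbTE ij) eq_sym (negbTE ij) !addr0.
rewrite diffkC; apply/funext => k; apply/funext => p; exact: mulrCA.
Qed.

(** The recursive class [mclass] is recovered from the estimates on all
    products of the commuting operators [kdiff j]. *)
Lemma kdiff_words_mclass r m t : uniq r ->
  (forall g, mclass Lam rho [::] m ((\big[comp/idfun]_(j <- r) (if g j then kdiff j else idfun)) t)) ->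
  mclass Lam rho r m t.
Proof.
elim: r t => [|j r IH] t /=; first by move=> _ /(_ (fun=> true)); rewrite big_nil.
case/andP => jr ur ht; have off c g u : u \in r -> (if u == j then c else g u) = g u.
  by move=> ru; case: eqP => // uj; rewrite uj (negbTE jr) in ru.
split; apply: IH => // g.
  have := ht (fun i => if i == j then false else g i); rewrite comp_big_cons eqxx.
  by under eq_big_seq => u ur' do rewrite off //.
have := ht (fun i => if i == j then true else g i); rewrite comp_big_cons eqxx.
under eq_big_seq => u ur' do rewrite off //.
rewrite (@comp_big_commute _ _ _ r (kdiff j)) //.
by move=> i u; case: (g i) => //; exact: kdiffC.
Qed.

Lemma mclass_kdiff_words r m t g : mclass Lam rho r m t ->
  mclass Lam rho [::] m ((\big[comp/idfun]_(j <- r) (if g j then kdiff j else idfun)) t).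
Proof.
elim: r t => [|j r IH] t /=; first by rewrite big_nil.
case=> t1 t2; rewrite comp_big_cons; case: (g j); last exact: IH.
rewrite (@comp_big_commute _ _ _ r (kdiff j)); first exact: IH.
by move=> i u; case: (g i) => //; exact: kdiffC.
Qed.

Lemma kdiff_eval p g t k :
  (\big[comp/idfun]_(j < n) (if g j then kdiff j else idfun)) t k p =
  (\big[comp/idfun]_(j < n) (if g j then kdiff1 j else idfun)) (fun l => t l p) k.
Proof.
have := @comp_big_morph coef ('rV[int]_n -> R[i]) 'I_n (fun j => if g j then kdiff j else idfun)
  (fun j => if g j then kdiff1 j else idfun) (fun t l => t l p) (index_enum 'I_n).
by move=> /(_ _ t)/(congr1 (@^~ k)) -> // i u; case: (g i).
Qed.

Lemma M_class_S_class m s : M_class Lam rho m s -> S_class Lam rho m s.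
Proof.
move=> [_ /(_ (fun=> false))]; congr S_class; apply/funext => k; apply/funext => x.
rewrite /monomial big1 ?mul1r; last by move=> i _; rewrite expr0.
by rewrite -[X in symbol_diff X](_ : (fun=> 0%N) = _) // symbol_diff0.
Qed.

Lemma M_class_mclass m s : M_class Lam rho m s -> mclass Lam rho (index_enum 'I_n) m (fcoefs s).
Proof.
move=> sMc; have [_ sM] := sMc; apply: kdiff_words_mclass => [|g N]; first exact: index_enum_uniq.
have cs := fun k => proj1 (proj1 (S_class_sbounded (M_class_S_class sMc)) k).
have -> : (\big[comp/idfun]_(j <- index_enum 'I_n) (if g j then kdiff j else idfun)) (fcoefs s) =
    fcoefs (fun k x => monomial k g * symbol_diff g s k x).
  apply/funext => k; apply/funext => p; rewrite kdiff_eval -monomial_diffm /fcoefs.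
  have [cd fd] := symbol_diff_fcoefs g cs.
  rewrite -fd /fcoef -torus_intZ; last by apply: cbcontM => //; exact: character_cbcont.
  by congr torus_int; apply/funext => x; rewrite mulrCA.
exact: S_class_symb.
Qed.

(** ** From coefficient arrays back to symbols *)

Definition fsymbol t : symbol R n := fun k x => fser (t k) x.

Lemma has_order_rapid m t k : has_order Lam m t -> rapid (t k).
Proof.
move=> ot M; have [C C0 hC] := ot M; exists (C * Lam k `^ m) => //.
by rewrite mulr_gt0 // LamX_gt0.
Qed.

Lemma fserB (c c' : 'rV[int]_n -> R[i]) x : rapid c -> rapid c' ->
  fser (c - c') x = fser c x - fser c' x.
Proof.
move=> rc rc'; have s1 := fser_summable x rc; have s2 := fser_summable x rc'.
rewrite /fser -csumN // -csumD //.
  by congr csum; apply/funext => p; rewrite -mulrBl.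
by have := abs_summableZ (-1) s2; congr abs_summable; apply/funext => p; rewrite mulN1r.
Qed.

Lemma symb_upto_diffm m t r a : (forall N, symb_upto Lam rho N m t) ->
  forall N, symb_upto Lam rho N (m - rho * (\sum_(j <- r) a j)%:R)
    ((\big[comp/idfun]_(j <- r) iter (a j) (diffk j)) t).
Proof.
move=> st; elim: r => [|j r IH].
  by move=> N; rewrite !big_nil mulr0 subr0.
move=> N; rewrite comp_big_cons big_cons natrD mulrDr opprD [- _ - _]addrC addrA.
elim: (a j) N => [|l IHl] N; first by rewrite mulr0 subr0.
by have [_ /(_ j)] := IHl N.+1; rewrite -natr1 mulrDr mulr1 opprD addrA.
Qed.

Lemma symbol_diff_fsymbol m t a : has_order Lam m t ->
  symbol_diff a (fsymbol t) = fsymbol ((\big[comp/idfun]_(j < n) iter (a j) (diffk j)) t).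
Proof.
move=> ot; apply/funext => k; apply/funext => x; rewrite /symbol_diff /diffm.
rewrite -(proj2 (@comp_big_morph_in coef ('rV[int]_n -> R[i]) 'I_n (fun t => has_order Lam m t)
  (fun j => iter (a j) (diffk j)) (fun j => iter (a j) (diff1 j)) (fun t l => fser (t l) x)
  (index_enum 'I_n) _ t ot)) // => j u ou.
apply: (@iter_morph_in coef _ (fun t => has_order Lam m t) (diffk j) (diff1 j)
  (fun t l => fser (t l) x)) => // v ov; split; first exact: has_order_diffk.
apply/funext => l; apply: fserB; exact: has_order_rapid ov.
Qed.

Lemma ffsymb_bound j l : exists2 K : R, 0 < K & forall p, cabs (ffsymb R j l p) <= K * jap p ^+ l.
Proof.
elim: l => [|l [K K0 hK]].
  by exists 1 => // p; rewrite /ffsymb big_geq // cabs1 mulr1.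
exists (K * l.+1%:R) => [|p]; first exact: mulr_gt0.
rewrite /ffsymb big_nat_recr //= -/(ffsymb R j l p) cabsM exprSr.
rewrite mulrACA; apply: ler_pM; rewrite ?cabs_ge0 //.
rewrite (le_trans (cabsB _ _)) // cabs_intr cabs_natr.
have := jap_coord R p j; have := jap_ge1 R p; have : (0 : R) <= l%:R by [].
rewrite -natr1; nra.
Qed.

Lemma ffsymb_prod_bound b : exists2 K : R, 0 < K & exists D : nat, forall p,
  cabs (\prod_j ffsymb R j (b j) p) <= K * jap p ^+ D.
Proof.
elim: (index_enum _) => [|j r [K K0 [D hD]]].
  by exists 1 => //; exists 0%N => p; rewrite big_nil cabs1 mulr1.
have [K' K'0 hK'] := ffsymb_bound j (b j); exists (K' * K); first exact: mulr_gt0.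
exists (b j + D)%N => p; rewrite big_cons cabsM exprD mulrACA.
by apply: ler_pM; rewrite ?cabs_ge0.
Qed.

(** The derivatives [Dfact b] multiply the coefficients by a polynomial in
    [p], which their rapid decay absorbs. *)
Lemma fsymbol_S_class m t : (forall N, symb_upto Lam rho N m t) -> S_class Lam rho m (fsymbol t).
Proof.
move=> st; have ot := symb_upto_order (st 0%N).
split; first by move=> k; apply: torus_smooth_fser; exact: has_order_rapid ot.
move=> a b; rewrite (symbol_diff_fsymbol a ot).
have := symb_upto_order (symb_upto_diffm (index_enum 'I_n) a st 0%N).
set t' := (\big[comp/idfun]_(j < n) _) _ => ot'.
have [K K0 [D hD]] := ffsymb_prod_bound b.
have [C C0 hC] := ot' (n.*2 + D)%N.
exists (K * C * wmass R n) => [|k x]; first by rewrite !mulr_gt0 // wmass_gt0.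
have [c' [rc' -> ->]] := Dfact_fser b (has_order_rapid k ot').
rewrite mulrAC; apply: fser_norm => p; rewrite cabsM.
apply: (le_trans (ler_pM (cabs_ge0 _) (cabs_ge0 _) (hD p) (hC k p))).
have j0 := jap_gt0 R p; have jD := japX_gt0 R p D; have jn := japX_gt0 R p n.*2.
rewrite le_eqVlt; apply/orP; left; apply/eqP; rewrite /wt exprD /mlength.
by field; rewrite !gt_eqF.
Qed.

(** Fourier summation commutes with differences and with multiplication by
    [k_j]. *)
Lemma mclass_fsymbol_M_class m t : mclass Lam rho (index_enum 'I_n) m t ->
  M_class Lam rho m (fsymbol t).
Proof.
move=> st; have ot := mclass_order st; split.
  by move=> k; apply: torus_smooth_fser; exact: has_order_rapid ot.
move=> g; have sg := mclass_kdiff_words g st.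
have -> : (fun k x => monomial k g * symbol_diff g (fsymbol t) k x) =
    fsymbol ((\big[comp/idfun]_(j < n) (if g j then kdiff j else idfun)) t).
  apply/funext => k; apply/funext => x; rewrite /symbol_diff monomial_diffm.
  have [kap kap0 hkap] := has_order_mulk Lam_mod.
  have := @comp_big_morph_in coef ('rV[int]_n -> R[i]) 'I_n
    (fun t => exists m', has_order Lam m' t) (fun j => if g j then kdiff j else idfun)
    (fun j => if g j then kdiff1 j else idfun) (fun t l => fser (t l) x) (index_enum 'I_n) _ t.
  case=> [j u [m' ou]||_ /(congr1 (@^~ k)) <- //]; last by exists m.
  case: (g j); last by split => //; exists m'.
  split; first by exists (m' + kap); apply: hkap; exact: has_order_diffk.
  apply/funext => l; rewrite /kdiff1 /diff1 -fserB; try exact: has_order_rapid ou.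
  rewrite /fser -csumZ; first by congr csum; apply/funext => p; rewrite mulrA.
  exact: (fser_summable x (has_order_rapid l (has_order_diffk Lam_mod j ou))).
exact: fsymbol_S_class sg.
Qed.

End ClassM.

(** * Operators with a given coefficient array *)

Section Operators.
Variables (R : realType) (n : nat).
Implicit Types (p k q : 'rV[int]_n) (x : 'rV[R]_n) (s : symbol R n) (f c : 'rV[int]_n -> R[i]).
Local Notation coef := ('rV[int]_n -> 'rV[int]_n -> R[i]).
Implicit Types (t : coef).
Local Notation jap := (@jap R n).

Definition op_of t f : 'rV[int]_n -> R[i] := fun k => csum (fun p => t k p * f (k + p)).

Lemma schwartz_rapid f : schwartz f -> rapid f.
Proof.
move=> sf M; have [C hC] := sf M; exists ((`|C| + 1) * n.+1%:R ^+ M).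
  by rewrite mulr_gt0 ?exprn_gt0 // ltr_wpDl.
move=> k; have e0 : 0 < 1 + enorm k :> R by rewrite ltr_wpDr ?enorm_ge0.
have eM : (1 + enorm k) ^- M <= n.+1%:R ^+ M * jap k ^- M :> R.
  rewrite ler_pdivlMr ?japX_gt0 // mulrC ler_pdivrMr ?exprn_gt0 // -exprMn.
  by rewrite lerXn2r ?nnegrE ?jap_le_enorm ?jap_ge0 // mulr_ge0 // ltW.
apply: (le_trans (hC k)); apply: (@le_trans _ _ ((`|C| + 1) * (1 + enorm k) ^- M)).
  by rewrite ler_wpM2r ?invr_ge0 ?exprn_ge0 ?(ltW e0) // (le_trans (ler_norm C)) // lerDl.
by rewrite -mulrA ler_wpM2l // addr_ge0.
Qed.

Lemma rapid_shift k c : rapid c -> rapid (fun p => c (k + p)).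
Proof.
move=> rc M; have [C C0 hC] := rc M; exists (C * jap (- k) ^+ M).
  by rewrite mulr_gt0 // japX_gt0.
move=> p; apply: (le_trans (hC _)); rewrite -mulrA ler_pM2l //.
by rewrite addrC -{1}[k]opprK japXV_sub.
Qed.

Lemma rapid_opp c : rapid c -> rapid (fun p => c (- p)).
Proof. by move=> rc M; have [C C0 hC] := rc M; exists C => // p; rewrite -japN. Qed.

Lemma bounded_rapid_summable (u c : 'rV[int]_n -> R[i]) B : (forall p, cabs (u p) <= B) -> rapid c ->
  abs_summable (fun p => u p * c p).
Proof.
move=> uB rc; have [C C0 hC] := rapid_dominated rc.
apply: (@dominated_summable _ _ _ (B * C)) => p; rewrite cabsM -mulrA.
by apply: ler_pM; rewrite ?cabs_ge0.
Qed.

Lemma fourier_fser f : rapid f -> fourier f = fser (fun p => f (- p)).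
Proof.
move=> rf; apply/funext => x; rewrite /fourier /fser.
have sm : abs_summable (fun k => cis (- phase k x) * f k).
  by apply: (@bounded_rapid_summable _ _ 1) => // p; rewrite cabs_cis.
rewrite -(csum_reindex (h := -%R) (h' := -%R) _ _ sm); try exact: opprK.
by congr csum; apply/funext => p; rewrite /= mulrC phaseNl opprK.
Qed.

(** Expanding the Fourier series of [f] turns the operator with symbol [s]
    into summation against the Fourier coefficients of [s]. *)
Lemma pdo_op_of s f k : cbcont (s k) -> rapid f -> pdo s f k = op_of (fcoefs s) f k.
Proof.
move=> cs rf; rewrite /pdo (fourier_fser rf).
rewrite (torus_int_fser (cbcontM (character_cbcont R k) cs) (rapid_opp rf)).
have [B B0 hB] := cbcont_bound cs.
have sm : abs_summable (fun p => fcoefs s k p * f (k + p)).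
  apply: (@bounded_rapid_summable _ _ (B *+ 2)); last exact: rapid_shift.
  by move=> p; exact: fcoef_norm.
have hK : cancel (fun q => - (k + q)) (fun q => - (k + q)).
  by move=> q; rewrite opprD opprK addrA addNr add0r.
rewrite /op_of -(csum_reindex hK hK sm); congr csum; apply/funext => q /=.
rewrite opprD addrA subrr sub0r mulrC; congr (_ * _); congr torus_int; apply/funext => x.
by rewrite opprD !opprK characterD /character; ring.
Qed.

End Operators.

Section Composition.
Variables (R : realType) (n : nat) (Lam : 'rV[int]_n -> R).
Hypothesis Lam_mod : moderate Lam.
Implicit Types (p k q : 'rV[int]_n) (f : 'rV[int]_n -> R[i]) (m : R).
Local Notation coef := ('rV[int]_n -> 'rV[int]_n -> R[i]).
Implicit Types (t a b : coef).
Local Notation jap := (@jap R n).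

(** Rapid decay in [k] of the output is obtained from that of [f] by Peetre's
    inequality, at the cost of powers of [p] that [t k p] pays for. *)
Lemma op_of_dominated m t f : has_order Lam m t -> rapid f ->
  forall M, exists2 C : R, 0 < C & forall k p, cabs (t k p * f (k + p)) <= (C * jap k ^- M) * wt R p.
Proof.
move=> ot rf M; have [_ /(_ m) [B B0 [K hK]] _ _] := Lam_mod.
have [C C0 hC] := ot (n.*2 + (M + K))%N; have [D D0 hD] := rf (M + K)%N.
exists (C * (B * Lam 0 `^ m) * D) => [|k p].
  by rewrite !mulr_gt0 // (LamX_gt0 Lam_mod).
rewrite cabsM; apply: (le_trans (ler_pM (cabs_ge0 _) (cabs_ge0 _) (hC k p) (hD (k + p)))).
have h1 := hK 0 k; rewrite add0r in h1.
have h2 := japXV_sub R k (- p) (M + K); rewrite opprK japN in h2.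
have jp := jap_gt0 R p; have jk := jap_gt0 R k; have jX q N := japX_gt0 R q N.
apply: (@le_trans _ _ (C * (B * Lam 0 `^ m * jap k ^+ K) * jap p ^- (n.*2 + (M + K)) *
    (D * (jap p ^+ (M + K) * jap k ^- (M + K))))).
  have L0 := LamX_gt0 Lam_mod m; have C0' := ltW C0; have D0' := ltW D0.
  apply: ler_pM; rewrite ?ler_wpM2l ?ler_wpM2r ?mulr_ge0 ?invr_ge0 ?(ltW (jX _ _)) ?(ltW (L0 _)) //.
  by rewrite ler_wpM2l // (le_trans h1) // mulrA.
by rewrite le_eqVlt; apply/orP; left; apply/eqP; rewrite /wt !exprD; field; rewrite !gt_eqF.
Qed.

Lemma op_of_summable m t f k : has_order Lam m t -> rapid f ->
  abs_summable (fun p => t k p * f (k + p)).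
Proof.
by move=> ot rf; have [C _ hC] := op_of_dominated ot rf 0; exact: dominated_summable (hC k).
Qed.

Lemma op_of_rapid m t f : has_order Lam m t -> rapid f -> rapid (op_of t f).
Proof.
move=> ot rf M; have [C C0 hC] := op_of_dominated ot rf M.
exists (C * wmass R n) => [|k]; first by rewrite mulr_gt0 // wmass_gt0.
by rewrite mulrAC; exact: dominated_csum_le (hC k).
Qed.

Lemma op_of_comp m m' a b f k : has_order Lam m a -> has_order Lam m' b -> rapid f ->
  op_of (coef_comp a b) f k = op_of a (op_of b f) k.
Proof.
move=> oa ob rf; rewrite /op_of /coef_comp.
rewrite (triple_sum Lam_mod k oa (amplitude_comp Lam_mod ob) (rapid_shift k rf)).
by congr csum; apply/funext => q; congr (_ * csum _); apply/funext => r; rewrite addrA.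
Qed.

Lemma op_of_sub_onec m t f k : has_order Lam m t -> rapid f ->
  op_of t f k = f k + op_of (t - @onec R n) f k.
Proof.
move=> ot rf; have st := op_of_summable k ot rf.
have so := op_of_summable k (has_order_onec Lam) rf.
have -> : f k = op_of (@onec R n) f k.
  rewrite -[LHS](csum_delta (0 : 'rV[int]_n) (f k)); congr csum; apply/funext => p.
  by rewrite /onec; case: eqP => [->|_]; rewrite ?mul1r ?addr0 ?mul0r.
have sr : abs_summable (fun p => (t - @onec R n) k p * f (k + p)).
  have := abs_summableD st (abs_summableZ (-1) so).
  by congr abs_summable; apply/funext => p; rewrite coefDE coefNE; ring.
by rewrite /op_of -csumD //; congr csum; apply/funext => p; rewrite coefDE coefNE; ring.
Qed.

End Composition.

(** * Reciprocal of an elliptic symbol *)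

Section Reciprocal.
Variables (R : realType) (n : nat) (Lam : 'rV[int]_n -> R) (rho : R).
Hypothesis Lam_mod : moderate Lam.
Implicit Types (p k : 'rV[int]_n) (x : 'rV[R]_n) (m : R) (s : symbol R n).

Lemma sbounded_if (P : pred 'rV[int]_n) m s u : sbounded Lam m s -> sbounded Lam m u ->
  sbounded Lam m (fun k => if P k then s k else u k).
Proof.
move=> [cs [C C0 hC]] [cu [D D0 hD]]; split; first by move=> k; case: (P k).
exists (C + D) => [|k x]; first exact: addr_gt0.
rewrite mulrDl; case: (P k).
  by rewrite (le_trans (hC k x)) // lerDl mulr_ge0 ?powR_ge0 // ltW.
by rewrite (le_trans (hD k x)) // lerDr mulr_ge0 ?powR_ge0 // ltW.
Qed.

Lemma derivs_upto_if (P : pred 'rV[int]_n) j l m s u :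
  derivs_upto Lam j l m s -> derivs_upto Lam j l m u ->
  derivs_upto Lam j l m (fun k => if P k then s k else u k).
Proof.
elim: l s u => [|l IH] s u [sb hs] [ub hu]; split => //; try exact: sbounded_if.
have [ds [Ds hds]] := hs; have [du [Du hdu]] := hu.
by exists (fun k => if P k then ds k else du k); split; [move=> k; case: (P k)|exact: IH].
Qed.

Lemma sbounded_weight m : sbounded Lam m (fun k _ => Complex (Lam k `^ m) 0).
Proof.
split; first by move=> k; split; [exact: cbcont_cst|by []].
by exists 1 => // k x; rewrite cabs_real mul1r ger0_norm ?powR_ge0.
Qed.

Lemma derivs_upto_weight j l m : derivs_upto Lam j l m (fun k _ => Complex (Lam k `^ m) 0).
Proof.
have zero : derivs_upto Lam j l m (fun _ _ => 0).
  elim: l => [|l IH]; split => //; try by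
    split; [move=> k; split; [exact: cbcont_cst|by []]|
            exists 1 => // k x; rewrite cabs0 mul1r powR_ge0].
  by exists (fun _ _ => 0); split => // k; exact: cderiv_cst.
case: l zero => [|l] zero; split => //; try exact: sbounded_weight.
exists (fun _ _ => 0); split; last exact: derivs_upto_pred.
by move=> k; exact: cderiv_cst.
Qed.

(** Redefining the symbol as [Lam k `^ m] on the finitely many [k] where
    ellipticity says nothing makes it invertible everywhere, at the price of a
    residual array; the Fourier coefficients of the reciprocal then invert the
    array of the new symbol exactly for the pointwise product. *)
Lemma elliptic_reciprocal m s : (0 < n)%N -> S_class Lam rho m s -> M_elliptic Lam m s ->
  exists (a' b : 'rV[int]_n -> 'rV[int]_n -> R[i]), [/\ residual Lam (a' - fcoefs s), has_order Lam (- m) b & coef_conv a' b = @onec R n].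
Proof.
move=> n0 sS [C [R1 [C0 R10 ell]]]; pose j0 := Ordinal n0.
pose w := fun k (_ : 'rV[R]_n) => Complex (Lam k `^ m) 0.
pose s' := fun k => if R1 <= enorm k then s k else w k.
have ds j l : derivs_upto Lam j l m s.
  by have [_ _ /(_ j l)] := S_class_derivs_upto Lam_mod (fun=> 0%N) sS;
     rewrite symbol_diff0 mlength0 mulr0 subr0.
have sb : sbounded Lam m s := S_class_sbounded sS.
have sb' : sbounded Lam m s' := sbounded_if _ sb (sbounded_weight m).
have ds' j l : derivs_upto Lam j l m s' := derivs_upto_if _ (ds j l) (derivs_upto_weight j l m).
have low k x : Num.min C 1 * Lam k `^ m <= cabs (s' k x).
  have L0 := powR_ge0 (Lam k) m; rewrite /s'; case: ifPn => [h|_].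
    by rewrite (le_trans _ (ell k x h)) // ler_wpM2r // ge_min lexx.
  by rewrite cabs_real ger0_norm // -[leRHS]mul1r ler_wpM2r // ge_min lexx orbT.
have c0 : 0 < Num.min C 1 by rewrite lt_min C0 ltr01.
have Lam_gt0 k := LamX_gt0 Lam_mod m k.
have s'0 k x : s' k x != 0 by rewrite -cabs_gt0; apply: lt_le_trans (low k x); rewrite mulr_gt0.
have os := has_order_fcoefs Lam_mod sb ds; have os' := has_order_fcoefs Lam_mod sb' ds'.
pose v : symbol R n := fun k x => (s' k x)^-1.
have dv j l : derivs_upto Lam j l (- m) v := derivs_upto_reciprocal Lam_mod l c0 low (ds' j).
have ov := has_order_fcoefs Lam_mod (derivs_upto_bounded (dv j0 0%N)) dv.
exists (fcoefs s'), (fcoefs v); split=> //.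
  (* enorm k < R1 bounds len1 k *)
  apply: (bounded_support_residual Lam_mod (has_orderB os' os) (B := Num.bound (n.+1%:R * (1 + R1)))).
  move=> k p Bk; rewrite coefDE coefNE /fcoefs /s' ifT ?subrr //.
  have R1k : n.+1%:R * (1 + R1) < jap R k.
    apply: (lt_le_trans (archi_boundP _)); first by rewrite mulr_ge0 // addr_ge0 // ltW.
    by rewrite /jap ler_nat ltnW.
  have := lt_le_trans R1k (jap_le_enorm R k).
  by rewrite ltr_pM2l // ltrD2l => /ltW.
apply: coef_ext => k p; have [cs' _] := sb'; have [cs'k ps'k] := cs' k.
have [/(_ k)[cvk _] _] := derivs_upto_bounded (dv j0 0%N).
have rs' : rapid (fcoefs s' k) := has_order_rapid Lam_mod k os'.
(* Fourier inversion of s' k turns the convolution into the coefficients of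
   the product of s' k and its reciprocal *)
have := fcoef_mul_fser p cvk rs'; rewrite [fser _](fourier_inversion cs'k ps'k rs').
rewrite /coef_conv /twist => <-; transitivity (torus_int (@character R n (- p))).
  by congr torus_int; apply/funext => x; rewrite /v mulVf // mulr1.
by rewrite torus_int_character oppr_eq0.
Qed.

End Reciprocal.

(** * The parametrix *)

Theorem theorem4p7 (R : realType) (n : nat) (n_gt0 : (0 < n)%N)
    (mu0 mu1 mu C0 C1 : R) (Lam : 'rV[int]_n -> R)
    (Lam_weight : weight_function mu0 mu1 mu C0 C1 Lam)
    (rho : R) (rho_gt0 : 0 < rho) (rho_le : rho <= 1 / mu)
    (m : R) (sigma : symbol R n)
    (sigma_M : M_class Lam rho m sigma)
    (sigma_elliptic : M_elliptic Lam m sigma) :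
  exists tau : symbol R n,
    M_class Lam rho (- m) tau /\
    exists r s : symbol R n,
      [/\ M_class_infty Lam rho r,
          M_class_infty Lam rho s,
          forall f : 'rV[int]_n -> R[i], schwartz f ->
            forall k, pdo tau (pdo sigma f) k = f k + pdo r f k &
          forall f : 'rV[int]_n -> R[i], schwartz f ->
            forall k, pdo sigma (pdo tau f) k = f k + pdo s f k].
Proof.
have Lam_mod := weight_moderate Lam_weight; have rho_ge0 := ltW rho_gt0.
have sS := M_class_S_class sigma_M; have sa := M_class_mclass Lam_mod sigma_M.
have [a' [b [ra ob ab]]] := elliptic_reciprocal Lam_mod n_gt0 sS sigma_elliptic.
have [t [st rl rr]] := coefficient_parametrix Lam_mod rho_ge0 rho_gt0 sa ra ob ab.
set a := fcoefs sigma in sa rl rr; have oa := mclass_order sa; have ot := mclass_order st.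
have ota := has_order_comp Lam_mod ot oa; have oat := has_order_comp Lam_mod oa ot.
have cs k : cbcont (sigma k) by have [/(_ k)[]] := S_class_sbounded sS.
have pdo_t u m' f k : has_order Lam m' u -> rapid f -> pdo (fsymbol u) f k = op_of u f k.
  move=> ou rf; have ru l := has_order_rapid Lam_mod l ou.
  rewrite pdo_op_of //; last exact: fser_cbcont.
  by congr (op_of _ f k); apply: coef_ext => l p; exact: fcoef_fser.
have pdo_s f k : rapid f -> pdo sigma f k = op_of a f k by move=> rf; exact: pdo_op_of.
exists (fsymbol t); split; first exact: mclass_fsymbol_M_class.
exists (fsymbol (coef_comp t a - @onec R n)), (fsymbol (coef_comp a t - @onec R n)); split.
- by move=> r; apply: mclass_fsymbol_M_class => //; exact: residual_mclass.
- by move=> r; apply: mclass_fsymbol_M_class => //; exact: residual_mclass.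
- move=> f /schwartz_rapid rf k; rewrite (_ : pdo sigma f = op_of a f); last first.
    by apply/funext => l; exact: pdo_s.
  rewrite (pdo_t _ _ _ _ ot) ?(pdo_t _ _ _ _ (rl 0)) //; last exact: op_of_rapid oa rf.
  by rewrite -(op_of_comp Lam_mod k ot oa rf) (op_of_sub_onec Lam_mod k ota rf).
- move=> f /schwartz_rapid rf k; rewrite (_ : pdo (fsymbol t) f = op_of t f); last first.
    by apply/funext => l; exact: pdo_t ot rf.
  rewrite pdo_s ?(pdo_t _ _ _ _ (rr 0)) //; last exact: op_of_rapid ot rf.
  by rewrite -(op_of_comp Lam_mod k oa ot rf) (op_of_sub_onec Lam_mod k oat rf).
Qed.
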